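(* Assume that the summability exponent of the sequence $\boldsymbol b$ satisfies $p\in(0,\min\{\frac23,\frac1\beta\}]$, $p\neq\frac1\beta$, and fix $\boldsymbol\xi\in\Xi$. Let $\delta>0$ be arbitrary. Then generating vectors for the lattice rules can be constructed by the component-by-component (CBC) algorithm such that, for an appropriately chosen offset (lower level) $\ell_0^{(2)}$ of the inner rules, the sparse tensor product approximation $\mathcal Q_{L,1}(f)$ (i.e. with $\sigma=1$) of the double integral $$ \mathcal I_K=\int_{[-K,K]^k}g\bigg(\int_{\Theta_s}f(\boldsymbol\theta,\boldsymbol y)\,{\rm d}\boldsymbol\theta\bigg){\rm d}\boldsymbol y $$ satisfies $$ \sqrt{\mathbb E\big[|\mathcal I_K-\mathcal Q_{L,1}(f)|^2\big]}\le C'\,(2^L)^{-1+\delta}(L+1) $$ with a constant $C'>0$ independent of $L$, the expectation being over the random shifts.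
   Context: Notation: $g(x)=x\log x$; $f(\boldsymbol\theta,\boldsymbol y)=C_{k,\Gamma}{\rm e}^{-\frac12\|\boldsymbol y-G_s(\boldsymbol\theta,\boldsymbol\xi)\|_{\Gamma^{-1}}^2}$, $C_{k,\Gamma}=(\det(2\pi\Gamma))^{-1/2}$, $\|\boldsymbol x\|_{\Gamma^{-1}}=\sqrt{\boldsymbol x^{\rm T}\Gamma^{-1}\boldsymbol x}$; $\|\cdot\|$ is the Euclidean norm; $|\boldsymbol\nu|=\sum_j\nu_j$, $\boldsymbol b^{\boldsymbol\nu}=\prod_jb_j^{\nu_j}$. Standing assumptions: $k,s\in\mathbb N$, $K>0$; $\Xi$ is a compact subset of a Euclidean space; $\Theta_s=[-\frac12,\frac12]^s$. $\Gamma\in\mathbb R^{k\times k}$ is symmetric positive definite and $0<\mu_{\min}\le1$ is a lower bound on its smallest eigenvalue. $C\ge1$, $\beta\ge1$ are constants and $\boldsymbol b=(b_j)_{j\ge1}\in\ell^p(\mathbb N)$, $p\in(0,1)$, is a sequence of nonnegative reals, all independent of $s$ and $\boldsymbol\xi$. The forward models $G_s:\Theta_s\times\Xi\to\mathbb R^k$ are smooth in $\boldsymbol\theta$ and satisfy $\|\partial^{\boldsymbol\nu}_{\boldsymbol\theta}G_s(\boldsymbol\theta,\boldsymbol\xi)\|\le C(|\boldsymbol\nu|!)^\beta\boldsymbol b^{\boldsymbol\nu}$ for all $\boldsymbol\theta\in\Theta_s$, $\boldsymbol\nu\in\mathbb N_0^s$, $\boldsymbol\xi\in\Xi$. Cubature: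 $Q^{(1)}_\ell F=(2K)^k2^{-\ell}\sum_{i=1}^{2^\ell}F\big(2K\{i\boldsymbol z/2^\ell+\boldsymbol\Delta\}-K\mathbf 1\big)$ with $\boldsymbol z\in\mathbb N^k$ a generating vector, $\{\cdot\}$ the componentwise fractional part, $\boldsymbol\Delta\sim\mathcal U([0,1]^k)$. For an offset $\ell_0^{(2)}\in\mathbb N_0$, $Q^{(2)}_\ell F=2^{-m}\sum_{i=1}^{2^{m}}F\big(\{i\boldsymbol z'/2^{m}+\boldsymbol\Delta'\}-\tfrac12\mathbf 1\big)$, $m=\ell+\ell_0^{(2)}$, with $\boldsymbol z'\in\mathbb N^s$ and an independent shift $\boldsymbol\Delta'\sim\mathcal U([0,1]^s)$. Difference operators: $\Delta^{(1)}_\ell F=Q^{(1)}_\ell F-Q^{(1)}_{\ell-1}F$ for $\ell\ge1$, $\Delta^{(1)}_0F=Q^{(1)}_0F$; $\Delta^{(2)}_\ell(F)=g(Q^{(2)}_\ell F)-g(Q^{(2)}_{\ell-1}F)$ for $\ell\ge1$, $\Delta^{(2)}_0(F)=g(Q^{(2)}_0F)$. Superscript $(2)$ operators act on $\boldsymbol\theta$ for fixed $\boldsymbol y$, superscript $(1)$ operators act on $\boldsymbol y$. For $L\in\mathbb N_0$, $\mathcal Q_{L,1}(f)=\sum_{\ell_1+\ell_2\le L}\Delta^{(1)}_{\ell_1}\Delta^{(2)}_{\ell_2}(f)$, sum over $\ell_1,\ell_2\in\mathbb N_0$. CBC algorithm: given positive weights $(\gamma_{\mathfrak u})_{\mathfrak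 u\subseteq\{1,\dots,d\}}$ and $n=2^m$ points, put $z_1=1$ and for $j=2,\dots,d$ successively choose $z_j\in\{1,\dots,n\}$ coprime to $n$ minimizing, with $z_1,\dots,z_{j-1}$ fixed, the squared shift-averaged worst-case error $\sum_{\varnothing\ne\mathfrak u\subseteq\{1,\dots,j\}}\gamma_{\mathfrak u}\frac1n\sum_{i=1}^n\prod_{l\in\mathfrak u}B_2(\{iz_l/n\})$, $B_2(x)=x^2-x+\frac16$, in the unanchored weighted Sobolev space. *)

(* Defs.v *)
From HB Require Import structures.
From mathcomp Require Import all_boot all_order all_algebra.
From mathcomp Require Import all_classical all_reals all_analysis.
Set Implicit Arguments.
Unset Strict Implicit.
Unset Printing Implicit Defensive.
Import Order.TTheory GRing.Theory Num.Theory.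
Import numFieldNormedType.Exports.
Local Open Scope classical_set_scope.
Local Open Scope ring_scope.

(* Points of R^n are column vectors; measurable structure is carried by
   n.-tuple R, the type on which the library puts the product sigma-algebra. *)
Definition vec (R : realType) n (t : n.-tuple R) : 'cV[R]_n :=
  \col_i tnth t i.

Definition box (R : realType) n (a b : R) : set (n.-tuple R) :=
  [set t | forall i, a <= tnth t i <= b].
Arguments box {R} n a b.

Section sigma_finite_bundle.
Context d (T : measurableType d) (R : realType).
Variables (nu : {measure set T -> \bar R}) (nu_sf : sigma_finite setT nu).

Let mu : set T -> \bar R := nu.
HB.instance Definition _ := Measure.on mu.
HB.instance Definition _ := Measure_isSigmaFinite.Build _ _ _ mu nu_sf.

Lemma sigma_finite_bundle :
  {mu : {sigma_finite_measure set T -> \bar R} | mu = nu :> (set _ -> \bar R)}.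
Proof. by exists mu. Qed.

End sigma_finite_bundle.

Section lebesgue_n.
Variable R : realType.
Local Open Scope ereal_scope.

Definition cons_pair n (x : (measurableTypeR R * n.-tuple R)%type) : n.+1.-tuple R :=
  [the n.+1.-tuple R of x.1 :: x.2].

Fixpoint lebesgue_measure_n n : set (n.-tuple R) -> \bar R :=
  match n with
  | 0%N => \d_([tuple] : 0.-tuple R)
  | n'.+1 => pushforward (@lebesgue_measure R \x @lebesgue_measure_n n')
                         (@cons_pair n')
  end.
Arguments lebesgue_measure_n : clear implicits.

Lemma measurable_cons_pair (n : nat) :
  measurable_fun [set: (measurableTypeR R * n.-tuple R)%type] (@cons_pair n).
Proof. exact: measurable_cons. Qed.

Let uncons n (t : n.+1.-tuple R) :
    (measurableTypeR R * n.-tuple R)%type :=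
  (thead t, [tuple of behead t]).

Let consK n : cancel (@cons_pair n) (@uncons n).
Proof. by move=> [x t]; congr pair; apply/val_inj. Qed.

Let measurable_uncons n : measurable_fun [set: n.+1.-tuple R] (@uncons n).
Proof.
apply: measurable_fun_pair; first exact: (measurable_tnth ord0).
exact: measurable_behead.
Qed.

Let lebesgue_measure_n_bundle n :
  {mu : {sigma_finite_measure set (n.-tuple R) -> \bar R} |
    mu = lebesgue_measure_n n :> (set _ -> \bar R)}.
Proof.
elim: n => [|n [mu muE]].
  by exists (\d_([tuple] : 0.-tuple R)).
rewrite /= -muE.
pose mu2 := [the {measure set _ -> \bar R} of @lebesgue_measure R \x mu].
pose nu := measure_function_pushforward__canonical__measure_function_Measure
  mu2 (@measurable_cons_pair n).
have nu_sf : sigma_finite setT nu.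
  have /sigma_finiteP[F [TF ndF Foo]] := sigma_finiteT (@lebesgue_measure R).
  have /sigma_finiteP[G [TG ndG Goo]] := sigma_finiteT mu.
  exists (fun i => @uncons n @^-1` (F i `*` G i)).
    rewrite -preimage_bigcup (_ : \bigcup_i _ = setT) ?preimage_setT//.
    apply/seteqP; split=> // -[x y] _.
    have [i _ Fx] : (\bigcup_i F i) x by rewrite -TF.
    have [j _ Gy] : (\bigcup_i G i) y by rewrite -TG.
    exists (maxn i j) => //; split.
    - by move: x Fx; exact/subsetPset/ndF/leq_maxl.
    - by move: y Gy; exact/subsetPset/ndG/leq_maxr.
  move=> i; have [? ?] := Foo i; have [? ?] := Goo i; split.
    by rewrite -[X in measurable X]setTI; apply: measurable_uncons => //;
      exact: measurableX.
  rewrite /nu /= /pushforward (_ : _ @^-1` _ = F i `*` G i); last first.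
    by apply/funext => x; rewrite /preimage /mkset consK.
  by rewrite product_measure1E// lte_mul_pinfty// ge0_fin_numE.
have [nu' nu'E] := sigma_finite_bundle nu_sf.
by exists nu'.
Qed.

Let lebesgue_measure_n0 n : lebesgue_measure_n n set0 = 0.
Proof. by case: (lebesgue_measure_n_bundle n) => mu <-; rewrite measure0. Qed.

Let lebesgue_measure_n_ge0 n A : 0 <= lebesgue_measure_n n A.
Proof. by case: (lebesgue_measure_n_bundle n) => mu <-. Qed.

Let lebesgue_measure_n_sigma_additive n :
  semi_sigma_additive (lebesgue_measure_n n).
Proof.
by case: (lebesgue_measure_n_bundle n) => mu <-;
  exact: measure_semi_sigma_additive.
Qed.

HB.instance Definition _ n := isMeasure.Build _ _ _ (lebesgue_measure_n n)
  (@lebesgue_measure_n0 n) (@lebesgue_measure_n_ge0 n)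
  (@lebesgue_measure_n_sigma_additive n).

Let lebesgue_measure_n_sigma_finite n :
  sigma_finite setT (lebesgue_measure_n n).
Proof.
by case: (lebesgue_measure_n_bundle n) => mu <-; exact: sigma_finiteT.
Qed.

HB.instance Definition _ n := Measure_isSigmaFinite.Build _ _ _
  (lebesgue_measure_n n) (@lebesgue_measure_n_sigma_finite n).

Lemma measurable_box n (a b : R) : measurable (box n a b).
Proof.
rewrite (_ : box n a b =
  \bigcap_(i in [set: 'I_n]) (fun t : n.-tuple R => tnth t i) @^-1` `[a, b]).
  apply: fin_bigcap_measurable => // i _; rewrite -[X in measurable X]setTI.
  exact: (measurable_tnth i).
apply/seteqP; split=> [t tab i _|t tab i] /=; first by rewrite in_itv; exact: tab.
by have := tab i Logic.I; rewrite /= in_itv.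
Qed.

Lemma lebesgue_measure_n_box n (a b : R) : (a <= b)%R ->
  lebesgue_measure_n n (box n a b) = ((b - a) ^+ n)%:E.
Proof.
move=> ab; elim: n => [|n IHn].
  by rewrite /= expr0 diracE mem_set//= => -[].
rewrite /= /pushforward (_ : _ @^-1` _ = `[a, b] `*` box n a b); last first.
  apply/seteqP; split=> [[x t] /= xt|[x t] /= [xab tab] i].
    split; first by have := xt ord0; rewrite tnth0 in_itv.
    by move=> i; have := xt (lift ord0 i); rewrite tnthS.
  case: (unliftP ord0 i) => [j ->|->]; first by rewrite tnthS.
  by rewrite tnth0; rewrite in_itv in xab.
rewrite product_measure1E//=; last exact: measurable_box.
rewrite IHn lebesgue_measure_itv/= lte_fin; case: ltP => ba.
  by rewrite -EFinD -EFinM exprS.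
have -> : a = b by apply/le_anti; rewrite ab ba.
by rewrite mul0e subrr exprS mul0r.
Qed.
End lebesgue_n.
Arguments lebesgue_measure_n {R} n.

Section calculus.
Variable R : realType.

Definition enorm n (x : 'cV[R]_n) : R := Num.sqrt (\sum_i x i ord0 ^+ 2).

Definition cube s : set 'cV[R]_s :=
  [set x | forall j, - 2^-1 <= x j ord0 <= 2^-1].

Definition diff_quot s k (j : 'I_s) (F : 'cV[R]_s -> 'cV[R]_k)
    (x : 'cV[R]_s) (h : R) : 'cV[R]_k :=
  h^-1 *: (F (x + h *: delta_mx j ord0) - F x).

(* The increments h -> 0, h <> 0, for which x + h e_j stays in D: derivatives
   of a function given on D only are one-sided on the boundary. *)
Definition increments s (D : set 'cV[R]_s) (j : 'I_s) (x : 'cV[R]_s) :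
    set_system R :=
  within [set h | D (x + h *: delta_mx j ord0)] 0^'.

Definition partial_in s k (D : set 'cV[R]_s) (j : 'I_s)
    (F : 'cV[R]_s -> 'cV[R]_k) (x : 'cV[R]_s) : 'cV[R]_k :=
  lim (diff_quot j F x h @[h --> increments D j x]).

Definition partials_in s k (D : set 'cV[R]_s) (w : seq 'I_s)
    (F : 'cV[R]_s -> 'cV[R]_k) : 'cV[R]_s -> 'cV[R]_k :=
  foldr (partial_in D) F w.

(* all iterated partial derivatives exist and are continuous on D *)
Definition smooth_in s k (D : set 'cV[R]_s) (F : 'cV[R]_s -> 'cV[R]_k) :=
  forall w : seq 'I_s,
    {within D, continuous (partials_in D w F)} /\
    forall j x, D x ->
      cvg (diff_quot j (partials_in D w F) x h @[h --> increments D j x]).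

Definition mixed_partial s k (D : set 'cV[R]_s) (nu : 'I_s -> nat)
    (F : 'cV[R]_s -> 'cV[R]_k) : 'cV[R]_s -> 'cV[R]_k :=
  partials_in D (flatten [seq nseq (nu j) j | j <- enum 'I_s]) F.

End calculus.
Arguments cube {R} s.

Section model.
Variable R : realType.

Definition xlogx (x : R) : R := x * ln x.

Definition posdef k (A : 'M[R]_k) :=
  A^T = A /\ forall x : 'cV[R]_k, x != 0 -> 0 < (x^T *m A *m x) ord0 ord0.

Definition wnorm k (A : 'M[R]_k) (x : 'cV[R]_k) : R :=
  Num.sqrt ((x^T *m A *m x) ord0 ord0).

Definition likelihood s k (Gamma : 'M[R]_k) (G : 'cV[R]_s -> 'cV[R]_k)
    (theta : 'cV[R]_s) (y : 'cV[R]_k) : R :=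
  (\det ((2 * pi) *: Gamma)) `^ (- 2^-1) *
  expR (- 2^-1 * wnorm (invmx Gamma) (y - G theta) ^+ 2).

Definition double_integral s k (K : R) (f : 'cV[R]_s -> 'cV[R]_k -> R) : R :=
  \int[lebesgue_measure_n k]_(y in box k (- K) K)
    xlogx (\int[lebesgue_measure_n s]_(t in box s (- 2^-1) 2^-1)
             f (vec t) (vec y)).

End model.

Section cubature.
Variable R : realType.

Definition frac (x : R) : R := x - (Num.floor x)%:~R.

(* {i z / n + Delta} *)
Definition lattice_point d (n : nat) (z : 'I_d -> nat) (Delta : 'cV[R]_d)
    (i : nat) : 'cV[R]_d :=
  \col_j frac (i%:R * (z j)%:R / n%:R + Delta j ord0).

(* In Q1 and Q2, z m is the generating vector of the rule with 2^m points. *)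
Definition Q1 k (K : R) (z : nat -> 'I_k -> nat) (Delta : 'cV[R]_k)
    (l : nat) (F : 'cV[R]_k -> R) : R :=
  (2 * K) ^+ k * 2 ^- l *
  \sum_(1 <= i < (2 ^ l).+1)
    F ((2 * K) *: lattice_point (2 ^ l) (z l) Delta i - const_mx K).

Definition Q2 s (l0 : nat) (z : nat -> 'I_s -> nat) (Delta : 'cV[R]_s)
    (l : nat) (F : 'cV[R]_s -> R) : R :=
  let m := (l + l0)%N in
  2 ^- m *
  \sum_(1 <= i < (2 ^ m).+1)
    F (lattice_point (2 ^ m) (z m) Delta i - const_mx 2^-1).

Definition Diff1 k (K : R) z Delta (l : nat) (F : 'cV[R]_k -> R) : R :=
  if l is l'.+1 then Q1 K z Delta l F - Q1 K z Delta l' F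
  else Q1 K z Delta 0 F.

Definition Diff2 s (l0 : nat) z Delta (l : nat) (F : 'cV[R]_s -> R) : R :=
  if l is l'.+1 then xlogx (Q2 l0 z Delta l F) - xlogx (Q2 l0 z Delta l' F)
  else xlogx (Q2 l0 z Delta 0 F).

(* the sparse tensor product approximation with sigma = 1 *)
Definition sparse_Q s k (K : R) (l0 : nat)
    (z1 : nat -> 'I_k -> nat) (z2 : nat -> 'I_s -> nat)
    (Delta1 : 'cV[R]_k) (Delta2 : 'cV[R]_s) (L : nat)
    (f : 'cV[R]_s -> 'cV[R]_k -> R) : R :=
  \sum_(l1 < L.+1) \sum_(l2 < L.+1 | (l1 + l2 <= L)%N)
    Diff1 K z1 Delta1 l1 (fun y =>
      Diff2 l0 z2 Delta2 l2 (fun theta => f theta y)).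

End cubature.

Section cbc.
Variables (R : realType) (d : nat) (gamma : {set 'I_d} -> R) (n : nat).

Definition bernoulli2 (x : R) : R := x ^+ 2 - x + 6^-1.

(* Squared shift-averaged worst-case error of the first j + 1 components of z
   (coordinates are numbered from 0). *)
Definition sq_error (j : 'I_d) (z : 'I_d -> nat) : R :=
  \sum_(u : {set 'I_d} | (u != finset.set0) && [forall l in u, (l <= j)%N])
    gamma u * (n%:R^-1 *
      \sum_(1 <= i < n.+1)
        \prod_(l in u) bernoulli2 (frac (i%:R * (z l)%:R / n%:R))).

Definition candidate (c : nat) := [&& (1 <= c)%N, (c <= n)%N & coprime c n].

Definition update (z : 'I_d -> nat) (j : 'I_d) (c : nat) : 'I_d -> nat :=
  fun l => if l == j then c else z l.

(* z is a possible output of the CBC algorithm, whatever the tie-breaking *)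
Definition cbc_output (z : 'I_d -> nat) :=
  forall j : 'I_d,
    if j == 0%N :> nat then z j = 1%N
    else candidate (z j) /\
         forall c, candidate c -> sq_error j z <= sq_error j (update z j c).

Lemma eq_sq_error (j : 'I_d) (z z' : 'I_d -> nat) :
  (forall l : 'I_d, (l <= j)%N -> z l = z' l) -> sq_error j z = sq_error j z'.
Proof.
move=> zz'; apply: eq_bigr => u /andP[_ /forall_inP uj].
by congr (_ * (_ * _)); apply: eq_bigr => i _; apply: eq_bigr => l /uj /zz' ->.
Qed.

Lemma cbc_output_exists : (0 < n)%N -> exists z, cbc_output z.
Proof.
move=> n0; pose ok z (j : 'I_d) :=
  if j == 0%N :> nat then z j = 1%N
  else candidate (z j) /\
       forall c, candidate c -> sq_error j z <= sq_error j (update z j c).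
suff H i : (i <= d)%N -> exists z, forall j : 'I_d, (j < i)%N -> ok z j.
  by have [z zP] := H d (leqnn d); exists z => j; exact: zP.
elim: i => [_|i IHi id]; first by exists (fun=> 0%N).
have [z zP] := IHi (ltnW id); pose j0 := Ordinal id.
suff [c cP] : exists c, ok (update z j0 c) j0.
  exists (update z j0 c) => j; rewrite ltnS leq_eqVlt => /orP[/eqP ji|ji].
    by rewrite (_ : j = j0)//; exact/val_inj.
  have ne (l : 'I_d) : (l <= j)%N -> (l == i :> nat) = false.
    by move=> lj; apply/ltn_eqF/(leq_ltn_trans lj).
  have upE (l : 'I_d) : (l <= j)%N -> update z j0 c l = z l.
    by move=> lj; rewrite /update -val_eqE /= ne.
  have := zP _ ji; rewrite /ok upE//; case: ifP => // _ [zc zmin]; split=> // b bc.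
  rewrite (eq_sq_error upE).
  have -> : sq_error j (update (update z j0 c) j b) = sq_error j (update z j b).
    apply: eq_sq_error => l lj; rewrite /update; case: eqP => // _.
    by rewrite -val_eqE /= ne.
  exact: zmin.
rewrite /ok /=; case: eqP => [i0|_].
  by exists 1%N; rewrite /update eqxx.
have c1 : candidate (inord 1 : 'I_n.+1) by rewrite inordK// /candidate n0 coprime1n.
have [c cc cmin] := @arg_minP _ _ _ (inord 1 : 'I_n.+1)
  (fun c : 'I_n.+1 => candidate c) (fun c => sq_error j0 (update z j0 c)) c1.
exists c; rewrite {1}/update eqxx; split=> // b bc.
rewrite [leRHS](@eq_sq_error j0 _ (update z j0 b)); last first.
  by move=> l _; rewrite /update; case: eqP.
have bn : (b < n.+1)%N by case/and3P: bc.
exact: (cmin (Ordinal bn)).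
Qed.

End cbc.

Section shifts.
Context d (Omega : measurableType d) (R : realType).
Variable P : probability Omega R.

Definition uniform01 n (X : {RV P >-> n.-tuple R}) :=
  forall A, measurable A ->
    distribution P X A = lebesgue_measure_n n (A `&` box n 0 1).

Definition independent_rv m n
    (X : {RV P >-> m.-tuple R}) (Y : {RV P >-> n.-tuple R}) :=
  forall A B, measurable A -> measurable B ->
    P (X @^-1` A `&` Y @^-1` B) = (P (X @^-1` A) * P (Y @^-1` B))%E.

End shifts.

(* Main.v *)
(* The dimensions are fixed, so all weights may be taken equal to 1 and the offset
   to be 0; the bounds on the derivatives then only matter through the finitely
   many mixed derivatives of order at most one in each variable, and these control
   all mixed first differences (predicate [mix]) of f on the unit cube.  The class
   [mix] is stable under products, inverses, exp, ln and x log x away from 0, and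
   under applying a linear functional to some of the variables.

   If F has mixed differences bounded by M, the error of a cubature rule with
   points x_i and weights c_i summing to 1 satisfies
     error^2 <= 2^d M^2 sum_ij c_i c_j (prod_l (1 + kappa (x_il, x_jl)) - 1)
   with kappa the kernel of the unanchored space; this follows from the discrete
   ANOVA decomposition on a grid, by Cauchy-Schwarz and refinement of the grid.
   Averaging over the shift turns the right-hand side into the CBC criterion.

   For CBC the kernel is expanded, on the n points, into a cosine sum with
   nonnegative coefficients.  In each step the minimum is at most the value for
   every candidate, so its square root is at most the average of the square roots;
   as sqrt (sum a) <= sum (sqrt a), a count of the candidates solving a congruence
   gives the rate log^c n / n for the root of the criterion.

   Since sum_(l1 + l2 <= L) telescopes in l1, the error of the sparse rule is
   I (Z - Z_L) + sum_l (I - Q1_(L - l)) (Z_l - Z_(l - 1)) with Z_l the inner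
   approximation at level l.  The l-th mean square is O(2^(-2 (1 - delta) L)) by
   independence of the two shifts, and there are L + 2 terms. *)

From Pilot Require Import Defs.
From HB Require Import structures.
From mathcomp Require Import all_boot all_order all_algebra.
From mathcomp Require Import all_classical all_reals all_analysis.
From mathcomp Require Import measurable_realfun ring lra zify.
Set Implicit Arguments.
Unset Strict Implicit.
Unset Printing Implicit Defensive.
Import Order.TTheory GRing.Theory Num.Theory.
Import numFieldNormedType.Exports.
(* Restores [Defs.frac], hidden by MathComp's fraction field library. *)
Import Pilot.Defs.
Local Open Scope classical_set_scope.
Local Open Scope ring_scope.

(** * Component-by-component construction *)

(** Two points shape the argument. The criterion has to decay like n^-2 up to logarithms, but
    averaging it over the candidates yields only about n^-1. Averaging its root and squaring
    afterwards yields n^-2, at the price of a sum of roots of Fourier coefficients. These roots are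
    of order 1/h, not summable over all frequencies; the exact expansion on n points has finitely
    many of them, so the sum is of order log n, and powers of log n are absorbed by 2^(delta m).

    The other point is that the inner error is itself integrated by the outer rule. It is therefore
    bounded in the class [mix] as a function of y, by a constant times the root of [lat_gap] at the
    inner shift. Each squared mixed term is then at most a product with one factor per shift. This
    requires mixed differences of f jointly in y and theta, and a positive lower bound of f that
    keeps the logarithm away from its singularity. Differences are preferred to derivatives because
    the same bounds pass to cubature sums, integrals and pointwise limits. *)

Section cosine_sums.
Variable R : realType.

(** With y = x / 2, sin x = 2 sin y cos y, where sin y >= y cos y by the mean value theorem and
    cos^2 y >= 1/2 because cos (2 y) >= 0. Weaker than Jordan's inequality, but enough for n sin (pi
    k / n) >= k. *)
Lemma sin_ge_half (x : R) : 0 <= x <= pi / 2 -> x / 2 <= sin x.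
Proof.
case/andP => x0 xpi; pose y := x / 2.
have y0 : 0 <= y by rewrite divr_ge0.
have y2 : y *+ 2 = x by rewrite /y; field.
have sy : y * cos y <= sin y.
  move: y0; rewrite le_eqVlt => /predU1P[<-|y0]; first by rewrite mul0r sin0.
  have [|c cy] := @MVT R sin cos 0 y y0 (fun z _ => is_derive_sin z).
    by apply: continuous_subspaceT => z; exact: continuous_sin.
  rewrite sin0 !subr0 => ->; rewrite mulrC ler_wpM2r ?(ltW y0)//.
  move: cy; rewrite in_itv /= => /andP[c0 cy].
  have p0 := @pi_gt0 R.
  rewrite ltW// ltr_cos ?in_itv//=; apply/andP; split; rewrite /y in cy *; lra.
have cy0 : 0 <= cos y.
  by apply: cos_ge0_pihalf; have p0 := @pi_gt0 R; rewrite /y; apply/andP; split; lra.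
have cy2 : 2^-1 <= cos y ^+ 2.
  have : 0 <= cos (y *+ 2).
    have p0 := @pi_gt0 R.
    by apply: cos_ge0_pihalf; rewrite y2; apply/andP; split; lra.
  by rewrite cos_mulr2n; lra.
rewrite -/y -y2 sin_mulr2n.
have := ler_wpM2l cy0 sy; have := ler_wpM2l y0 cy2; rewrite expr2; lra.
Qed.

Definition cosn (n k : nat) : R := cos (2 * pi * k%:R / n%:R).

Lemma cosnDn n k : (0 < n)%N -> cosn n (k + n) = cosn n k.
Proof.
move=> n0; rewrite /cosn natrD mulrDr mulrDl mulfK ?pnatr_eq0 -?lt0n//.
by rewrite mulr_natl cosD2pi.
Qed.

Lemma cosnDM n k q : (0 < n)%N -> cosn n (k + q * n) = cosn n k.
Proof.
move=> n0; elim: q => [|q IH]; first by rewrite addn0.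
by rewrite mulSn addnCA addnC cosnDn.
Qed.

Lemma cosn_mod n k : (0 < n)%N -> cosn n (k %% n) = cosn n k.
Proof. by move=> n0; rewrite {2}(divn_eq k n) addnC cosnDM. Qed.

Lemma cosn0 n : cosn n 0 = 1.
Proof. by rewrite /cosn mulr0 mul0r cos0. Qed.

Lemma cosnM n a b i : (0 < n)%N -> cosn n (a * i) * cosn n (b * i) =
  2^-1 * (cosn n ((a + b) * i) + cosn n ((a + n.-1 * b) * i)).
Proof.
move=> n0; pose x : R := 2 * pi * (a * i)%:R / n%:R.
pose y : R := 2 * pi * (b * i)%:R / n%:R.
have E1 : cosn n ((a + b) * i) = cos (x + y).
  by rewrite /cosn /x /y mulnDl natrD mulrDr mulrDl.
have E2 : cosn n ((a + n.-1 * b) * i) = cos (x - y).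
  have -> : cos (x - y) = cos (x - y + (b * i)%:R * (pi *+ 2)).
    elim: (b * i)%N => [|q IH]; first by rewrite mul0r addr0.
    by rewrite -natr1 mulrDl mul1r addrA cosD2pi.
  congr cos; rewrite /x /y -mulr_natr mulnDl natrD.
  have -> : (n.-1 * b * i)%:R = (n%:R - 1) * (b * i)%:R :> R.
    by rewrite -mulnA natrM -(prednK n0) -(natr1 n.-1) addrK.
  have : n%:R != 0 :> R by rewrite pnatr_eq0 -lt0n.
  by move: (n%:R) (pi) => N p N0; field.
by rewrite E1 E2 -/(cosn n _) /cosn -/x -/y cosB cosD; field.
Qed.

Lemma sin_pi_gt0 n h : (0 < h < n)%N -> 0 < sin (pi * h%:R / n%:R : R).
Proof.
case/andP => h0 hn; have n0 : 0 < n%:R :> R by rewrite ltr0n (ltn_trans h0).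
apply: sin_gt0_pi; apply/andP; split.
  by rewrite divr_gt0// mulr_gt0 ?pi_gt0 ?ltr0n.
by rewrite ltr_pdivrMr// ltr_pM2l ?pi_gt0// ltr_nat.
Qed.

Lemma cosn_sum n h : (0 < n)%N ->
  \sum_(1 <= i < n.+1) cosn n (h * i) = n%:R * (n %| h)%N%:R.
Proof.
move=> n0; case: (boolP (n %| h)%N) => nh.
  rewrite mulr1; under eq_bigr => i _.
    by rewrite -(cosn_mod _ n0) (eqP (dvdn_mulr _ nh)) cosn0; over.
  by rewrite sumr_const_nat subSS subn0.
rewrite mulr0; set r := (h %% n)%N.
have r0 : (0 < r < n)%N by rewrite ltn_mod n0 andbT lt0n.
have sr := sin_pi_gt0 r0.
under eq_bigr => i _ do rewrite -(cosn_mod _ n0) -modnMml (cosn_mod _ n0) -/r.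
apply: (mulfI (lt0r_neq0 sr)); rewrite mulr0 mulr_sumr.
(* Dirichlet kernel trick: with u = pi r / n, [g i.+1 - g i] is sin u cos (2 i u). The two ends of
   the telescoping sum agree, their arguments differing by r full turns. *)
pose g i : R := 2^-1 * sin (pi * r%:R / n%:R * (2 * i%:R - 1)).
rewrite (eq_bigr (fun i => g i.+1 - g i)) => [|i _].
  rewrite telescope_sumr// /g -mulrBr -(natr1 n).
  have -> : pi * r%:R / n%:R * (2 * (n%:R + 1) - 1) =
     pi * r%:R / n%:R * (2 * 1 - 1) + r%:R * (2 * pi) :> R.
    have : n%:R != 0 :> R by rewrite pnatr_eq0 -lt0n.
    by move: (n%:R) (pi) => N p N0; field.
  have -> : forall (x : R) k, sin (x + k%:R * (2 * pi)) = sin x.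
    move=> x; elim=> [|k IH]; first by rewrite mul0r addr0.
    by rewrite -natr1 -IH -[RHS]sinD2pi mulr2n; congr sin; ring.
  by rewrite subrr mulr0.
rewrite /g /cosn natrM -(natr1 i).
set u := pi * _ / _; have -> : 2 * pi * (r%:R * i%:R) / n%:R = 2 * i%:R * u.
  by rewrite /u; ring.
have -> : u * (2 * (i%:R + 1) - 1) = 2 * i%:R * u + u by ring.
have -> : u * (2 * i%:R - 1) = 2 * i%:R * u - u by ring.
by rewrite sinD sinB; field.
Qed.

End cosine_sums.

Section bernoulli_cosine.
Variable R : realType.
Implicit Types J : seq (R * nat).

(* [J] lists the pairs (coefficient, frequency) of a cosine sum on n points. *)
Definition cosev n J (i : nat) : R := \sum_(q <- J) q.1 * cosn R n (q.2 * i).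

Definition sqrtnorm J : R := \sum_(q <- J) Num.sqrt q.1.

Definition nneg_coefs J := all (fun q => 0 <= q.1) J.

Definition dilate z J := [seq (q.1, z * q.2)%N | q <- J].

(* cos A cos B = (cos (A + B) + cos (A - B)) / 2, with (n - 1) h for - h mod n. *)
Definition cosmul n J J' :=
  [seq (q.1 * q'.1 / 2, (q.2 + q'.2)%N) | q <- J, q' <- J'] ++
  [seq (q.1 * q'.1 / 2, (q.2 + n.-1 * q'.2)%N) | q <- J, q' <- J'].

(* The n-point discrete Fourier coefficients of B_2; see [bernoulli2_cosev]. *)
Definition b2coef n h : R := (2 * n%:R ^+ 2 * sin (pi * h%:R / n%:R) ^+ 2)^-1.

Definition b2coefs n : seq (R * nat) :=
  ((6 * n%:R ^+ 2)^-1, 0%N) :: [seq (b2coef n h, h) | h <- index_iota 1 n].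

Lemma cosev_mul n J J' i : (0 < n)%N ->
  cosev n (cosmul n J J') i = cosev n J i * cosev n J' i.
Proof.
move=> n0; rewrite /cosev big_cat /= !big_allpairs_dep -big_split /= mulr_suml.
apply: eq_bigr => q _; rewrite mulr_sumr -big_split /=; apply: eq_bigr => q' _ /=.
by rewrite mulrACA cosnM//; field.
Qed.

Lemma cosev_dilate n z J i : cosev n (dilate z J) i = cosev n J (z * i).
Proof.
by rewrite /cosev big_map; apply: eq_bigr => q _ /=; rewrite mulnCA mulnA.
Qed.

Lemma cosev_mod n J i : (0 < n)%N -> cosev n J (i %% n) = cosev n J i.
Proof.
move=> n0; apply: eq_bigr => q _.
by rewrite -(cosn_mod _ (q.2 * i)%N)// -modnMmr cosn_mod.
Qed.

Lemma nneg_coefs_mul n J J' : nneg_coefs J -> nneg_coefs J' ->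
  nneg_coefs (cosmul n J J').
Proof.
move=> /allP J0 /allP J0'; rewrite /nneg_coefs all_cat.
by apply/andP; split; apply/allP => _ /allpairsP[q [/J0 h1 /J0' h2 ->]] /=;
  rewrite !mulr_ge0 ?invr_ge0.
Qed.

Lemma sqrtnorm_ge0 J : 0 <= sqrtnorm J.
Proof. by apply: sumr_ge0 => q _; exact: sqrtr_ge0. Qed.

(** Each pair of coefficients produces two, both equal to half the product; dropping the half under
    the root leaves the factor 2. *)
Lemma sqrtnorm_mul n J J' : nneg_coefs J -> nneg_coefs J' ->
  sqrtnorm (cosmul n J J') <= 2 * sqrtnorm J * sqrtnorm J'.
Proof.
move=> /allP J0 /allP J0'; rewrite /sqrtnorm big_cat /= !big_allpairs_dep /= -big_split /=.
rewrite -mulrA mulr_suml mulr_sumr [leLHS]big_seq [leRHS]big_seq.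
apply: ler_sum => q qJ.
rewrite !mulr_sumr -big_split /= [leLHS]big_seq [leRHS]big_seq.
apply: ler_sum => q' qJ'.
have h1 := J0 _ qJ; have h2 := J0' _ qJ'.
rewrite -mulr2n -[Num.sqrt _ *+ 2]mulr_natl ler_pM2l// -sqrtrM//.
by rewrite ler_wsqrtr// ler_piMr ?mulr_ge0// invf_le1// ler1n.
Qed.

Lemma nneg_b2coefs n : nneg_coefs (b2coefs n).
Proof.
rewrite /nneg_coefs /= invr_ge0 mulr_ge0 ?sqr_ge0//=.
apply/allP => _ /mapP[h _ ->] /=.
by rewrite /b2coef invr_ge0 mulr_ge0 ?sqr_ge0// mulr_ge0 ?sqr_ge0.
Qed.

Lemma second_diff0_linear n (D : nat -> R) :
  (forall i, (i.+2 <= n)%N -> D i.+2 - 2 * D i.+1 + D i = 0) ->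
  forall i, (i <= n)%N -> D i = D 0%N + i%:R * (D 1%N - D 0%N).
Proof.
move=> H; suff E i : (i < n)%N -> D i = D 0%N + i%:R * (D 1%N - D 0%N) /\
    D i.+1 = D 0%N + i.+1%:R * (D 1%N - D 0%N).
  by case=> [|i] iN; [rewrite mul0r addr0|exact: (E i iN).2].
elim: i => [|i IH] iN; first by split; ring.
have [E1 E2] := IH (ltnW iN); split=> //.
have := H i iN; rewrite E1 E2 -(natr1 i.+1) -(natr1 i) => /eqP.
by rewrite -addrA addr_eq0 => /eqP ->; ring.
Qed.

(** The difference [D] of the two sides has vanishing second differences: the sines in [b2coef]
    cancel, and the cosines at an index not divisible by n sum to -1. So [D] is affine; equal values
    at 0 and n make it constant, and a zero sum over a period makes it 0. The frequency 0
    coefficient is the mean of B_2 over the grid. *)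
Lemma bernoulli2_cosev n i : (0 < n)%N -> (i <= n)%N ->
  bernoulli2 (i%:R / n%:R : R) = cosev n (b2coefs n) i.
Proof.
move=> n0; have N0 : n%:R != 0 :> R by rewrite pnatr_eq0 -lt0n.
have evE j : cosev n (b2coefs n) j =
    (6 * n%:R ^+ 2)^-1 + \sum_(1 <= h < n) b2coef n h * cosn R n (h * j).
  by rewrite /cosev big_cons mul0n cosn0 mulr1 big_map.
pose D j := cosev n (b2coefs n) j - bernoulli2 (j%:R / n%:R).
have D2 j : (j.+2 <= n)%N -> D j.+2 - 2 * D j.+1 + D j = 0.
  move=> jn; rewrite /D !evE.
  have E h : (0 < h < n)%N -> b2coef n h * cosn R n (h * j.+2) -
      2 * (b2coef n h * cosn R n (h * j.+1)) + b2coef n h * cosn R n (h * j) =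
      - 2 / n%:R ^+ 2 * cosn R n (j.+1 * h).
    move=> hn; have s0 := sin_pi_gt0 R hn.
    pose u : R := pi * h%:R / n%:R; pose x := 2 * u * j.+1%:R.
    have -> : cosn R n (h * j.+2) = cos (x + 2 * u).
      by rewrite /cosn /x /u natrM -(natr1 j.+1); congr cos; ring.
    have -> : cosn R n (h * j) = cos (x - 2 * u).
      by rewrite /cosn /x /u natrM -(natr1 j); congr cos; ring.
    have -> : cosn R n (h * j.+1) = cos x.
      by rewrite /cosn /x /u natrM; congr cos; ring.
    have -> : cosn R n (j.+1 * h) = cos x.
      by rewrite /cosn /x /u natrM; congr cos; ring.
    rewrite cosB cosD (_ : cos (2 * u) = 1 - 2 * sin u ^+ 2); last first.
      by rewrite mulr_natl cos_mulr2n cos2sin2; ring.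
    by rewrite /b2coef -/u; field; rewrite N0 gt_eqF.
  have S : \sum_(1 <= h < n) cosn R n (j.+1 * h) = -1.
    have := cosn_sum R j.+1 n0; rewrite big_nat_recr//= => /eqP.
    rewrite (_ : (n %| j.+1)%N = false) ?mulr0; last first.
      by apply/negbTE; rewrite gtnNdvd.
    by rewrite addr_eq0 => /eqP ->; rewrite -(cosn_mod _ _ n0) modnMl cosn0.
  have -> : (6 * n%:R ^+ 2)^-1 + \sum_(1 <= h < n) b2coef n h * cosn R n (h * j.+2) -
      bernoulli2 (j.+2%:R / n%:R) -
      2 * ((6 * n%:R ^+ 2)^-1 + \sum_(1 <= h < n) b2coef n h * cosn R n (h * j.+1) -
      bernoulli2 (j.+1%:R / n%:R)) +
      ((6 * n%:R ^+ 2)^-1 + \sum_(1 <= h < n) b2coef n h * cosn R n (h * j) -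
      bernoulli2 (j%:R / n%:R)) =
      \sum_(1 <= h < n) (- 2 / n%:R ^+ 2 * cosn R n (j.+1 * h)) -
      (bernoulli2 (j.+2%:R / n%:R) - 2 * bernoulli2 (j.+1%:R / n%:R)
       + bernoulli2 (j%:R / n%:R)).
    rewrite -(eq_big_nat _ _ E) big_split sumrB /= -mulr_sumr; ring.
  rewrite -mulr_sumr S /bernoulli2 -(natr1 j.+1) -(natr1 j).
  by move: (n%:R) N0 => N N0; field.
have D0 j : (j <= n)%N -> D j = D 0%N.
  move=> jn; rewrite (second_diff0_linear D2 jn).
  have := second_diff0_linear D2 (leqnn n).
  have -> : D n = D 0%N.
    rewrite /D -[cosev _ _ n](cosev_mod _ _ n0) modnn; congr (_ - _).
    by rewrite /bernoulli2 divff// mul0r; ring.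
  move/eqP; rewrite eq_sym -subr_eq0 addrAC subrr add0r mulf_eq0 (negbTE N0).
  move=> /eqP ->.
  by rewrite mulr0 addr0.
have SD : \sum_(1 <= j < n.+1) D j = 0.
  rewrite /D sumrB; under eq_bigr do rewrite evE.
  rewrite big_split sumr_const_nat subSS subn0 exchange_big /=.
  rewrite [X in _ + X - _](eq_big_nat _ _ (F2 := fun=> 0)) => [|h hn].
    rewrite big1// addr0 /bernoulli2.
    have SS m : \sum_(1 <= j < m.+1) (((j%:R / n%:R) ^+ 2 - j%:R / n%:R + 6^-1)) =
      m%:R * (m%:R + 1) * (2 * m%:R + 1) / 6 / n%:R ^+ 2
      - m%:R * (m%:R + 1) / 2 / n%:R + m%:R / 6 :> R.
      elim: m => [|m IH]; first by rewrite big_nil; field.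
      rewrite big_nat_recr//= IH -(natr1 m).
      by move: (n%:R) N0 => N N0; field.
    rewrite SS -[_ *+ n]mulr_natl.
    by move: (n%:R) N0 => N N0; field.
  rewrite -mulr_sumr cosn_sum// (_ : (n %| h)%N = false) ?mulr0//.
  by apply/negbTE; rewrite gtnNdvd; case/andP: hn.
move=> iN; move: SD; rewrite (eq_big_nat _ _ (F2 := fun=> D 0%N)) => [|j /andP[_ jn]].
  rewrite sumr_const_nat subSS subn0 => /eqP; rewrite mulrn_eq0 eqn0Ngt n0 /=.
  by rewrite -(D0 _ iN) /D subr_eq0 => /eqP.
exact: D0.
Qed.

Lemma frac_nat n k : (0 < n)%N -> frac (k%:R / n%:R : R) = (k %% n)%:R / n%:R.
Proof.
move=> n0; have N0 : 0 < n%:R :> R by rewrite ltr0n.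
have E : k%:R / n%:R = (k %/ n)%:R + (k %% n)%:R / n%:R :> R.
  by rewrite {1}(divn_eq k n) natrD mulrDl natrM mulfK// gt_eqF.
rewrite /frac (_ : Num.floor _ = (k %/ n)%:Z); first by rewrite E -pmulrn addrAC subrr add0r.
apply: Num.Theory.floor_def; rewrite E intrD -!pmulrn; apply/andP; split.
  by rewrite lerDl divr_ge0.
by rewrite ltrD2l ltr_pdivrMr// mul1r ltr_nat ltn_mod.
Qed.

Lemma bernoulli2_frac n k : (0 < n)%N ->
  bernoulli2 (frac (k%:R / n%:R : R)) = cosev n (b2coefs n) k.
Proof.
by move=> n0; rewrite frac_nat// bernoulli2_cosev ?cosev_mod// ltnW// ltn_mod.
Qed.

End bernoulli_cosine.

(** * Counting solutions of congruences, and gcd-weighted harmonic sums *)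

Lemma count_congruence (n a h : nat) : (0 < n)%N ->
  (\sum_(1 <= c < n.+1) (n %| a + h * c)%N <= gcdn h n)%N.
Proof.
move=> n0; set P := fun c => (n %| a + h * c)%N.
have -> : (\sum_(1 <= c < n.+1) P c = count P (index_iota 1 n.+1))%N.
  by rewrite -sum1_count [RHS]big_mkcond; apply: eq_bigr => c _; rewrite /=; case: (P c).
rewrite -size_filter; set s := seq.filter _ _.
case E : s => [//|c0 s0].
have cs c : c \in s -> (0 < c <= n)%N /\ P c.
  by rewrite mem_filter mem_index_iota ltnS => /andP[].
set g := gcdn h n; have g0 : (0 < g)%N by rewrite gcdn_gt0 n0 orbT.
have c0s : c0 \in s by rewrite E mem_head.
have c0min c : c \in s -> (c0 <= c)%N.
  have : sorted leq s by apply: sorted_filter; [exact: leq_trans|exact: iota_sorted].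
  rewrite E /= inE => /(order_path_min leq_trans)/allP H /predU1P[->//|/H].
  by [].
have us : uniq s by rewrite filter_uniq// iota_uniq.
(* Relative to the smallest solution [c0], every solution differs by a multiple of n / g, and the
   range of length n leaves room for g multiples only. *)
have -> : g = size [seq (c0 + n %/ g * j)%N | j <- iota 0 g].
  by rewrite size_map size_iota.
rewrite -E; apply: uniq_leq_size => // c cin; have cc := c0min _ cin.
have [[/andP[_ cn] Pc] [/andP[c00 _] Pc0]] := (cs _ cin, cs _ c0s).
have : (n %| h * (c - c0))%N.
  have -> : (h * (c - c0) = (a + h * c) - (a + h * c0))%N.
    by rewrite subnDl mulnBr.
  exact: dvdn_sub.
have gn : (g %| n)%N by rewrite dvdn_gcdr.
have gh : (g %| h)%N by rewrite dvdn_gcdl.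
rewrite -{1}(divnK gn) -{1}(divnK gh) mulnAC dvdn_pmul2r// Gauss_dvdr; last first.
  have hn0 : (n %/ g > 0)%N by rewrite divn_gt0// dvdn_leq.
  rewrite /coprime -(eqn_pmul2r g0) muln_gcdl !divnK// mul1n gcdnC.
  by rewrite -/g.
case/dvdnP => j jE; apply/mapP; exists j; last by rewrite mulnC -jE subnKC.
have q0 : (0 < n %/ g)%N by rewrite divn_gt0// dvdn_leq.
have : (j * (n %/ g) < g * (n %/ g))%N.
  rewrite -jE (mulnC g) divnK//; apply: leq_ltn_trans (_ : c - 1 < n)%N.
    by rewrite leq_sub2l.
  by rewrite subn1 prednK// (leq_trans c00).
by rewrite ltn_pmul2r// mem_iota.
Qed.

Section harmonic.
Variable R : realType.

Lemma harmonic_pow2 m : \sum_(1 <= h < 2 ^ m) h%:R^-1 <= m%:R :> R.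
Proof.
elim: m => [|m IH]; first by rewrite expn0 big_geq.
have e0 : (0 < 2 ^ m)%N by rewrite expn_gt0.
rewrite (big_cat_nat (n := 2 ^ m)) //=; last by rewrite leq_exp2l.
rewrite -natr1 lerD//.
apply: (@le_trans _ _ (\sum_(2 ^ m <= h < 2 ^ m.+1) (2 ^ m)%:R^-1)).
  apply: ler_sum_nat => h /andP[h1 _].
  by rewrite lef_pV2 ?posrE ?ltr0n ?ler_nat// (leq_trans e0).
rewrite sumr_const_nat expnS mul2n -addnn addnK -[_ *+ _]mulr_natl.
by rewrite divff// pnatr_eq0 -lt0n.
Qed.

(** The gcd of h with 2^m is some 2^t, and h = 2^t j turns the summand into 1 / j. Each of the m + 1
    values of t thus contributes at most a harmonic sum. *)
Lemma gcd_harmonic_pow2 m :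
  \sum_(1 <= h < 2 ^ m) (gcdn h (2 ^ m))%:R / h%:R <= (m.+1 * m)%:R :> R.
Proof.
set n := (2 ^ m)%N.
apply: (@le_trans _ _ (\sum_(1 <= h < n) \sum_(t < m.+1) \sum_(1 <= j < n)
   (h == 2 ^ t * j)%N%:R * j%:R^-1)).
  apply: ler_sum_nat => h /andP[h0 hn].
  have /(dvdn_pfactor _ _ (isT : prime 2))[t tm gE] : (gcdn h n %| 2 ^ m)%N.
    by rewrite dvdn_gcdr.
  have gh : (gcdn h n %| h)%N by rewrite dvdn_gcdl.
  have hE := divnK gh; set j := (h %/ gcdn h n)%N in hE.
  have j0 : (0 < j)%N by rewrite lt0n; apply/eqP => j0; rewrite -hE j0 in h0.
  have jn : (j < n)%N.
    apply: leq_ltn_trans hn; rewrite -hE leq_pmulr// gcdn_gt0 h0//.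
  rewrite (bigD1 (inord t))//= (big_cat_nat (n := j)) //=; last exact: ltnW.
  rewrite (big_ltn (m := j))// inordK// -gE mulnC hE eqxx mul1r.
  rewrite (_ : _ / _ = j%:R^-1); last first.
    rewrite -[X in _ / X%:R]hE natrM invfM mulrCA divff ?mulr1//.
    by rewrite pnatr_eq0 -lt0n gcdn_gt0 h0.
  rewrite -addrA addrCA -addrA lerDl.
  have nn (r : seq nat) (f : nat -> nat) : 0 <= \sum_(j <- r) (f j)%:R * j%:R^-1 :> R.
    by apply: sumr_ge0 => i _; rewrite mulr_ge0 ?invr_ge0.
  apply: addr_ge0; first exact: nn.
  apply: addr_ge0; first exact: nn.
  by apply: sumr_ge0 => i _; exact: nn.
rewrite exchange_big /=.
apply: (@le_trans _ _ (\sum_(t < m.+1) m%:R)); last first.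
  by rewrite sumr_const card_ord -[_ *+ _]mulr_natl -natrM.
apply: ler_sum => t _; rewrite exchange_big /=.
apply: le_trans (harmonic_pow2 m); apply: ler_sum => j _.
rewrite -mulr_suml ler_piMl ?invr_ge0// -natr_sum (_ : 1 = 1%:R)// ler_nat.
case: (leqP 1 (2 ^ t * j)%N) => tj; last first.
  rewrite big_nat big1// => h /andP[h1 _].
  by apply/eqP; rewrite eqb0 gtn_eqF// (leq_trans tj).
case: (ltnP (2 ^ t * j) n) => tjn.
  rewrite (big_cat_nat (n := 2 ^ t * j)) //=; last exact: ltnW.
  rewrite (big_ltn (m := 2 ^ t * j))// eqxx.
  rewrite big_nat big1 => [|h /andP[_ h1]]; last first.
    by apply/eqP; rewrite eqb0 ltn_eqF.
  rewrite big_nat big1// => h /andP[h1 _].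
  by apply/eqP; rewrite eqb0 gtn_eqF.
rewrite big_nat big1// => h /andP[_ h1].
by apply/eqP; rewrite eqb0 ltn_eqF// (leq_trans h1).
Qed.

End harmonic.

(** * The rate of convergence of the CBC construction *)

Section cbc_rate.
Variable R : realType.
Implicit Types J : seq (R * nat).

(** The sine is symmetric under h -> n - h, and for the smaller of the two [sin_ge_half] gives the
    reciprocal as bound. Adding both reciprocals spares later sums the case distinction. *)
Lemma sqrt_b2coef_le n h : (0 < h < n)%N ->
  Num.sqrt (b2coef R n h) <= h%:R^-1 + (n - h)%:R^-1.
Proof.
move=> /andP[h0 hn].
have N0 : 0 < n%:R :> R by rewrite ltr0n (ltn_trans h0).
have key k : (0 < k)%N -> (2 * k <= n)%N -> sin (pi * h%:R / n%:R) = sin (pi * k%:R / n%:R : R) ->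
    Num.sqrt (b2coef R n h) <= k%:R^-1.
  move=> k0 kn sE; have K0 : 0 < k%:R :> R by rewrite ltr0n.
  have s0 : 0 < sin (pi * k%:R / n%:R : R).
    apply: sin_pi_gt0; rewrite k0 /=.
    by apply: leq_trans kn; rewrite mul2n -addnn -addn1 leq_add2l.
  have kn' : 2 * k%:R <= n%:R :> R by rewrite -natrM ler_nat.
  rewrite -[leRHS]ger0_norm ?invr_ge0// -sqrtr_sqr ler_wsqrtr//.
  rewrite /b2coef sE exprVn lef_pV2 ?posrE; first last.
  - exact: exprn_gt0.
  - by rewrite mulr_gt0 ?exprn_gt0 ?mulr_gt0 ?exprn_gt0.
  have p0 := @pi_gt0 R; have p2 := @pi_ge2 R.
  set u : R := pi * k%:R / n%:R.
  have u0 : 0 <= u by rewrite divr_ge0// mulr_ge0// ltW.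
  have : u / 2 <= sin u.
    apply: sin_ge_half; rewrite u0 /= /u ler_pdivrMr// -mulrA ler_pM2l//; lra.
  have kE : k%:R = n%:R * u / pi
    by rewrite /u [n%:R * _]mulrC mulfVK ?gt_eqF// mulrC mulKf// gt_eqF.
  rewrite -/u [X in X ^+ 2 <= _]kE.
  move: (sin u) => S uS.
  have nu : n%:R * u / pi <= n%:R * S.
    rewrite ler_pdivrMr// -mulrA ler_pM2l//.
    have S0 : 0 <= S by lra.
    by apply: (@le_trans _ _ (S * 2)); [lra|rewrite ler_wpM2l].
  have h1 : 0 <= n%:R * u / pi by rewrite divr_ge0 ?mulr_ge0// ltW.
  have : (n%:R * u / pi) ^+ 2 <= (n%:R * S) ^+ 2.
    by rewrite lerXn2r ?nnegrE// (le_trans h1 nu).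
  rewrite [(n%:R * S) ^+ 2]exprMn => /le_trans; apply.
  by rewrite -mulrA ler_peMl ?ler1n// mulr_ge0 ?sqr_ge0.
case: (leqP (2 * h) n) => hn2.
  by apply: le_trans (key h h0 hn2 erefl) _; rewrite lerDl invr_ge0.
have nh0 : (0 < n - h)%N by rewrite subn_gt0.
have nh2 : (2 * (n - h) <= n)%N.
  by rewrite mulnBr leq_subLR mul2n -addnn leq_add2r ltnW.
apply: le_trans (key (n - h)%N nh0 nh2 _) _; last by rewrite lerDr invr_ge0.
rewrite natrB 1?ltnW// mulrBr mulrBl mulfK ?gt_eqF// sinB sinpi cospi.
by rewrite mul0r add0r; ring.
Qed.

Lemma sum_rev_complement n (f : nat -> nat -> R) :
  \sum_(1 <= h < n) f h (n - h)%N = \sum_(1 <= h < n) f (n - h)%N h.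
Proof.
rewrite big_nat_rev /= !big_nat; apply: eq_bigr => h /andP[h0 hn].
by rewrite add1n subSS subKn// ltnW.
Qed.

Lemma sqrt_b2coef_sum_le (m : nat) (w : nat -> R) (n := (2 ^ m)%N) :
  (forall h, 0 <= w h) -> (forall h, (0 < h < n)%N -> w (n - h)%N = w h) ->
  \sum_(1 <= h < n) Num.sqrt (b2coef R n h) * w h <=
  2 * \sum_(1 <= h < n) w h / h%:R.
Proof.
move=> w0 ws.
apply: (@le_trans _ _ (\sum_(1 <= h < n) (h%:R^-1 * w h + (n - h)%:R^-1 * w h))).
  apply: ler_sum_nat => h hn; rewrite -mulrDl ler_wpM2r//.
  exact: sqrt_b2coef_le.
rewrite big_split /= (sum_rev_complement n (fun a b => b%:R^-1 * w a)).
rewrite mulr2n mulrDl mul1r le_eqVlt; apply/orP; left; apply/eqP.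
congr (_ + _); rewrite !big_nat; apply: eq_bigr => h hn; rewrite mulrC//.
by rewrite ws.
Qed.

Lemma sqrt_b2mean_le n : (0 < n)%N -> Num.sqrt (6 * n%:R ^+ 2)^-1 <= n%:R^-1 :> R.
Proof.
move=> n0; have N0 : 0 < n%:R :> R by rewrite ltr0n.
rewrite -[leRHS]ger0_norm ?invr_ge0// -sqrtr_sqr ler_wsqrtr// exprVn.
by rewrite lef_pV2 ?posrE ?mulr_gt0 ?exprn_gt0// ler_peMl ?sqr_ge0// ler1n.
Qed.

Lemma sqrtnorm_b2coefs m : sqrtnorm (b2coefs R (2 ^ m)) <= 1 + 2 * m%:R.
Proof.
have n0 : (0 < 2 ^ m)%N by rewrite expn_gt0.
rewrite /sqrtnorm big_cons big_map /= lerD//.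
  apply: le_trans (sqrt_b2mean_le n0) _.
  by rewrite invf_le1 ?ltr0n// (_ : 1 = 1%:R)// ler_nat.
under eq_bigr do rewrite -[Num.sqrt _]mulr1.
apply: le_trans (sqrt_b2coef_sum_le (w := fun=> 1) _ _) _ => //.
by rewrite ler_pM2l//; under eq_bigr do rewrite mul1r; exact: harmonic_pow2.
Qed.

Lemma gcdn_complement a b : (a <= b)%N -> gcdn (b - a) b = gcdn a b.
Proof. by move=> /subnKC {2 3}<-; rewrite gcdnDl gcdnDr gcdnC. Qed.

Lemma sqrtnorm_gcd_b2coefs m (n := (2 ^ m)%N) :
  \sum_(q <- b2coefs R n) Num.sqrt q.1 * (gcdn q.2 n)%:R <= 1 + 2 * (m.+1 * m)%:R.
Proof.
have n0 : (0 < n)%N by rewrite expn_gt0.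
rewrite big_cons big_map /= lerD//.
  rewrite gcd0n; apply: le_trans (_ : n%:R^-1 * n%:R <= _).
    by rewrite ler_wpM2r// sqrt_b2mean_le.
  by rewrite mulVf// pnatr_eq0 -lt0n.
apply: le_trans (sqrt_b2coef_sum_le (w := fun h => (gcdn h n)%:R) _ _) _ => //.
  move=> h /andP[_ hn] /=; congr (_%:R).
  by rewrite gcdn_complement// ltnW.
by rewrite ler_pM2l// gcd_harmonic_pow2.
Qed.

Lemma cosev_mean n J : (0 < n)%N ->
  n%:R^-1 * \sum_(1 <= i < n.+1) cosev n J i = \sum_(q <- J) q.1 * (n %| q.2)%N%:R.
Proof.
move=> n0; rewrite exchange_big mulr_sumr /=; apply: eq_bigr => q _.
by rewrite -mulr_sumr cosn_sum// mulrCA mulKf// pnatr_eq0 -lt0n.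
Qed.

Lemma sqrtr_sum_le J (P : nat -> bool) : nneg_coefs J ->
  Num.sqrt (\sum_(q <- J) q.1 * (P q.2)%:R) <=
  \sum_(q <- J) Num.sqrt q.1 * (P q.2)%:R.
Proof.
elim: J => [|q J IH] /=; first by rewrite !big_nil sqrtr0.
move=> /andP[q0 J0]; rewrite !big_cons.
apply: le_trans (lerD (lexx _) (IH J0)).
have s0 : 0 <= \sum_(j <- J) j.1 * (P j.2)%:R.
  rewrite big_seq; apply: sumr_ge0 => i iJ.
  by rewrite mulr_ge0//; move/allP : J0; exact.
case: (P q.2); rewrite ?mulr1 ?mulr0 ?add0r//.
rewrite -[leRHS]ger0_norm ?addr_ge0 ?sqrtr_ge0// -sqrtr_sqr ler_wsqrtr//.
by rewrite sqrrD !sqr_sqrtr// addrAC lerDl mulrn_wge0// mulr_ge0 ?sqrtr_ge0.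
Qed.

Lemma candidate_count m :
  (2 ^ m)%:R / 2 <= \sum_(1 <= c < (2 ^ m).+1) (coprime c (2 ^ m))%:R :> R.
Proof.
case: m => [|m]; first by rewrite expn0 big_nat1 coprimen1 /=; lra.
have odd_count k : (\sum_(1 <= c < (2 * k).+1) odd c = k)%N.
  elim: k => [|k IH]; first by rewrite big_geq.
  by rewrite mulnS !addSn add0n 2?big_nat_recr//= IH oddM /= addn0 addn1.
rewrite (eq_bigr (fun c => (odd c)%:R)) => [|c _].
  by rewrite -natr_sum expnS odd_count natrM mulrAC divff// mul1r.
by rewrite coprime_pexpr// coprimen2.
Qed.

(* [J] encodes the product over the components already chosen and [T] is the
   criterion at the minimizer.  At least half of c = 1, ..., n are candidates. *)
Lemma cbc_step m J T (n := (2 ^ m)%N) : nneg_coefs J ->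
  (forall c, candidate n c -> T <= n%:R^-1 * \sum_(1 <= i < n.+1)
     cosev n J i * cosev n (b2coefs R n) (c * i)) ->
  Num.sqrt T <= 4 * sqrtnorm J * (1 + 2 * (m.+1 * m)%:R) / n%:R.
Proof.
move=> J0 Tmin; have n0 : (0 < n)%N by rewrite expn_gt0.
have N0 : 0 < n%:R :> R by rewrite ltr0n.
set B := b2coefs R n in Tmin *.
pose D : R := \sum_(q <- B) Num.sqrt q.1 * (gcdn q.2 n)%:R.
(* [U c] bounds the root of the criterion at a candidate by subadditivity. Being nonnegative, it may
   be summed over all [c] from 1 to n, where the solutions of the congruences are easy to count. *)
pose U c : R := \sum_(q <- J) \sum_(h <- B) Num.sqrt q.1 * Num.sqrt h.1 *
  ((n %| q.2 + h.2 * c)%N%:R + (n %| q.2 + (n.-1 * h.2) * c)%N%:R).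
have U0 c : 0 <= U c.
  by do 2!apply: sumr_ge0 => ? _; rewrite !mulr_ge0 ?sqrtr_ge0 ?addr_ge0.
have TU c : candidate n c -> Num.sqrt T <= U c.
  move=> /Tmin; under eq_bigr => i _.
    rewrite -cosev_dilate -cosev_mul//; over.
  rewrite cosev_mean// => Tc; apply: (le_trans (ler_wsqrtr Tc)).
  have C0 : nneg_coefs (cosmul n J (dilate c B)).
    apply: nneg_coefs_mul => //; rewrite /nneg_coefs all_map.
    exact: (nneg_b2coefs R n).
  apply: (le_trans (sqrtr_sum_le (fun a => n %| a)%N C0)).
  have B0 : nneg_coefs B by exact: nneg_b2coefs.
  clearbody B.
  rewrite /cosmul big_cat /= !big_allpairs_dep -big_split /= [leLHS]big_seq [leRHS]big_seq.
  apply: ler_sum => q qJ; rewrite !big_map -big_split /= [leLHS]big_seq [leRHS]big_seq.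
  apply: ler_sum => h hB.
  have q0 : 0 <= q.1 by move/allP : J0 => /(_ _ qJ).
  have h0 : 0 <= h.1 by move/allP : B0 => /(_ _ hB).
  rewrite -mulrDr (mulnC c) mulnA ler_wpM2r ?addr_ge0// -sqrtrM//.
  by rewrite ler_wsqrtr// ler_piMr ?mulr_ge0// invf_le1// ler1n.
have : n%:R / 2 * Num.sqrt T <= \sum_(1 <= c < n.+1) U c.
  apply: le_trans (_ : (\sum_(1 <= c < n.+1) (coprime c n)%:R) * Num.sqrt T <= _).
    by rewrite ler_wpM2r ?sqrtr_ge0// candidate_count.
  rewrite mulr_suml; apply: ler_sum_nat => c /andP[c0 cn].
  case: (boolP (coprime c n)) => cc; rewrite ?mul0r// mul1r.
  by apply: TU; rewrite /candidate c0 -ltnS cn.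
have UD : \sum_(1 <= c < n.+1) U c <= 2 * sqrtnorm J * D.
  rewrite exchange_big -mulrA mulr_suml mulr_sumr /=; apply: ler_sum => q _.
  rewrite exchange_big mulrCA !mulr_sumr /=; apply: ler_sum => h _.
  rewrite -mulr_sumr big_split /= -!natr_sum -mulrA ler_wpM2l ?sqrtr_ge0//.
  rewrite -mulrCA ler_wpM2l ?sqrtr_ge0// -natrD -natrM ler_nat mul2n -addnn.
  rewrite leq_add ?count_congruence//.
  (* The factor [n.-1], which encodes a minus sign, is coprime to n and leaves the gcd with n
     unchanged. *)
  apply: leq_trans (count_congruence _ _ n0) _.
  rewrite gcdnC Gauss_gcdr; first by rewrite gcdnC.
  by rewrite -[X in coprime X](prednK n0) coprimeSn.
move=> /le_trans/(_ UD) H; rewrite ler_pdivlMr//.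
have SD : sqrtnorm J * D <= sqrtnorm J * (1 + 2 * (m.+1 * m)%:R).
  by rewrite ler_wpM2l ?sqrtnorm_ge0// sqrtnorm_gcd_b2coefs.
by move: H SD; move: (sqrtnorm J) (Num.sqrt T) (_%:R) => x y z; lra.
Qed.

Definition b2kernel n (z i : nat) : R := 1 + bernoulli2 (frac (i%:R * z%:R / n%:R)).

(** With unit weights, the sum over all subsets is an expanded product of factors 1 + B_2, and the
    empty subset accounts for the 1 subtracted. In the proof [b] is 0 beyond j, which removes the
    subsets reaching further. *)
Lemma sq_error1 d n (j : 'I_d) (z : 'I_d -> nat) :
  sq_error (fun=> 1 : R) n j z = n%:R^-1 *
    \sum_(1 <= i < n.+1) (\prod_(l < d | (l <= j)%N) b2kernel n (z l) i - 1).
Proof.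
rewrite /sq_error; under eq_bigr do rewrite mul1r.
rewrite -mulr_sumr exchange_big /=; congr (_ * _); apply: eq_bigr => i _.
rewrite [X in _ = X - 1]big_mkcond /=.
pose b (l : 'I_d) := if (l <= j)%N then bernoulli2 (frac (i%:R * (z l)%:R / n%:R : R)) else 0.
rewrite (eq_bigr (fun l => b l + 1)) => [|l _]; last first.
  by rewrite /b /b2kernel; case: ifP => _; rewrite [RHS]addrC ?addr0.
rewrite bigA_distr [X in _ = X - 1](bigD1 finset.set0)//=.
rewrite [X in X + _ - 1]big1 => [|l _]; last by rewrite finset.in_set0.
rewrite addrAC subrr add0r big_mkcondr; apply: eq_bigr => u _.
rewrite -big_mkcond /=; case: ifP => [/forall_inP uj|/negbT].
  by apply: eq_bigr => l /uj lj; rewrite /b lj.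
rewrite negb_forall => /existsP[l]; rewrite negb_imply => /andP[lu lj].
by rewrite (bigD1 l)//= /b (negbTE lj) mul0r.
Qed.

End cbc_rate.

Section cbc_bound.
Variable R : realType.

Lemma b2kernel_cosev n z i : (0 < n)%N ->
  b2kernel R n z i = cosev n ((1, 0%N) :: dilate z (b2coefs R n)) i.
Proof.
move=> n0; rewrite /b2kernel -natrM mulnC bernoulli2_frac// -cosev_dilate.
by rewrite [RHS]/cosev big_cons mul0n cosn0 mulr1.
Qed.

Lemma nneg_coefs_dilate z J : nneg_coefs J -> nneg_coefs (dilate z J : seq (R * nat)).
Proof. by rewrite /nneg_coefs all_map. Qed.

Lemma sqrtnorm_dilate z J : sqrtnorm (dilate z J) = sqrtnorm J :> R.
Proof. by rewrite /sqrtnorm big_map. Qed.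

(** Each factor 1 + B_2 has [sqrtnorm] at most 2 (m + 1), and [sqrtnorm_mul] doubles it once more:
    hence the base 4 (m + 1). *)
Lemma prod_b2kernel_cosev d m (z : 'I_d -> nat) k (n := (2 ^ m)%N) : (k <= d)%N ->
  exists J : seq (R * nat), [/\ nneg_coefs J,
    sqrtnorm J <= (4 * m.+1%:R) ^+ k &
    forall i, cosev n J i = \prod_(l < d | (l < k)%N) b2kernel R n (z l) i].
Proof.
have n0 : (0 < n)%N by rewrite expn_gt0.
elim: k => [_|k IH kd].
  exists [:: (1, 0%N)]; split=> [||i]; first by rewrite /nneg_coefs /= ler01.
    by rewrite /sqrtnorm big_seq1 sqrtr1 expr0.
  by rewrite /cosev big_seq1 mul0n cosn0 mulr1 big_pred0.
have [J [J0 JS JE]] := IH (ltnW kd); pose j0 := Ordinal kd.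
pose B : seq (R * nat) := (1, 0%N) :: dilate (z j0) (b2coefs R n).
have B0 : nneg_coefs B.
  apply/andP; split; first exact: ler01.
  exact: (nneg_coefs_dilate _ (nneg_b2coefs R n)).
exists (cosmul n J B); split=> [||i]; first exact: nneg_coefs_mul.
  apply: (le_trans (sqrtnorm_mul _ J0 B0)).
  have SB : sqrtnorm B <= 2 * m.+1%:R.
    rewrite /B /sqrtnorm big_cons sqrtr1 -/(sqrtnorm _) sqrtnorm_dilate.
    by have := sqrtnorm_b2coefs R m; rewrite -(natr1 m) -/n; lra.
  rewrite exprSr (_ : 4 * m.+1%:R = 2 * (2 * m.+1%:R)); last by ring.
  rewrite -mulrA mulrCA ler_pM ?sqrtnorm_ge0 ?mulr_ge0 ?sqrtnorm_ge0//.
    by rewrite (_ : 2 * (2 * m.+1%:R) = 4 * m.+1%:R)//; ring.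
  by rewrite ler_pM2l.
rewrite cosev_mul// JE -b2kernel_cosev// [RHS](bigD1 j0)//= mulrC; congr (_ * _).
apply: eq_bigl => l; rewrite [RHS]andbC ltnS [in RHS]leq_eqVlt -val_eqE /=.
by case: ltngtP.
Qed.

(** The bound of [cbc_step] with the exponent of [prod_b2kernel_cosev] raised to d, so that one
    number serves every component. It is of order m^(d + 2) / 2^m. *)
Definition cbc_gap d m : R := 4 * (4 * m.+1%:R) ^+ d * (1 + 2 * (m.+1 * m)%:R) / (2 ^ m)%:R.

Lemma cbc_partial_bound d m (z : 'I_d -> nat) k (n := (2 ^ m)%N) :
  cbc_output (fun=> 1 : R) n z -> (k <= d)%N ->
  n%:R^-1 * \sum_(1 <= i < n.+1) (\prod_(l < d | (l < k)%N) b2kernel R n (z l) i - 1)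
  <= k%:R * cbc_gap d m ^+ 2.
Proof.
move=> zP; have n0 : (0 < n)%N by rewrite expn_gt0.
have N0 : 0 < n%:R :> R by rewrite ltr0n.
have gap0 : 0 <= cbc_gap d m.
  by rewrite /cbc_gap !mulr_ge0 ?invr_ge0 ?addr_ge0 ?exprn_ge0 ?mulr_ge0.
elim: k => [_|k IH kd].
  rewrite mul0r (eq_bigr (fun=> 0)) ?big1 ?mulr0//.
  by move=> i _; rewrite big_pred0// subrr.
have [J [J0 JS JE]] := prod_b2kernel_cosev m z (ltnW kd).
pose j0 := Ordinal kd.
pose T c := n%:R^-1 * \sum_(1 <= i < n.+1) cosev n J i * cosev n (b2coefs R n) (c * i).
(* From P (1 + B) - 1 = (P - 1) + P B: a new component adds [T] of its value to the criterion, so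
   the CBC step minimizes [T]. *)
have splitE z' : (forall l : 'I_d, (l < k)%N -> z' l = z l) ->
  n%:R^-1 * \sum_(1 <= i < n.+1) (\prod_(l < d | (l <= j0)%N) b2kernel R n (z' l) i - 1)
  = n%:R^-1 * \sum_(1 <= i < n.+1) (\prod_(l < d | (l < k)%N) b2kernel R n (z l) i - 1)
    + T (z' j0).
  move=> zz'; rewrite -mulrDr -big_split /=; congr (_ * _); apply: eq_bigr => i _.
  rewrite (bigD1 j0)//= (eq_big (fun l : 'I_d => l < k)%N
    (fun l => b2kernel R n (z l) i)) /=.
  - by rewrite /b2kernel -natrM mulnC bernoulli2_frac// -JE; ring.
  - by move=> l; rewrite [LHS]andbC [in LHS]leq_eqVlt -val_eqE /=; case: ltngtP.
  - move=> l /andP[lk ne]; rewrite zz'//.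
    by move: lk ne; rewrite leq_eqVlt -val_eqE /=; case: ltngtP.
have T0 c : 0 <= T c.
  rewrite /T; under eq_bigr => i _ do rewrite -cosev_dilate -cosev_mul//.
  rewrite cosev_mean// big_seq; apply: sumr_ge0 => q qJ; rewrite mulr_ge0//.
  have : nneg_coefs (cosmul n J (dilate c (b2coefs R n))).
    by apply: nneg_coefs_mul => //; exact/nneg_coefs_dilate/nneg_b2coefs.
  by move/allP; exact.
have sqrtT : Num.sqrt (T (z j0)) <= cbc_gap d m.
  have [k0|k0] := posnP k; last first.
    have : Num.sqrt (T (z j0)) <= 4 * sqrtnorm J * (1 + 2 * (m.+1 * m)%:R) / n%:R.
      apply: cbc_step => // c cc.
      have := zP j0; rewrite eqn0Ngt k0 /= => -[_ /(_ c cc)].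
      have zu (l : 'I_d) : (l < k)%N -> update z j0 c l = z l.
        by move=> lk; rewrite /update -val_eqE /= ltn_eqF.
      by rewrite !sq_error1 (splitE z)// (splitE _ zu) lerD2l /update eqxx.
    move=> /le_trans; apply; rewrite /cbc_gap ler_wpM2r ?invr_ge0//.
    rewrite ler_wpM2r ?addr_ge0// ler_pM2l//; apply: (le_trans JS).
    rewrite ler_weXn2l// 1?ltnW//.
    by rewrite -(natr1 m) mulrDr mulr1; have := ler0n R m; lra.
  (* The first component is prescribed instead of minimized. There [T] is the mean of B_2 over the
     grid, where only frequency 0 survives. *)
  have z1 : z j0 = 1%N by have := zP j0; rewrite /= k0 eqxx.
  have -> : T (z j0) = (6 * n%:R ^+ 2)^-1.
    rewrite /T z1 (eq_bigr (fun i => cosev n (b2coefs R n) i)) => [|i _].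
      rewrite cosev_mean// big_cons dvdn0 mulr1 big_map big_nat big1 ?addr0//.
      by move=> h /andP[h0 hn]; rewrite gtnNdvd ?mulr0.
    by rewrite JE mul1n k0 big_pred0 ?mul1r.
  apply: (le_trans (sqrt_b2mean_le R n0)).
  rewrite /cbc_gap ler_peMl ?invr_ge0//.
  have h1 : 1 <= (4 * m.+1%:R) ^+ d :> R.
    by rewrite exprn_ege1// -(natr1 m) mulrDr mulr1; have := ler0n R m; lra.
  have h2 : 1 <= 1 + 2 * (m.+1 * m)%:R :> R by rewrite lerDl mulr_ge0.
  by rewrite mulr_ege1// mulr_ege1// ler1n.
have := splitE z (fun _ _ => erefl).
rewrite (eq_bigr (fun i => \prod_(l < d | (l < k.+1)%N) b2kernel R n (z l) i - 1))//.
move=> ->; rewrite -(natr1 k) mulrDl mul1r lerD ?IH 1?ltnW//.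
by rewrite -(sqr_sqrtr (T0 (z j0))) lerXn2r ?nnegrE ?sqrtr_ge0.
Qed.

End cbc_bound.

(** * Bounded mixed differences *)

Section mixed_differences.
Variable R : realType.
Implicit Types (F G : seq R -> R) (M N c e : R) (d : nat).

Definition unit_itv (x : R) := 0 <= x <= 1.

Definition ucube d (t : seq R) := (size t == d) && all unit_itv t.

(* Every mixed first difference of F : [0, 1]^d -> R, in any set of coordinates,
   is at most M times the product of the increments.  Functions of d variables
   are represented on lists. *)
Fixpoint mix d F M : Prop :=
  if d is d'.+1 then
    (forall a, unit_itv a -> mix d' (fun t => F (a :: t)) M) /\
    (forall a b, unit_itv a -> unit_itv b ->
       mix d' (fun t => F (a :: t) - F (b :: t)) (M * `|a - b|))
  else `|F [::]| <= M.

Lemma ucubeS d a t : ucube d.+1 (a :: t) = unit_itv a && ucube d t.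
Proof. by rewrite /ucube /= eqSS andbCA. Qed.

Lemma mix_ext d F G M : (forall t, ucube d t -> F t = G t) ->
  mix d F M -> mix d G M.
Proof.
elim: d F G M => [|d IH] F G M FG /=; first by rewrite FG.
have FG' a t : unit_itv a -> ucube d t -> F (a :: t) = G (a :: t).
  by move=> ua ut; apply: FG; rewrite ucubeS ua.
move=> [F1 F2]; split=> [a ua|a b ua ub].
  by apply: IH (F1 a ua) => t ut; exact: FG'.
by apply: IH (F2 a b ua ub) => t ut; rewrite !FG'.
Qed.

Lemma mix_le d F M N : M <= N -> mix d F M -> mix d F N.
Proof.
elim: d F M N => [|d IH] F M N MN /=; first by move/le_trans; exact.
move=> [F1 F2]; split=> [a ua|a b ua ub]; first exact: (IH _ _ _ MN (F1 a ua)).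
by apply: IH (F2 a b ua ub); rewrite ler_wpM2r.
Qed.

Lemma unit_itv0 : unit_itv 0. Proof. by rewrite /unit_itv lexx ler01. Qed.
Lemma mix_ge0 d F M : mix d F M -> 0 <= M.
Proof.
elim: d F M => [|d IH] F M /=; first exact: le_trans.
by move=> [F1 _]; exact: IH (F1 0 unit_itv0).
Qed.

Lemma mix_norm d F M t : mix d F M -> ucube d t -> `|F t| <= M.
Proof.
elim: d F M t => [|d IH] F M [|a t] //=.
by move=> [F1 _]; rewrite ucubeS => /andP[ua]; exact: (IH _ _ _ (F1 a ua)).
Qed.

Lemma mix_cst d c : mix d (fun=> c) `|c|.
Proof.
elim: d c => [|d IH] c //=; split=> // a b _ _.
by apply: mix_le (IH _); rewrite subrr normr0 mulr_ge0.
Qed.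

Lemma mixD d F G M N : mix d F M -> mix d G N ->
  mix d (fun t => F t + G t) (M + N).
Proof.
elim: d F G M N => [|d IH] F G M N /=.
  by move=> FM GN; rewrite (le_trans (ler_normD _ _))// lerD.
move=> [F1 F2] [G1 G2]; split=> [a ua|a b ua ub].
  exact: (IH _ _ _ _ (F1 a ua) (G1 a ua)).
rewrite mulrDl.
by apply: mix_ext (IH _ _ _ _ (F2 a b ua ub) (G2 a b ua ub)) => t _; ring.
Qed.

Lemma mixZ d c F M : mix d F M -> mix d (fun t => c * F t) (`|c| * M).
Proof.
elim: d F M => [|d IH] F M /=; first by rewrite normrM => /ler_wpM2l; exact.
move=> [F1 F2]; split=> [a ua|a b ua ub]; first exact: (IH _ _ (F1 a ua)).
by rewrite -mulrA; apply: mix_ext (IH _ _ (F2 a b ua ub)) => t _; ring.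
Qed.

Lemma mixN d F M : mix d F M -> mix d (fun t => - F t) M.
Proof.
move=> /(mixZ (-1)); rewrite normrN1 mul1r.
by apply: mix_ext => t _; rewrite mulN1r.
Qed.

Lemma mixB d F G M N : mix d F M -> mix d G N ->
  mix d (fun t => F t - G t) (M + N).
Proof. by move=> Fm /mixN; exact: mixD. Qed.

Lemma mix_sum (I : Type) (r : seq I) (P : pred I) d (F : I -> seq R -> R)
    (M : I -> R) : (forall i, mix d (F i) (M i)) ->
  mix d (fun t => \sum_(i <- r | P i) F i t) (\sum_(i <- r | P i) M i).
Proof.
move=> Fm; elim: r => [|i r IH].
  rewrite big_nil; apply: mix_le (mix_ext _ (mix_cst d 0)).
    by rewrite normr0.
  by move=> t _; rewrite big_nil.
rewrite big_cons; case: ifP => Pi.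
  by apply: mix_ext (mixD (Fm i) IH) => t _; rewrite big_cons Pi.
by apply: mix_ext IH => t _; rewrite big_cons Pi.
Qed.

(** The discrete product rule replaces one difference by two terms, hence a factor 2 per
    coordinate. *)
Lemma mixM d F G M N : mix d F M -> mix d G N ->
  mix d (fun t => F t * G t) (2 ^+ d * (M * N)).
Proof.
elim: d F G M N => [|d IH] F G M N /=.
  by move=> FM GN; rewrite expr0 mul1r normrM ler_pM.
move=> Fm Gm; have [M0 N0] := (mix_ge0 (d := d.+1) Fm, mix_ge0 (d := d.+1) Gm).
move: Fm Gm => [F1 F2] [G1 G2]; split=> [a ua|a b ua ub].
  apply: mix_le (IH _ _ _ _ (F1 a ua) (G1 a ua)).
  by rewrite ler_wpM2r ?mulr_ge0// ler_eXn2l ?ltr1n.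
have := mixD (IH _ _ _ _ (F2 a b ua ub) (G1 a ua))
             (IH _ _ _ _ (F1 b ub) (G2 a b ua ub)).
rewrite (_ : _ + _ = 2 ^+ d.+1 * (M * N) * `|a - b|); last by rewrite exprS; ring.
by apply: mix_ext => t _; ring.
Qed.

(** Closure under pointwise limits brings in exp as a power series and ln as a limit of Riemann
    sums, without any chain rule for mixed differences. *)
Lemma mix_lim d (u : nat -> seq R -> R) F (Ms : nat -> R) M :
  (forall n, mix d (u n) (Ms n)) ->
  (forall t, ucube d t -> u n t @[n --> \oo] --> F t) ->
  Ms n @[n --> \oo] --> M -> mix d F M.
Proof.
elim: d u F Ms M => [|d IH] u F Ms M /= um uF MsM.
  have uN : `|u n [::]| @[n --> \oo] --> `|F [::]| by apply: cvg_norm; exact: uF.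
  by apply: (ler_cvg_to uN MsM); exact: nearW.
have uF' a t : unit_itv a -> ucube d t -> u n (a :: t) @[n --> \oo] --> F (a :: t).
  by move=> ua ut; apply: uF; rewrite ucubeS ua.
split=> [a ua|a b ua ub].
  apply: (IH (fun n t => u n (a :: t)) _ Ms) => [n|t ut|//].
    exact: (um n).1.
  exact: uF'.
apply: (IH (fun n t => u n (a :: t) - u n (b :: t)) _
  (fun n => Ms n * `|a - b|)) => [n|t ut|].
- exact: (um n).2.
- by apply: cvgB; exact: uF'.
- exact: cvgMr_tmp.
Qed.

Lemma mix_nth d i : mix d (fun t => nth 0 t i) 1.
Proof.
elim: d i => [|d IH] i /=; first by rewrite nth_nil normr0.
case: i => [|i]; split=> [a /andP[a0 a1]|a b _ _] /=.
- by apply: mix_le (mix_cst d a); rewrite ger0_norm.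
- by rewrite mul1r; exact: mix_cst.
- exact: IH.
- apply: mix_le (mix_ext _ (mix_cst d 0)); last by move=> t _; rewrite subrr.
  by rewrite normr0 mulr_ge0.
Qed.

Lemma mix_drop k d F M : mix d F M -> mix (k + d) (fun t => F (drop k t)) M.
Proof.
move=> Fm; elim: k => [|k IH] /=.
  by apply: mix_ext Fm => t _; rewrite drop0.
split=> // a b _ _; apply: mix_le (mix_ext _ (mix_cst (k + d) 0)).
  by rewrite normr0 mulr_ge0// (mix_ge0 Fm).
by move=> t _; rewrite subrr.
Qed.

(** Induction on d through 1/x - 1/y = -(x - y) (1/x) (1/y). The bound is chosen before F: this
    uniformity is what later makes constants independent of the cubature rule and its shift. *)
Lemma mixV d c M : 0 < c -> exists2 N, 0 <= N & forall F, mix d F M ->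
  (forall t, ucube d t -> c <= F t) -> mix d (fun t => (F t)^-1) N.
Proof.
move=> c0; elim: d => [|d [N N0 IH]].
  exists c^-1; rewrite ?invr_ge0 ?(ltW c0)//= => F _ /(_ [::] isT) cF.
  have F0 := lt_le_trans c0 cF.
  by rewrite ger0_norm ?invr_ge0 ?(ltW F0)// lef_pV2.
exists (N + 2 ^+ d * (`|M| * (2 ^+ d * (N * N)))).
  by rewrite addr_ge0// !mulr_ge0.
move=> F Fm cF; have M0 := mix_ge0 Fm; move: Fm => [F1 F2].
have cF' a : unit_itv a -> forall t, ucube d t -> c <= F (a :: t).
  by move=> ua t ut; apply: cF; rewrite ucubeS ua.
split=> [a ua|a b ua ub].
  apply: mix_le (IH _ (F1 a ua) (cF' a ua)).
  by rewrite lerDl !mulr_ge0.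
have := mixM (mixN (F2 a b ua ub))
  (mixM (IH _ (F1 a ua) (cF' a ua)) (IH _ (F1 b ub) (cF' b ub))).
move=> H; apply: mix_le (mix_ext _ H).
  rewrite mulrDl ler_wpDl ?mulr_ge0// (ger0_norm M0).
  by rewrite le_eqVlt; apply/orP; left; apply/eqP; ring.
move=> t ut /=.
have /lt_le_trans/(_ (cF' a ua t ut)) Fa := c0.
have /lt_le_trans/(_ (cF' b ub t ut)) Fb := c0.
by field; rewrite !gt_eqF.
Qed.

Lemma mix_section k s F M y : mix (k + s) F M -> ucube k y ->
  mix s (fun t => F (y ++ t)) M.
Proof.
elim: k y F => [|k IH] [|a y] F // [F1 _]; rewrite ucubeS => /andP[ua uy].
exact: (IH _ (fun t => F (a :: t)) (F1 a ua)).
Qed.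

(** A functional acting on the last s variables commutes with differences in the first k. Additivity
    is asked for on the class only, since integration is not additive on arbitrary functions. *)
Lemma mix_app k s (Lam : (seq R -> R) -> R) (eps : R) :
  (forall H H' M M', mix s H M -> mix s H' M' ->
     Lam (fun t => H t - H' t) = Lam H - Lam H') ->
  (forall H M, mix s H M -> `|Lam H| <= eps * M) ->
  forall F M, mix (k + s) F M ->
  mix k (fun y => Lam (fun t => F (y ++ t))) (eps * M).
Proof.
move=> LamB Lam_le; elim: k => [|k IH] F M /= Fm; first exact: Lam_le.
move: Fm => [F1 F2]; split=> [a ua|a b ua ub]; first exact: (IH _ _ (F1 a ua)).
have H := IH _ _ (F2 a b ua ub); rewrite -mulrA; apply: mix_ext H => y uy.
have sec c : unit_itv c -> mix s (fun t => F (c :: y ++ t)) M.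
  by move=> uc; exact: mix_section (F1 c uc) uy.
exact: LamB (sec a ua) (sec b ub).
Qed.

End mixed_differences.

(** * Exponential, logarithm and x log x of functions with bounded mixed differences *)

Section mixed_composition.
Variable R : realType.
Implicit Types (F G : seq R -> R) (M N c e : R) (d : nat).

Lemma mixX d n F M : mix d F M -> mix d (fun t => F t ^+ n) ((2 ^+ d * M) ^+ n).
Proof.
move=> Fm; elim: n => [|n IH].
  apply: (@mix_ext _ _ (fun=> 1)) => [t _|]; rewrite ?expr0//.
  by rewrite -[X in mix _ _ X]normr1; exact: mix_cst.
by rewrite exprS -mulrA; apply: mix_ext (mixM Fm IH) => t _; rewrite exprS.
Qed.

Lemma mix_expR d F M : mix d F M ->
  mix d (fun t => expR (F t)) (expR (2 ^+ d * M)).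
Proof.
move=> Fm.
apply: (@mix_lim _ _ (fun n t => series (exp_coeff (F t)) n) _
  (fun n => series (exp_coeff (2 ^+ d * M)) n)) => [n|t ut|].
- apply: mix_le (mix_ext _ (mix_sum (index_iota 0 n) predT
    (fun i => mixZ (i`!%:R)^-1 (mixX i Fm)))) => [|t _].
    rewrite /series /=; apply: ler_sum => i _.
    by rewrite ger0_norm ?invr_ge0// /exp_coeff mulrC.
  by apply: eq_bigr => i _; rewrite /exp_coeff /= mulrC.
- exact: is_cvg_series_exp_coeff.
- exact: is_cvg_series_exp_coeff.
Qed.

Lemma ln_bounds (x y : R) : 0 < x -> 0 < y ->
  (y - x) / y <= ln y - ln x <= (y - x) / x.
Proof.
have H (u v : R) : 0 < u -> 0 < v -> ln v - ln u <= (v - u) / u.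
  move=> u0 v0; rewrite -ln_div ?posrE//.
  rewrite (_ : v / u = 1 + (v - u) / u); last by field; rewrite gt_eqF.
  apply: le_ln1Dx; rewrite mulrBl divff ?gt_eqF// ltrBDr addNr.
  by rewrite divr_gt0.
move=> x0 y0; rewrite H// andbT -lerN2 opprB.
by apply: le_trans (H y x y0 x0) _; rewrite -mulNr opprB.
Qed.

(** Left Riemann sums of (a - b) / (b + t (a - b)) over [0, 1]. By [ln_bounds] on each cell, left
    and right sums enclose the telescoping logarithm, and their difference telescopes too, to
    O(1/n). *)
Lemma ln_riemann (a b : R) : 0 < a -> 0 < b ->
  \sum_(j < n.+1) n.+1%:R^-1 * ((a - b) / (b + j%:R / n.+1%:R * (a - b)))
    @[n --> \oo] --> ln a - ln b.
Proof.
move=> a0 b0; pose x n j : R := b + j%:R / n.+1%:R * (a - b).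
have x0 n j : (j <= n.+1)%N -> 0 < x n j.
  move=> jn; rewrite /x.
  set t := _ / _; have t0 : 0 <= t by rewrite divr_ge0.
  have t1 : t <= 1 by rewrite ler_pdivrMr ?ltr0n// mul1r ler_nat.
  have -> : b + t * (a - b) = (1 - t) * b + t * a by ring.
  case: (ltP t 1) => t1'.
    by rewrite ltr_pwDl// ?mulr_gt0 ?mulr_ge0 ?subr_gt0// ltW.
  by rewrite (_ : t = 1) ?subrr ?mul0r ?add0r ?mul1r//; apply/le_anti/andP.
have dx n j : x n j.+1 - x n j = n.+1%:R^-1 * (a - b).
  have : n.+1%:R != 0 :> R by rewrite pnatr_eq0.
  rewrite /x (_ : j.+1%:R = j%:R + 1 :> R) ?natr1//.
  by move: (n.+1%:R) => N N0; field.
have xE n : x n 0 = b /\ x n n.+1 = a.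
  by rewrite /x mul0r mul0r addr0 divff ?pnatr_eq0//; split => //; ring.
have tel n : ln a - ln b = \sum_(j < n.+1) (ln (x n j.+1) - ln (x n j)).
  rewrite -(big_mkord predT (fun j => ln (x n j.+1) - ln (x n j))).
  by rewrite telescope_sumr// (xE n).1 (xE n).2.
have up n : ln a - ln b <=
    \sum_(j < n.+1) n.+1%:R^-1 * ((a - b) / x n j).
  rewrite (tel n); apply: ler_sum => j _.
  have /andP[_] := ln_bounds (x0 n j (ltnW (ltn_ord j))) (x0 n j.+1 (ltn_ord j)).
  by rewrite dx mulrA.
have lo n : \sum_(j < n.+1) n.+1%:R^-1 * ((a - b) / x n j) <=
    ln a - ln b + (a - b) * (b^-1 - a^-1) * n.+1%:R^-1.
  rewrite (tel n) -lerBlDl -sumrB.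
  have -> : (a - b) * (b^-1 - a^-1) * n.+1%:R^-1 =
      \sum_(j < n.+1) n.+1%:R^-1 * (a - b) * ((x n j)^-1 - (x n j.+1)^-1).
    rewrite -mulr_sumr; under eq_bigr do rewrite -opprB.
    rewrite sumrN.
    rewrite -(big_mkord predT (fun j => (x n j.+1)^-1 - (x n j)^-1)).
    by rewrite telescope_sumr// (xE n).1 (xE n).2 opprB; ring.
  apply: ler_sum => j _.
  have /andP[+ _] := ln_bounds (x0 n j (ltnW (ltn_ord j))) (x0 n j.+1 (ltn_ord j)).
  by rewrite dx => H; rewrite [leRHS]mulrBr mulrA lerD2l lerN2.
apply: (@squeeze_cvgr _ _ _ _ (fun=> ln a - ln b)
  (fun n => ln a - ln b + (a - b) * (b^-1 - a^-1) * n.+1%:R^-1)).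
- by apply: nearW => n; rewrite up lo.
- exact: cvg_cst.
- rewrite -[X in _ --> X]addr0; apply: cvgD; first exact: cvg_cst.
  rewrite -(mulr0 ((a - b) * (b^-1 - a^-1))); apply: cvgMl_tmp.
  exact: cvg_harmonic.
Qed.

Lemma mix_ln_diff d c M : 0 < c -> exists2 C, 0 <= C & forall F G e,
  mix d F M -> mix d G M ->
  (forall t, ucube d t -> c <= F t) -> (forall t, ucube d t -> c <= G t) ->
  mix d (fun t => F t - G t) e -> mix d (fun t => ln (F t) - ln (G t)) (C * e).
Proof.
move=> c0; have [N N0 invN] := @mixV R d c (M + (M + M)) c0.
exists (2 ^+ d * N) => [|F G e Fm Gm cF cG FGe]; first by rewrite mulr_ge0.
have e0 := mix_ge0 FGe; have M0 := mix_ge0 Fm.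
apply: (@mix_lim _ _ (fun n t => \sum_(j < n.+1) n.+1%:R^-1 *
    ((F t - G t) / (G t + j%:R / n.+1%:R * (F t - G t)))) _
  (fun=> 2 ^+ d * N * e)) => [n|t ut|].
- have step (j : 'I_n.+1) : mix d (fun t => n.+1%:R^-1 *
    ((F t - G t) / (G t + j%:R / n.+1%:R * (F t - G t))))
    (n.+1%:R^-1 * (2 ^+ d * N * e)).
    have t0 : 0 <= j%:R / n.+1%:R :> R by rewrite divr_ge0.
    have t1 : j%:R / n.+1%:R <= 1 :> R.
      by rewrite ler_pdivrMr ?ltr0n// mul1r ler_nat ltnW.
    apply: mix_le (mixZ n.+1%:R^-1 (mixM FGe (invN _ _ _))).
    + by rewrite ger0_norm ?invr_ge0// ler_wpM2l ?invr_ge0// -mulrA (mulrC N).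
    + apply: mix_le (mixD Gm (mixZ (j%:R / n.+1%:R) (mixB Fm Gm))).
      by rewrite lerD2l ger0_norm// ler_piMl// addr_ge0.
    + move=> t ut; have := cF t ut; have := cG t ut.
      move: (_ / _) t0 t1 => s s0 s1 cGt cFt.
      have := ler_wpM2l s0 cFt.
      have : (1 - s) * c <= (1 - s) * G t by rewrite ler_wpM2l// subr_ge0.
      lra.
  apply: mix_le (mix_sum _ _ step).
  by rewrite sumr_const card_ord -[(_ * _) *+ _]mulr_natl mulVKf// pnatr_eq0.
- by apply: ln_riemann; [exact: lt_le_trans (cF t ut)|exact: lt_le_trans (cG t ut)].
- exact: cvg_cst.
Qed.

Lemma mix_ln d c M : 0 < c -> exists2 N, 0 <= N & forall F, mix d F M ->
  (forall t, ucube d t -> c <= F t) -> mix d (fun t => ln (F t)) N.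
Proof.
move=> c0; have [C C0 lnC] := @mix_ln_diff d c (`|M| + c) c0.
exists (C * (`|M| + c) + `|ln c|) => [|F Fm cF].
  by rewrite addr_ge0 ?mulr_ge0 ?addr_ge0// ltW.
have M0 := mix_ge0 Fm.
have Hc : mix d (fun=> c) c by apply: mix_le (mix_cst d c); rewrite gtr0_norm.
have := lnC F (fun=> c) (`|M| + c).
move=> /(_ _ _ cF (fun t _ => lexx c)) H.
apply: mix_ext (mixD (H _ _ _) (mix_cst d (ln c))) => [t _||| ].
- by rewrite subrK.
- by apply: mix_le Fm; rewrite ger0_norm// lerDl ltW.
- by apply: mix_le Hc; rewrite lerDr.
- by apply: mix_le (mixB Fm Hc); rewrite ger0_norm.
Qed.

Lemma mix_xlogx d c M : 0 < c -> exists2 N, 0 <= N & forall F, mix d F M ->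
  (forall t, ucube d t -> c <= F t) -> mix d (fun t => xlogx (F t)) N.
Proof.
move=> c0; have [N N0 lnN] := @mix_ln d c M c0.
exists (2 ^+ d * (`|M| * N)) => [|F Fm cF]; first by rewrite !mulr_ge0.
rewrite ger0_norm ?(mix_ge0 Fm)//; exact: mixM (lnN _ Fm cF).
Qed.

Lemma mix_xlogx_diff d c M : 0 < c -> exists2 C, 0 <= C & forall F G e,
  mix d F M -> mix d G M ->
  (forall t, ucube d t -> c <= F t) -> (forall t, ucube d t -> c <= G t) ->
  mix d (fun t => F t - G t) e ->
  mix d (fun t => xlogx (F t) - xlogx (G t)) (C * e).
Proof.
move=> c0; have [C C0 lnC] := @mix_ln_diff d c M c0.
have [N N0 lnN] := @mix_ln d c M c0.
exists (2 ^+ d * N + 2 ^+ d * (`|M| * C)) => [|F G e Fm Gm cF cG FG].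
  by rewrite addr_ge0 ?mulr_ge0.
have H := mixD (mixM FG (lnN _ Fm cF)) (mixM Gm (lnC _ _ _ Fm Gm cF cG FG)).
apply: mix_le (mix_ext _ H).
  rewrite (ger0_norm (mix_ge0 Fm)) le_eqVlt; apply/orP; left; apply/eqP; ring.
by move=> t _; rewrite /xlogx; ring.
Qed.

End mixed_composition.

(** * Worst-case error *)

Section grid.
Variable R : realType.
Implicit Types (F G : seq R -> R) (M : R) (d N : nat).

Lemma sqr_sum_le n (v : 'I_n -> R) :
  (\sum_i v i) ^+ 2 <= n%:R * \sum_i v i ^+ 2.
Proof.
case: n v => [|n] v; first by rewrite !big_ord0 expr2 !mul0r.
set S := \sum_i v i; set Q := \sum_i _; pose m := S / n.+1%:R.
have : 0 <= \sum_i (v i - m) ^+ 2 by apply: sumr_ge0 => ? _; exact: sqr_ge0.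
have -> : \sum_i (v i - m) ^+ 2 = Q - m * 2 * S + n.+1%:R * m ^+ 2.
  have E i : (v i - m) ^+ 2 = v i ^+ 2 - m * 2 * v i + m ^+ 2 by ring.
  under eq_bigr do rewrite E.
  rewrite big_split sumrB /= -mulr_sumr sumr_const card_ord.
  by rewrite -[m ^+ 2 *+ n.+1]mulr_natl.
have N0 : 0 < n.+1%:R :> R by rewrite ltr0n.
rewrite /m; move: (n.+1%:R) N0 => N N0.
have -> : Q - S / N * 2 * S + N * (S / N) ^+ 2 = (N * Q - S ^+ 2) / N.
  by field; rewrite gt_eqF.
by rewrite pmulr_lge0 ?invr_gt0// subr_ge0.
Qed.

Fixpoint gmean N d F : R :=
  if d is d'.+1 then
    N%:R^-1 * \sum_(t < N) gmean N d' (fun s => F (t%:R / N%:R :: s))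
  else F [::].

(* On the grid with N points per axis, [gbeta], [gkappa] and [kerp gkappa] are the
   analogues of t - 1_(x < t), of its Gram kernel [kappa], and of the reproducing
   kernel of the unanchored space. *)
Definition gbeta N (k t : nat) : R := t%:R / N%:R - (k < t)%:R.

Definition gkappa N (k l : nat) : R :=
  N%:R^-1 * \sum_(t < N) gbeta N k t * gbeta N l t.

Fixpoint kerp (T : Type) (kap : T -> T -> R) (x y : seq T) : R :=
  match x, y with
  | a :: x', b :: y' => (1 + kap a b) * kerp kap x' y'
  | _, _ => 1
  end.

Definition gpt N (ks : seq nat) : seq R := [seq k%:R / N%:R | k <- ks].

Lemma gmeanB N d F G :
  gmean N d (fun t => F t - G t) = gmean N d F - gmean N d G.
Proof.
elim: d F G => [|d IH] F G //=.
by rewrite -mulrBr -sumrB; congr (_ * _); apply: eq_bigr => i _; exact: IH.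
Qed.

Lemma gmeanZ N d c F : gmean N d (fun t => c * F t) = c * gmean N d F.
Proof.
elim: d F => [|d IH] F //=.
by rewrite [RHS]mulrCA [in RHS]mulr_sumr; congr (_ * _); apply: eq_bigr => i _; exact: IH.
Qed.

Lemma gmean_sum N d (I : Type) (r : seq I) (F : I -> seq R -> R) :
  gmean N d (fun t => \sum_(i <- r) F i t) = \sum_(i <- r) gmean N d (F i).
Proof.
elim: d F => [|d IH] F //=.
rewrite -mulr_sumr [in RHS]exchange_big /=; congr (_ * _).
by apply: eq_bigr => i _; exact: IH.
Qed.

(** Summed by parts, the term t / N of [gbeta] gives phi (N - 1) minus the mean; the indicator
    telescopes to phi (N - 1) - phi k. As [0.-1] is 0, the summand t = 0 vanishes. *)
Lemma anova1 N (phi : nat -> R) k : (k < N)%N ->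
  phi k = N%:R^-1 * (\sum_(t < N) phi t) +
          \sum_(t < N) gbeta N k t * (phi t - phi t.-1).
Proof.
case: N => // n kn.
have N0 : n.+1%:R != 0 :> R by rewrite pnatr_eq0.
have E1 m : \sum_(t < m.+1) t%:R * (phi t - phi t.-1) =
    m.+1%:R * phi m - \sum_(t < m.+1) phi t.
  elim: m => [|m IH]; first by rewrite !big_ord1 /=; ring.
  by rewrite big_ord_recr /= IH [in RHS]big_ord_recr /= -(natr1 m.+1); ring.
have E2 m : \sum_(t < m.+1) (k < t)%:R * (phi t - phi t.-1) =
    (k <= m)%:R * (phi m - phi k).
  elim: m => [|m IH].
    by rewrite big_ord1 ltn0 leqn0 mul0r; case: eqP => [->|_] /=; ring.
  rewrite big_ord_recr /= IH ltnS (leq_eqVlt k m.+1) ltnS.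
  by case: eqP => [->|_]; rewrite /= ?ltnn//; case: (k <= m)%N => /=; ring.
under [X in _ + X]eq_bigr do rewrite /gbeta mulrBl -mulrA mulrCA.
rewrite sumrB -mulr_sumr E1 E2 -ltnS kn [_ * (_ - \sum_(t < _) _)]mulrBr mulKf//=; ring.
Qed.

Lemma unit_itv_grid N t : (t <= N)%N -> unit_itv (t%:R / N%:R : R).
Proof.
case: N => [|N tN]; first by rewrite invr0 mulr0 unit_itv0.
by rewrite /unit_itv divr_ge0//= ler_pdivrMr ?ltr0n// mul1r ler_nat.
Qed.

Lemma grid_step N (t : nat) : `|t%:R / N%:R - t.-1%:R / N%:R : R| <= N%:R^-1.
Proof.
case: t => [|t]; first by rewrite subrr normr0 invr_ge0.
by rewrite -mulrBl -natrB// subSnn mul1r ger0_norm ?invr_ge0.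
Qed.

Lemma mix_gstep N d F M (t : 'I_N) : mix d.+1 F M ->
  mix d (fun s => F (t%:R / N%:R :: s) - F (t.-1%:R / N%:R :: s)) (M / N%:R).
Proof.
move=> Fm; have M0 := mix_ge0 Fm; move: Fm => [_ F2].
apply: mix_le (F2 _ _ _ _); first by rewrite ler_wpM2l// grid_step.
- exact/unit_itv_grid/ltnW.
- by apply/unit_itv_grid/(leq_trans (leq_pred _))/ltnW.
Qed.

Lemma mix_gavg N d F M : (0 < N)%N -> mix d.+1 F M ->
  mix d (fun s => N%:R^-1 * \sum_(t < N) F (t%:R / N%:R :: s)) M.
Proof.
move=> N0 [F1 _].
apply: mix_le (mixZ _ (mix_sum (index_enum 'I_N) predT (M := fun=> M) _)).
  rewrite sumr_const card_ord -[M *+ N]mulr_natl ger0_norm ?invr_ge0//.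
  by rewrite mulKf// pnatr_eq0 -lt0n.
by move=> t; exact/F1/unit_itv_grid/ltnW.
Qed.

Definition gidx N d (ks : seq nat) := (size ks == d) && all (fun k => (k < N)%N) ks.

(** Cauchy-Schwarz over the N steps costs a factor N, and each step has mixed bound M / N by
    [mix_gstep]. Together these turn the sum of products of [gbeta] into the average [gkappa]. *)
Lemma gram_step N d n F M (c : 'I_n -> R) (k : 'I_n -> nat)
    (l : 'I_n -> seq nat) (K : 'I_n -> 'I_n -> R) : (0 < N)%N ->
  (forall G B a, mix d G B -> (\sum_i a i * G (gpt N (l i))) ^+ 2 <=
     2 ^+ d * B ^+ 2 * \sum_i \sum_j a i * a j * K i j) ->
  mix d.+1 F M ->
  (\sum_(t < N) \sum_i (c i * gbeta N (k i) t) *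
     (F (t%:R / N%:R :: gpt N (l i)) - F (t.-1%:R / N%:R :: gpt N (l i)))) ^+ 2 <=
  2 ^+ d * M ^+ 2 * \sum_i \sum_j c i * c j * (gkappa N (k i) (k j) * K i j).
Proof.
move=> N0 H Fm.
apply: (le_trans (sqr_sum_le _)).
apply: (@le_trans _ _ (N%:R * \sum_(t < N) 2 ^+ d * (M / N%:R) ^+ 2 *
  \sum_i \sum_j (c i * gbeta N (k i) t) * (c j * gbeta N (k j) t) * K i j)).
  rewrite ler_wpM2l//; apply: ler_sum => t _.
  exact: (H _ _ _ (mix_gstep t Fm)).
rewrite -mulr_sumr exchange_big /=.
under eq_bigr => i _ do rewrite exchange_big /=.
rewrite le_eqVlt; apply/orP; left; apply/eqP.
rewrite !mulr_sumr; apply: eq_bigr => i _.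
rewrite !mulr_sumr; apply: eq_bigr => j _.
have NN : N%:R != 0 :> R by rewrite pnatr_eq0 -lt0n.
have -> : \sum_(t < N) c i * gbeta N (k i) t * (c j * gbeta N (k j) t) * K i j =
    c i * c j * K i j * (N%:R * gkappa N (k i) (k j)).
  rewrite /gkappa mulVKf// mulr_sumr; apply: eq_bigr => t _; ring.
by move: (N%:R) NN (gkappa _ _ _) => n' n0 g; field.
Qed.

(** [anova1] in the first coordinate splits the sum into a mean part and a difference part, matching
    the two terms of 1 + kappa. Bounding (u + v)^2 by 2 (u^2 + v^2) costs a factor 2 per
    coordinate. *)
Lemma gram_bound N d n F M (c : 'I_n -> R) (ks : 'I_n -> seq nat) :
  (0 < N)%N -> mix d F M -> (forall i, gidx N d (ks i)) ->
  (\sum_i c i * F (gpt N (ks i))) ^+ 2 <=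
  2 ^+ d * M ^+ 2 *
    \sum_i \sum_j c i * c j * kerp (gkappa N) (ks i) (ks j).
Proof.
move=> N0; elim: d F M c ks => [|d IH] F M c ks Fm ksd.
  have ks0 i : ks i = [::] by apply/size0nil; have /andP[/eqP] := ksd i.
  under eq_bigr do rewrite ks0.
  under [X in _ * X]eq_bigr => i _ do
    (under eq_bigr do rewrite !ks0 mulr1; rewrite -mulr_sumr).
  rewrite -!mulr_suml exprMn mulrC -expr2 expr0 mul1r ler_wpM2r ?sqr_ge0//.
  by rewrite -[leLHS]real_normK ?num_real// lerXn2r ?nnegrE ?(mix_ge0 Fm).
have ksE i : ks i = head 0%N (ks i) :: behead (ks i).
  by have := ksd i; case: (ks i).
pose k i := head 0%N (ks i); pose l i := behead (ks i).
have kN i : (k i < N)%N by have := ksd i; rewrite ksE => /andP[_ /andP[]].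
have ld i : gidx N d (l i).
  by have := ksd i; rewrite ksE /gidx /= eqSS => /andP[-> /andP[_ ->]].
pose P s := N%:R^-1 * \sum_(t < N) F (t%:R / N%:R :: s).
pose D (t : 'I_N) s := F (t%:R / N%:R :: s) - F (t.-1%:R / N%:R :: s).
pose u := \sum_i c i * P (gpt N (l i)).
pose v (t : 'I_N) := \sum_i (c i * gbeta N (k i) t) * D t (gpt N (l i)).
have -> : \sum_i c i * F (gpt N (ks i)) = u + \sum_t v t.
  rewrite /u /v exchange_big -big_split /=; apply: eq_bigr => i _.
  rewrite ksE /= -/(k i) -/(l i).
  rewrite (anova1 (fun t => F (t%:R / N%:R :: gpt N (l i))) (kN i)) mulrDr.
  congr (_ + _); rewrite mulr_sumr.
  by apply: eq_bigr => t _; rewrite mulrA.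
set K := fun i j => kerp (gkappa N) (l i) (l j).
pose S0 := \sum_i \sum_j c i * c j * K i j.
pose S1 := \sum_i \sum_j c i * c j * (gkappa N (k i) (k j) * K i j).
have -> : \sum_i \sum_j c i * c j * kerp (gkappa N) (ks i) (ks j) = S0 + S1.
  rewrite -big_split; apply: eq_bigr => i _; rewrite -big_split.
  by apply: eq_bigr => j _ /=; rewrite ksE (ksE j) /= -mulrDr mulrDl mul1r.
have uS : u ^+ 2 <= 2 ^+ d * M ^+ 2 * S0.
  exact: (IH _ _ _ _ (mix_gavg N0 Fm) ld).
have vS : (\sum_t v t) ^+ 2 <= 2 ^+ d * M ^+ 2 * S1.
  by apply: gram_step => // G B a Gm; exact: IH.
have : (u + \sum_t v t) ^+ 2 <= 2 * (u ^+ 2 + (\sum_t v t) ^+ 2).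
  by rewrite -subr_ge0 (_ : _ - _ = (u - \sum_t v t) ^+ 2) ?sqr_ge0//; ring.
move=> /le_trans; apply; rewrite (exprS 2 d) -(mulrA 2 (2 ^+ d)) -(mulrA 2 (_ * _)).
by rewrite ler_pM2l// (mulrDr _ S0) lerD.
Qed.

(** Only the mean part carries the error to the induction; the difference part has no mean to
    subtract and falls under [gram_bound]. Correspondingly (1 + g) K - 1 = (K - 1) + g K. *)
Lemma gram_error_bound N d n F M (c : 'I_n -> R) (ks : 'I_n -> seq nat) :
  (0 < N)%N -> mix d F M -> (forall i, gidx N d (ks i)) ->
  (\sum_i c i * F (gpt N (ks i)) - (\sum_i c i) * gmean N d F) ^+ 2 <=
  2 ^+ d * M ^+ 2 *
    \sum_i \sum_j c i * c j * (kerp (gkappa N) (ks i) (ks j) - 1).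
Proof.
move=> N0; elim: d F M c ks => [|d IH] F M c ks Fm ksd.
  have ks0 i : ks i = [::] by apply/size0nil; have /andP[/eqP] := ksd i.
  under eq_bigr do rewrite ks0.
  rewrite -mulr_suml subrr expr2 mul0r expr0 mul1r mulr_ge0 ?sqr_ge0//.
  rewrite big1// => i _; rewrite big1// => j _.
  by rewrite !ks0 subrr mulr0.
have ksE i : ks i = head 0%N (ks i) :: behead (ks i).
  by have := ksd i; case: (ks i).
pose k i := head 0%N (ks i); pose l i := behead (ks i).
have kN i : (k i < N)%N by have := ksd i; rewrite ksE => /andP[_ /andP[]].
have ld i : gidx N d (l i).
  by have := ksd i; rewrite ksE /gidx /= eqSS => /andP[-> /andP[_ ->]].
pose P s := N%:R^-1 * \sum_(t < N) F (t%:R / N%:R :: s).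
pose D (t : 'I_N) s := F (t%:R / N%:R :: s) - F (t.-1%:R / N%:R :: s).
pose u := \sum_i c i * P (gpt N (l i)) - (\sum_i c i) * gmean N d P.
pose v (t : 'I_N) := \sum_i (c i * gbeta N (k i) t) * D t (gpt N (l i)).
have -> : \sum_i c i * F (gpt N (ks i)) - (\sum_i c i) * gmean N d.+1 F =
    u + \sum_t v t.
  have -> : gmean N d.+1 F = gmean N d P by rewrite /P gmeanZ gmean_sum.
  rewrite /u /v addrAC exchange_big -big_split /=; congr (_ - _).
  apply: eq_bigr => i _; rewrite ksE /= -/(k i) -/(l i).
  rewrite (anova1 (fun t => F (t%:R / N%:R :: gpt N (l i))) (kN i)) mulrDr.
  congr (_ + _); rewrite mulr_sumr.
  by apply: eq_bigr => t _; rewrite mulrA.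
set K := fun i j => kerp (gkappa N) (l i) (l j).
pose S0 := \sum_i \sum_j c i * c j * (K i j - 1).
pose S1 := \sum_i \sum_j c i * c j * (gkappa N (k i) (k j) * K i j).
have -> : \sum_i \sum_j c i * c j * (kerp (gkappa N) (ks i) (ks j) - 1) = S0 + S1.
  rewrite -big_split; apply: eq_bigr => i _; rewrite -big_split.
  by apply: eq_bigr => j _ /=; rewrite ksE (ksE j) /= -/(K i j); ring.
have uS : u ^+ 2 <= 2 ^+ d * M ^+ 2 * S0.
  exact: (IH _ _ _ _ (mix_gavg N0 Fm) ld).
have vS : (\sum_t v t) ^+ 2 <= 2 ^+ d * M ^+ 2 * S1.
  by apply: gram_step => // G B a Gm; exact: gram_bound.
have : (u + \sum_t v t) ^+ 2 <= 2 * (u ^+ 2 + (\sum_t v t) ^+ 2).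
  by rewrite -subr_ge0 (_ : _ - _ = (u - \sum_t v t) ^+ 2) ?sqr_ge0//; ring.
move=> /le_trans; apply; rewrite (exprS 2 d) -(mulrA 2 (2 ^+ d)) -(mulrA 2 (_ * _)).
by rewrite ler_pM2l// (mulrDr _ S0) lerD.
Qed.

End grid.

(** * From the grid to arbitrary points, by refinement *)

Section grid_limit.
Variable R : realType.
Implicit Types (F G : seq R -> R) (M : R) (d N : nat).

Lemma mix_lipschitz d F M e (x y : seq R) : mix d F M ->
  ucube d x -> ucube d y -> (forall i, `|nth 0 x i - nth 0 y i| <= e) ->
  `|F x - F y| <= d%:R * M * e.
Proof.
elim: d F x y => [|d IH] F [|a x] [|b y] //.
  by move=> _ _ _ _; rewrite subrr normr0 !mul0r.
move=> Fm; have M0 := mix_ge0 Fm; move: Fm => [F1 F2].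
rewrite !ucubeS => /andP[ua ux] /andP[ub uy] xy.
have -> : F (a :: x) - F (b :: y) =
  (F (a :: x) - F (b :: x)) + (F (b :: x) - F (b :: y)) by ring.
rewrite (le_trans (ler_normD _ _))// -natr1 !mulrDl mul1r addrC lerD//.
  by apply: IH (F1 b ub) ux uy _ => i; exact: (xy i.+1).
apply: le_trans (mix_norm (F2 _ _ ua ub) ux) _.
by rewrite ler_wpM2l// (xy 0%N).
Qed.

Definition gidxof N (x : R) : nat := Num.truncn (N%:R * x).

(** Half-open, because rounding 1 down would give the index N, outside the grid. Shifted lattice
    points, being fractional parts, satisfy it. *)
Definition unit_itvo (x : R) := 0 <= x < 1.

Definition ucubeo d (t : seq R) := (size t == d) && all unit_itvo t.

Lemma unit_itvoW x : unit_itvo x -> unit_itv x.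
Proof. by case/andP => x0 /ltW x1; apply/andP. Qed.

Lemma ucubeoW d t : ucubeo d t -> ucube d t.
Proof.
by case/andP => st /allP ut; rewrite /ucube st; apply/allP => x /ut /unit_itvoW.
Qed.

Lemma gidxof_lt N x : (0 < N)%N -> unit_itvo x -> (gidxof N x < N)%N.
Proof.
move=> N0 /andP[x0 x1]; rewrite /gidxof.
have /truncn_itv/andP[+ _] : 0 <= N%:R * x by rewrite mulr_ge0.
move=> /le_lt_trans; rewrite -(ltr_nat R); apply.
by rewrite gtr_pMr// ltr0n.
Qed.

Lemma gidxof_near N x : 0 <= x -> (0 < N)%N ->
  `|(gidxof N x)%:R / N%:R - x| <= N%:R^-1.
Proof.
move=> x0 N0; have N0' : 0 < N%:R :> R by rewrite ltr0n.
have /truncn_itv : 0 <= N%:R * x by rewrite mulr_ge0.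
rewrite -/(gidxof N x) -natr1 => /andP[h1 h2].
rewrite ler_norml lerBrDr lerBlDr.
rewrite ler_pdivlMr// mulrDl mulNr mulVf ?gt_eqF//.
rewrite ler_pdivrMr// mulrDl mulVf ?gt_eqF//.
by apply/andP; split; lra.
Qed.

Lemma gidxof_le N x : unit_itv x -> (gidxof N x <= N)%N.
Proof.
move=> /andP[x0 x1]; rewrite /gidxof.
have /truncn_itv/andP[+ _] : 0 <= N%:R * x by rewrite mulr_ge0.
rewrite -(ler_nat R) => /le_trans; apply.
by rewrite ler_piMr.
Qed.

Lemma gidxof_cvg x : unit_itvo x ->
  (gidxof n.+1 x)%:R / n.+1%:R @[n --> \oo] --> x.
Proof.
move=> /andP[x0 _]; apply/cvgrPdist_le => e e0.
have [m _ mP] : \forall n \near \oo, `|0 - n.+1%:R^-1 : R| <= e.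
  by move/cvgrPdist_le : (@cvg_harmonic R); exact.
exists m => // n /= mn; rewrite distrC.
apply: (le_trans (gidxof_near x0 _)) => //.
by have := mP n mn; rewrite sub0r normrN ger0_norm ?invr_ge0.
Qed.

Lemma gidx_gidxof N d x : (0 < N)%N -> ucubeo d x ->
  gidx N d (map (gidxof N) x).
Proof.
move=> N0 /andP[sx /allP ux]; rewrite /gidx size_map sx /=.
by apply/allP => _ /mapP[y /ux uy ->]; exact: gidxof_lt.
Qed.

Lemma grid_value_cvg d F M x : mix d F M -> ucube d x ->
  F (gpt R n.+1 (map (gidxof n.+1) x)) @[n --> \oo] --> F x.
Proof.
move=> Fm ux; apply/cvgrPdist_le => e e0.
have [m _ mP] : \forall n \near \oo, `|0 - d%:R * M * n.+1%:R^-1| <= e.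
  have : d%:R * M * n.+1%:R^-1 @[n --> \oo] --> (0 : R).
    by rewrite -(mulr0 (d%:R * M)); apply: cvgMl_tmp; exact: cvg_harmonic.
  by move/cvgrPdist_le; exact.
exists m => // n /= mn.
apply: (@le_trans _ _ (d%:R * M * n.+1%:R^-1)); last first.
  by have := mP n mn; rewrite sub0r normrN; apply/le_trans/ler_norm.
apply: (mix_lipschitz Fm).
- exact: ux.
- case/andP: ux => sx /allP ux; rewrite /gpt -map_comp /ucube size_map sx /=.
  by apply/allP => _ /mapP[y /ux uy ->]; exact/unit_itv_grid/gidxof_le.
- move=> i; case: (ltnP i (size x)) => ix; last first.
    by rewrite !nth_default ?size_map// subrr normr0 invr_ge0.
  rewrite /gpt -map_comp (nth_map 0)//= distrC; apply: gidxof_near => //.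
  case/andP: ux => _ /allP H.
  by have /H/andP[] : nth 0 x i \in x by exact: mem_nth.
Qed.

(** Equal to B_2(|x - y|) / 2 + (x - 1/2) (y - 1/2), the usual form of the unanchored kernel. *)
Definition kappa (x y : R) : R := 3^-1 + (x ^+ 2 + y ^+ 2) / 2 - Num.max x y.

(** In closed form in r = 1/N and the two grid points, continuous down to r = 0, where it becomes
    [kappa]. *)
Lemma gkappaE N k l : (k < N)%N -> (l < N)%N ->
  let r := N%:R^-1 : R in let x := k%:R / N%:R in let y := l%:R / N%:R in
  gkappa R N k l = (1 - r) * (2 - r) / 6 - ((1 - r) - x * (x + r)) / 2
     - ((1 - r) - y * (y + r)) / 2 + (1 - r - Num.max x y).
Proof.
case: N => // n kn ln r x y.
have N0 : n.+1%:R != 0 :> R by rewrite pnatr_eq0.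
have S1 i m : \sum_(t < m.+1) (i < t)%:R * t%:R =
    (i <= m)%:R * ((m%:R * (m%:R + 1) - i%:R * (i%:R + 1)) / 2) :> R.
  elim: m => [|m IH].
    by rewrite big_ord1 ltn0 leqn0; case: eqP => [->|_] /=; field.
  rewrite big_ord_recr /= IH ltnS (leq_eqVlt i m.+1) ltnS.
  have [im|mi] := leqP i m; first by rewrite orbT -(natr1 m) /=; field.
  by rewrite orbF; case: eqP => [->|_] /=; rewrite -?(natr1 m); field.
have S0 i m : \sum_(t < m.+1) (i < t)%:R = (i <= m)%:R * (m%:R - i%:R) :> R.
  elim: m => [|m IH].
    by rewrite big_ord1 ltn0 leqn0; case: eqP => [->|_] /=; ring.
  rewrite big_ord_recr /= IH ltnS (leq_eqVlt i m.+1) ltnS.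
  have [im|mi] := leqP i m; first by rewrite orbT -(natr1 m) /=; ring.
  by rewrite orbF; case: eqP => [->|_] /=; rewrite -?(natr1 m); ring.
have S2 m : \sum_(t < m.+1) t%:R ^+ 2 =
    m%:R * (m%:R + 1) * (2 * m%:R + 1) / 6 :> R.
  elim: m => [|m IH]; first by rewrite big_ord1 /=; field.
  by rewrite big_ord_recr /= IH -(natr1 m); field.
have mx t : ((k < t) && (l < t) = (maxn k l < t))%N by rewrite gtn_max.
rewrite /gkappa.
have -> : \sum_(t < n.+1) gbeta R n.+1 k t * gbeta R n.+1 l t =
  \sum_(t < n.+1) (r ^+ 2 * t%:R ^+ 2 - r * ((k < t)%:R * t%:R)
     - r * ((l < t)%:R * t%:R) + (maxn k l < t)%:R).
  apply: eq_bigr => t _; rewrite -mx /gbeta -/r.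
  by case: (k < t)%N; case: (l < t)%N => /=; ring.
rewrite big_split !sumrB /= -!mulr_sumr !S1 S0 S2 geq_max (kn : (k <= n)%N) (ln : (l <= n)%N) /=.
have nE : n%:R = r^-1 - 1 by rewrite invrK -(natr1 n); ring.
have r0 : r != 0 by rewrite invr_eq0.
have kE : k%:R = x / r by rewrite /x /r invrK mulfVK.
have lE : l%:R = y / r by rewrite /y /r invrK mulfVK.
have -> : (maxn k l)%:R = Num.max x y / r.
  rewrite /x /y -/r maxr_pMl ?invr_ge0 ?invr_ge0//.
  rewrite !mulfK//; case/orP: (leq_total k l) => kl.
    by rewrite (maxn_idPr kl) max_r ?ler_nat.
  by rewrite (maxn_idPl kl) max_l ?ler_nat.
move: (Num.max x y) => mm.
rewrite nE kE lE -/r; move: x y r r0 {nE kE lE} => x y r r0; by field.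
Qed.

Lemma gkappa_cvg x y : unit_itvo x -> unit_itvo y ->
  gkappa R n.+1 (gidxof n.+1 x) (gidxof n.+1 y) @[n --> \oo] --> kappa x y.
Proof.
move=> ux uy; pose r (n : nat) : R := n.+1%:R^-1.
have r0 : r n @[n --> \oo] --> (0 : R) by exact: cvg_harmonic.
have xc := gidxof_cvg ux; have yc := gidxof_cvg uy.
set xn := fun n : nat => _ in xc; set yn := fun n : nat => _ in yc.
have -> : (fun n => gkappa R n.+1 (gidxof n.+1 x) (gidxof n.+1 y)) =
    (fun n => (1 - r n) * (2 - r n) / 6 - ((1 - r n) - xn n * (xn n + r n)) / 2
     - ((1 - r n) - yn n * (yn n + r n)) / 2
     + (1 - r n - (xn n + yn n + `|xn n - yn n|) / 2)).
  by apply/funext => n; rewrite gkappaE ?gidxof_lt//= maxr_absE.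
have -> : kappa x y = (1 - 0) * (2 - 0) / 6 - ((1 - 0) - x * (x + 0)) / 2
     - ((1 - 0) - y * (y + 0)) / 2 + (1 - 0 - (x + y + `|x - y|) / 2).
  by rewrite /kappa maxr_absE; field.
have r1 : 1 - r n @[n --> \oo] --> (1 - 0 : R) by apply: cvgB => //; exact: cvg_cst.
have r2 : 2 - r n @[n --> \oo] --> (2 - 0 : R) by apply: cvgB => //; exact: cvg_cst.
apply: cvgD; first apply: cvgB; first apply: cvgB.
- by apply: cvgMr_tmp; exact: cvgM.
- by apply: cvgMr_tmp; apply: cvgB => //; apply: cvgM => //; exact: cvgD.
- by apply: cvgMr_tmp; apply: cvgB => //; apply: cvgM => //; exact: cvgD.
- apply: cvgB => //; apply: cvgMr_tmp; apply: cvgD; first exact: cvgD.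
  by apply: cvg_norm; exact: cvgB.
Qed.

Lemma kerp_cvg d x y : ucubeo d x -> ucubeo d y ->
  kerp (gkappa R n.+1) (map (gidxof n.+1) x) (map (gidxof n.+1) y)
    @[n --> \oo] --> kerp kappa x y.
Proof.
elim: d x y => [|d IH] [|a x] [|b y] //=; try by move=> *; exact: cvg_cst.
rewrite /ucubeo /= => /andP[sx /andP[ua ux]] /andP[sy /andP[ub uy]].
apply: cvgM.
  by apply: cvgD; [exact: cvg_cst|exact: gkappa_cvg].
by apply: IH; apply/andP.
Qed.

Lemma lattice_error_bound d n F M I (c : 'I_n -> R) (x : 'I_n -> seq R) :
  mix d F M -> (forall i, ucubeo d (x i)) -> gmean m.+1 d F @[m --> \oo] --> I ->
  (\sum_i c i * F (x i) - (\sum_i c i) * I) ^+ 2 <=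
  2 ^+ d * M ^+ 2 * \sum_i \sum_j c i * c j * (kerp kappa (x i) (x j) - 1).
Proof.
move=> Fm xd FI.
pose lhs m := (\sum_i c i * F (gpt R m.+1 (map (gidxof m.+1) (x i))) -
  (\sum_i c i) * gmean m.+1 d F) ^+ 2.
pose rhs m := 2 ^+ d * M ^+ 2 * \sum_i \sum_j c i * c j *
  (kerp (gkappa R m.+1) (map (gidxof m.+1) (x i)) (map (gidxof m.+1) (x j)) - 1).
pose S := \sum_i c i * F (x i) - (\sum_i c i) * I.
have S_cvg : \sum_i c i * F (gpt R m.+1 (map (gidxof m.+1) (x i))) -
    (\sum_i c i) * gmean m.+1 d F @[m --> \oo] --> S.
  apply: cvgB; last exact: cvgMl_tmp.
  apply: (cvg_big (op := +%R)) => [|i _]; first exact: add_continuous.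
  by apply: cvgMl_tmp; apply: grid_value_cvg Fm _; exact: ucubeoW.
have lhs_cvg : lhs m @[m --> \oo] --> S ^+ 2 by exact: (cvgM S_cvg S_cvg).
have rhs_cvg : rhs m @[m --> \oo] --> 2 ^+ d * M ^+ 2 *
    \sum_i \sum_j c i * c j * (kerp kappa (x i) (x j) - 1).
  apply: cvgMl_tmp.
  apply: (cvg_big (op := +%R)) => [|i _]; first exact: add_continuous.
  apply: (cvg_big (op := +%R)) => [|j _]; first exact: add_continuous.
  apply: cvgMl_tmp; apply: cvgB; last exact: cvg_cst.
  exact: kerp_cvg.
apply: (ler_cvg_to lhs_cvg rhs_cvg).
apply: nearW => m; apply: gram_error_bound => // i.
exact: gidx_gidxof.
Qed.

End grid_limit.

(** * Integration over boxes *)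

Section tonelli.
Variable R : realType.
Local Open Scope ereal_scope.

Lemma lebesgue_measure_nS d (f : d.+1.-tuple R -> \bar R) :
  measurable_fun [set: d.+1.-tuple R] f -> (forall t, 0 <= f t) ->
  \int[@lebesgue_measure_n R d.+1]_t f t =
  \int[@lebesgue_measure R]_x \int[@lebesgue_measure_n R d]_t f (cons_pair (x, t)).
Proof.
move=> mf f0.
transitivity (\int[@lebesgue_measure R \x @lebesgue_measure_n R d]_z f (cons_pair z)).
  rewrite /= (ge0_integral_pushforward (@measurable_cons_pair R d))//=.
rewrite fubini_tonelli1//.
exact: (measurableT_comp mf (@measurable_cons_pair R d)).
Qed.

Lemma measurable_section_integral d (f : d.+1.-tuple R -> \bar R) :
  measurable_fun [set: d.+1.-tuple R] f -> (forall t, 0 <= f t) ->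
  measurable_fun [set: measurableTypeR R]
    (fun x => \int[@lebesgue_measure_n R d]_t f (cons_pair (x, t))).
Proof.
move=> mf f0.
apply: (@measurable_fun_fubini_tonelli_F _ _ _ _ R (@lebesgue_measure_n R d)
  (fun z => f (cons_pair z))) => //.
exact: (measurableT_comp mf (@measurable_cons_pair R d)).
Qed.

End tonelli.

Section rounding.
Variable R : realType.

Lemma measurable_truncn_eq (c a : R) (k : nat) :
  measurable [set x : measurableTypeR R | Num.truncn (c * (x - a)) = k].
Proof.
have mf : measurable_fun [set: measurableTypeR R] (fun x => c * (x - a)).
  by apply: measurable_funM => //; exact: measurable_funB.
(* [truncn] is 0 on negative numbers as well, so the fibre of 0 is a half-line. *)
rewrite (_ : mkset _ = if k == 0%N
    then (fun x : R => c * (x - a)) @^-1` `]-oo, 1[%classic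
    else (fun x : R => c * (x - a)) @^-1` `[k%:R, k.+1%:R[%classic).
  by case: eqP => _; rewrite -[X in measurable X]setTI; apply: mf.
apply/seteqP; split=> x /=; case: eqP => [->|/eqP k0] /=; rewrite in_itv /=.
- move=> /eqP; case: (ltP (c * (x - a)) 1) => // h; rewrite gtn_eqF//.
  by rewrite truncn_gt0.
- move=> xk; have : 0 <= c * (x - a).
    have : (0 < Num.truncn (c * (x - a)))%N by rewrite xk lt0n.
    by rewrite truncn_gt0; exact: le_trans.
  by move=> /truncn_itv; rewrite xk.
- by move=> h; apply/eqP; rewrite -leqn0 leqNgt truncn_gt0 -ltNge.
- by move=> h; exact: truncn_def.
Qed.

(** The cap [minn N] leaves finitely many values per coordinate, so the function is a finite sum of
    indicators times functions of the remaining coordinates. *)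
Lemma measurable_rounded d (F : seq nat -> R) (c a : R) N :
  measurable_fun [set: d.-tuple R]
    (fun t => F [seq minn N (Num.truncn (c * (x - a))) | x <- tval t]).
Proof.
elim: d F => [|d IH] F.
  rewrite (_ : (fun t => _) = cst (F [::])); first exact: measurable_cst.
  by apply/funext => t; rewrite tuple0.
pose psi (x : R) := minn N (Num.truncn (c * (x - a))).
rewrite (_ : (fun t => _) = fun t : d.+1.-tuple R => \sum_(k < N.+1)
    \1_[set x | psi x = k] (thead t) * F (val k :: map psi (behead t))).
  apply: measurable_sum => k; apply: measurable_funM.
    have mI : measurable_fun [set: measurableTypeR R] (\1_[set x : R | psi x = k] : R -> R).
      apply: measurable_indic.
      have [kN|kN] := ltnP k N.
        rewrite (_ : mkset _ = [set x | Num.truncn (c * (x - a)) = k :> nat]).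
          exact: measurable_truncn_eq.
        apply/seteqP; split=> x /=; rewrite /psi; last by move=> ->; apply/minn_idPr/ltnW.
        by case: (leqP N (Num.truncn (c * (x - a)))) => // _ kE; move: kN; rewrite -kE ltnn.
      rewrite (_ : mkset _ = ~` \bigcup_(j in [set j | (j < N)%N])
          [set x | Num.truncn (c * (x - a)) = j]).
        by apply: measurableC; apply: bigcup_measurable => j _; exact: measurable_truncn_eq.
      have -> : val k = N by apply/eqP; rewrite eqn_leq kN -ltnS ltn_ord.
      apply/seteqP; split=> x /=; rewrite /psi.
        move=> /minn_idPl NT [j /= jN Tj]; by rewrite Tj leqNgt jN in NT.
      move=> H; apply/minn_idPl; rewrite leqNgt; apply/negP => TN; apply: H.
      by exists (Num.truncn (c * (x - a))).
    exact: (measurableT_comp mI (measurable_tnth ord0)).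
  exact: (measurableT_comp (IH (fun ks => F (val k :: ks))) (@measurable_behead _ R d)).
apply/funext => t; have -> : tval t = thead t :: behead t by rewrite {1}(tuple_eta t).
have pN : (psi (thead t) < N.+1)%N by rewrite ltnS geq_minl.
rewrite (bigD1 (Ordinal pN))//= big1 => [|k kN].
  by rewrite indicE mem_set// mul1r addr0.
rewrite indicE memNset ?mul0r//= => pk; move: kN.
by rewrite -val_eqE /= pk eqxx.
Qed.

End rounding.

Section box_step.
Variable R : realType.
Implicit Types (F G : seq R -> R) (M : R) (d N : nat).

Lemma ge0_integral_itvco_split (h : R -> \bar R) (a b c : R) : a <= b -> b <= c ->
  measurable_fun [set: measurableTypeR R] h -> (forall x, 0 <= h x)%E ->
  (\int[@lebesgue_measure R]_(x in `[a, c[) h x = \int[@lebesgue_measure R]_(x in `[a, b[) h x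
    + \int[@lebesgue_measure R]_(x in `[b, c[) h x)%E.
Proof.
move=> ab bc mh h0.
have -> : `[a, c[%classic = `[a, b[%classic `|` `[b, c[%classic.
  by rewrite -itv_bndbnd_setU// bnd_simp.
rewrite ge0_integral_setU//=; first by apply: measurable_funS mh.
rewrite disj_set2E; apply/eqP; apply/seteqP; split=> // x [] /=.
by rewrite !in_itv /= => /andP[_ h1] /andP[h2 _]; have := lt_le_trans h1 h2; rewrite ltxx.
Qed.

Lemma step_integral_bounds (h : R -> \bar R) (a delta : R) (l u : nat -> R) N :
  measurable_fun [set: measurableTypeR R] h -> (forall x, 0 <= h x)%E -> 0 < delta ->
  (forall k (x : R), (k < N)%N -> a + delta * k%:R <= x < a + delta * k.+1%:R ->
     ((l k)%:E <= h x <= (u k)%:E)%E) ->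
  ((delta * \sum_(k < N) l k)%:E <=
    \int[@lebesgue_measure R]_(x in `[a, (a + delta * N%:R)%R[) h x <=
    (delta * \sum_(k < N) u k)%:E)%E.
Proof.
move=> mh h0 d0; elim: N => [|N IH] H.
  by rewrite !big_ord0 !mulr0 addr0 set_itvco0 integral_set0 lexx.
have /IH/andP[IHl IHu] : forall k (x : R), (k < N)%N -> a + delta * k%:R <= x < a + delta * k.+1%:R ->
     ((l k)%:E <= h x <= (u k)%:E)%E.
  by move=> k x kN; apply: H; rewrite ltnS ltnW.
have aN : a <= a + delta * N%:R by rewrite lerDl mulr_ge0// ltW.
have NN : a + delta * N%:R <= a + delta * N.+1%:R.
  by rewrite lerD2l ler_pM2l// ler_nat.
rewrite (ge0_integral_itvco_split aN NN mh h0).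
have mI : lebesgue_measure `[a + delta * N%:R, a + delta * N.+1%:R[%classic = delta%:E.
  rewrite lebesgue_measure_itv/= lte_fin ltrD2l ltr_pM2l// ltr_nat ltnSn -EFinD.
  by rewrite -(natr1 N); congr EFin; ring.
have mJ : measurable_fun (`[a + delta * N%:R, a + delta * N.+1%:R[%classic : set (measurableTypeR R)) h.
  exact: measurable_funS mh.
rewrite !big_ord_recr /= !mulrDr !EFinD; apply/andP; split.
  apply: leeD => //.
  (* Integrals are compared between nonnegative functions only, and [l N] may be negative; it is
     replaced by its positive part first. *)
  apply: (@le_trans _ _ (\int[lebesgue_measure]_(x in `[(a + delta * N%:R)%R, (a + delta * N.+1%:R)%R[) (Num.max 0 (l N))%:E)%E).
    rewrite integral_cst// [X in (_ * X)%E]mI -EFinM lee_fin mulrC ler_wpM2r ?(ltW d0)//.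
    by rewrite le_max lexx orbT.
  apply: ge0_le_integral => //=.
  - by move=> x _; rewrite lee_fin le_max lexx.
  - move=> x; rewrite in_itv /= => xI; have /andP[+ _] := H N x (ltnSn N) xI.
    by case: (leP 0 (l N)).
apply: leeD => //.
apply: (@le_trans _ _ (\int[lebesgue_measure]_(x in `[(a + delta * N%:R)%R, (a + delta * N.+1%:R)%R[) (u N)%:E)%E).
  apply: ge0_le_integral => //=.
  by move=> x; rewrite in_itv /= => xI; have /andP[_ +] := H N x (ltnSn N) xI.
by rewrite integral_cst// [X in (_ * X)%E]mI -EFinM lee_fin mulrC.
Qed.

Definition rescale (a b x : R) := (x - a) / (b - a).

Lemma rescale_unit a b x : a < b -> a <= x <= b -> unit_itv (rescale a b x).
Proof.
move=> ab /andP[ax xb]; have ba : 0 < b - a by rewrite subr_gt0.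
by rewrite /unit_itv divr_ge0 ?subr_ge0 ?(ltW ab)//= ler_pdivrMr// mul1r lerD2r.
Qed.

Lemma rescale_box a b d (t : d.-tuple R) : a < b -> box d a b t ->
  ucube d (map (rescale a b) t).
Proof.
move=> ab tab; rewrite /ucube size_map size_tuple eqxx /=.
by apply/allP => _ /mapP[x /tnthP[i ->] ->]; apply: rescale_unit.
Qed.

(** Such functions are Lipschitz, hence pointwise limits of functions of the rounded coordinates. *)
Lemma measurable_mix_box d F M a b : a < b -> mix d F M ->
  measurable_fun (box d a b) (fun t : d.-tuple R => F (map (rescale a b) t)).
Proof.
move=> ab Fm; have ba : b - a != 0 by rewrite subr_eq0 gt_eqF.
apply: (@measurable_fun_cvg _ _ _ _ (fun n (t : d.-tuple R) => F (gpt R n.+1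
  [seq minn n.+1 (Num.truncn (n.+1%:R / (b - a) * (x - a))) | x <- tval t]))).
  move=> n; apply: measurable_funTS.
  exact: (measurable_rounded (fun ks => F (gpt R n.+1 ks))).
move=> t tab; have := grid_value_cvg Fm (rescale_box ab tab).
apply: cvg_trans; apply: near_eq_cvg; apply: nearW => n /=.
congr (F (gpt _ _ _)); rewrite -map_comp; apply/eq_in_map => x xt /=.
have -> : n.+1%:R / (b - a) * (x - a) = n.+1%:R * rescale a b x.
  by rewrite /rescale -mulrA (mulrC _ (x - a)).
apply/esym/minn_idPr; apply: gidxof_le; apply: rescale_unit => //.
by case/tnthP: xt => i ->.
Qed.

End box_step.

Section box_integral.
Variable R : realType.
Implicit Types (F G : seq R -> R) (M : R) (d N : nat).

Lemma gmean_le N d F M : (0 < N)%N -> mix d F M -> `|gmean N d F| <= M.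
Proof.
move=> N0; elim: d F => [//|d IH] F [F1 _] /=.
rewrite normrM ger0_norm ?invr_ge0// ler_pdivrMl ?ltr0n// mulrC.
apply: (le_trans (ler_norm_sum _ _ _)).
apply: (@le_trans _ _ (\sum_(t < N) M)); last first.
  by rewrite sumr_const card_ord -[M *+ N]mulr_natl mulrC.
by apply: ler_sum => t _; apply/IH/F1/unit_itv_grid/ltnW.
Qed.

Lemma gmean_slice N d F M (a b : R) : (0 < N)%N -> mix d.+1 F M ->
  unit_itv a -> unit_itv b ->
  `|gmean N d (fun s => F (a :: s)) - gmean N d (fun s => F (b :: s))| <= M * `|a - b|.
Proof.
by move=> N0 [_ F2] ua ub; rewrite -gmeanB; apply: gmean_le => //; exact: F2.
Qed.

Lemma box0 (a b : R) : box 0 a b = setT.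
Proof. by apply/seteqP; split=> // t _ [[]]. Qed.

Lemma box_cons d (a b x : R) (t : d.-tuple R) :
  box d.+1 a b (cons_pair (x, t)) <-> (a <= x <= b) /\ box d a b t.
Proof.
split=> [H|[H1 H2] i].
  split=> [|i]; first by have := H ord0; rewrite tnth0.
  by have := H (lift ord0 i); rewrite tnthS.
by case: (unliftP ord0 i) => [j ->|->]; rewrite ?tnthS ?tnth0.
Qed.

(** Tonelli slices off the first coordinate. On each of the N cells, moving the slice to the left
    grid point costs M / N by [gmean_slice], and every coordinate adds one such term. *)
Lemma ge0_box_integral_bounds d F M (a b : R) N : a < b -> (0 < N)%N -> mix d F M ->
  (forall t, ucube d t -> 0 <= F t) ->
  (((b - a) ^+ d * (gmean N d F - d%:R * M / N%:R))%:E <=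
    \int[@lebesgue_measure_n R d]_(t in box d a b) (F (map (rescale a b) t))%:E <=
   ((b - a) ^+ d * (gmean N d F + d%:R * M / N%:R))%:E)%E.
Proof.
move=> ab N0; have ba : 0 < b - a by rewrite subr_gt0.
have NN : 0 < N%:R :> R by rewrite ltr0n.
elim: d F => [|d IH] F Fm F0.
  have mF := measurable_mix_box ab Fm; rewrite box0 in mF *.
  rewrite integral_dirac//=; last exact/measurable_EFinP.
  by rewrite diracE in_setT mul1e !mul0r subr0 addr0 expr0 mul1r lexx.
have Fx x : unit_itv x -> mix d (fun s => F (x :: s)) M by exact: Fm.1.
have Fx0 x : unit_itv x -> forall t, ucube d t -> 0 <= F (x :: t).
  by move=> ux t ut; apply: F0; rewrite ucubeS ux.
pose f : d.+1.-tuple R -> \bar R :=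
  (fun t => (F (map (rescale a b) t))%:E) \_ (box d.+1 a b).
have mf : measurable_fun [set: d.+1.-tuple R] f.
  apply/(measurable_restrictT _ _).1; first exact: measurable_box.
  by apply/measurable_EFinP; exact: measurable_mix_box Fm.
have f0 t : (0 <= f t)%E.
  rewrite /f patchE; case: ifPn => //; rewrite inE => tab.
  by rewrite lee_fin; apply/F0/rescale_box.
pose h x := (\int[@lebesgue_measure_n R d]_t f (cons_pair (x, t)))%E.
have hE x : a <= x <= b -> h x = (\int[@lebesgue_measure_n R d]_(t in box d a b)
   (F (rescale a b x :: map (rescale a b) t))%:E)%E.
  move=> xab; rewrite [RHS]integral_mkcond; apply: eq_integral => t _.
  rewrite /f !patchE; have [tab|tab] := pselect (box d a b t).
    by rewrite !mem_set//; apply/box_cons.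
  by rewrite !memNset// => /box_cons[].
have h_out x : ~~ (a <= x <= b) -> h x = 0%E.
  move=> xab; rewrite /h (eq_integral (cst 0%E)) ?integral0// => t _.
  rewrite /f patchE memNset// => /box_cons[xab' _]; by rewrite xab' in xab.
rewrite integral_mkcond -/f lebesgue_measure_nS// -/h.
(* The slice integral vanishes off [a, b], and dropping the null point b lets the half-open cells
   tile the domain exactly. *)
have -> : (\int[@lebesgue_measure R]_x h x = \int[@lebesgue_measure R]_(x in `[a, b[) h x)%E.
  have mh : measurable_fun [set: measurableTypeR R] h by exact: measurable_section_integral.
  rewrite integral_itv_bndo_bndc; last exact: measurable_funS mh.
  rewrite [RHS]integral_mkcond; apply: eq_integral => x _.
  rewrite patchE; case: ifPn => //; rewrite notin_setE /= in_itv /= => /negP.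
  exact: h_out.
pose delta := (b - a) / N%:R.
have bE : b = a + delta * N%:R by rewrite /delta mulfVK ?gt_eqF//; ring.
pose v k := gmean N d (fun s => F (k%:R / N%:R :: s)).
pose e := d.+1%:R * M / N%:R.
have := @step_integral_bounds R h a delta
  (fun k => (b - a) ^+ d * (v k - e)) (fun k => (b - a) ^+ d * (v k + e)) N.
have mh : measurable_fun [set: measurableTypeR R] h by exact: measurable_section_integral.
have h0 x : (0 <= h x)%E by apply: integral_ge0.
have delta0 : 0 < delta by rewrite divr_gt0.
rewrite -bE => /(_ mh h0 delta0) H.
have sumE (x : R) : \sum_(k < N) (b - a) ^+ d * (v k + x) =
    (b - a) ^+ d * N%:R * (gmean N d.+1 F + x).
  rewrite -mulr_sumr big_split /= sumr_const card_ord -[x *+ N]mulr_natl.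
  by rewrite -mulrA; congr (_ * _); rewrite mulrDr mulVKf// gt_eqF.
have cE (x : R) : delta * ((b - a) ^+ d * N%:R * x) = (b - a) ^+ d.+1 * x.
  by rewrite /delta exprS; field; rewrite gt_eqF.
move: H; rewrite /= (sumE (- e)) (sumE e) !cE; apply.
move=> k x kN /andP[kx xk].
have xab : a <= x <= b.
  apply/andP; split.
    by apply: le_trans kx; rewrite lerDl mulr_ge0// ltW.
  by rewrite bE (le_trans (ltW xk))// lerD2l ler_pM2l// ler_nat.
have ux := rescale_unit ab xab.
rewrite hE//.
have /andP[IHl IHu] := IH (fun s => F (rescale a b x :: s)) (Fx _ ux) (Fx0 _ ux).
have uk := unit_itv_grid R (ltnW kN).
have xN : `|rescale a b x - k%:R / N%:R| <= N%:R^-1.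
  have -> : rescale a b x - k%:R / N%:R = (x - (a + delta * k%:R)) / (b - a).
    by rewrite /rescale /delta; field; rewrite !gt_eqF.
  rewrite normrM (ger0_norm (x := (b - a)^-1)) ?invr_ge0 ?(ltW ba)//.
  rewrite ler_pdivrMr// ger0_norm ?subr_ge0// [N%:R^-1 * _]mulrC -/delta.
  by move: xk; rewrite -(natr1 k); lra.
have M0 := mix_ge0 Fm.
have := gmean_slice N0 Fm ux uk; rewrite -/(v k).
have := ler_wpM2l M0 xN.
move: (gmean N d _) IHl IHu => w IHl IHu h1 h2.
have {h1}h2 := le_trans h2 h1.
move: h2; rewrite ler_norml => /andP[h3 h4].
have eE : e = d%:R * M / N%:R + M / N%:R.
  by rewrite /e -(natr1 d) mulrDl mul1r mulrDl.
have bd : 0 <= (b - a) ^+ d by rewrite exprn_ge0// ltW.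
apply/andP; split.
  apply: le_trans IHl; rewrite lee_fin ler_wpM2l// eE; lra.
by apply: (le_trans IHu); rewrite lee_fin ler_wpM2l// eE; lra.
Qed.

End box_integral.

Section cube_mean.
Variable R : realType.
Implicit Types (F G : seq R -> R) (M : R) (d N : nat).

Lemma gmean_cst N d (c : R) : (0 < N)%N -> gmean N d (fun=> c) = c.
Proof.
move=> N0; elim: d => [|d IH] //=; rewrite IH sumr_const card_ord.
by rewrite -[c *+ N]mulr_natl mulKf// pnatr_eq0 -lt0n.
Qed.

Lemma gmeanD N d F G : gmean N d (fun t => F t + G t) = gmean N d F + gmean N d G.
Proof.
elim: d F G => [|d IH] F G //=.
by rewrite -mulrDr -big_split; congr (_ * _); apply: eq_bigr => i _; exact: IH.
Qed.

Lemma gmean_ge N d F c : (0 < N)%N -> (forall t, ucube d t -> c <= F t) ->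
  c <= gmean N d F.
Proof.
move=> N0; elim: d F => [|d IH] F cF /=; first exact: cF.
rewrite ler_pdivlMl ?ltr0n//.
rewrite -[N in leLHS]card_ord mulr_natl -sumr_const; apply: ler_sum => i _.
by apply: IH => t ut; apply: cF; rewrite ucubeS ut andbT; exact/unit_itv_grid/ltnW.
Qed.

Lemma mix_integrable_box d F M (a b : R) : a < b -> mix d F M ->
  (@lebesgue_measure_n R d).-integrable (box d a b)
    (EFin \o (fun t : d.-tuple R => F (map (rescale a b) t))).
Proof.
move=> ab Fm; apply: measurable_bounded_integrable.
- exact: measurable_box.
- by rewrite [X in (X < _)%E](lebesgue_measure_n_box _ (ltW ab)) ltry.
- exact: measurable_mix_box Fm.
- exists M; split; first exact: num_real.
  move=> N MN t tab /=; apply: le_trans (ltW MN).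
  exact: (mix_norm Fm (rescale_box ab tab)).
Qed.

(** Adding the constant M makes F nonnegative, which doubles the mixed bound. *)
Lemma box_integral_bound d F M (a b : R) N : a < b -> (0 < N)%N -> mix d F M ->
  `|\int[@lebesgue_measure_n R d]_(t in box d a b) F (map (rescale a b) t) -
    (b - a) ^+ d * gmean N d F| <= (b - a) ^+ d * (d%:R * (M + M) / N%:R).
Proof.
move=> ab N0 Fm; have M0 := mix_ge0 Fm.
have Cm : mix d (fun=> M) M by have := mix_cst d M; rewrite ger0_norm.
have FMm := mixD Fm Cm.
have := @ge0_box_integral_bounds R d _ _ a b N ab N0 FMm.
have F0 t : ucube d t -> 0 <= F t + M.
  by move=> /(mix_norm Fm); rewrite ler_norml => /andP[+ _]; lra.
have mub : @lebesgue_measure_n R d (box d a b) = ((b - a) ^+ d)%:E.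
  by rewrite lebesgue_measure_n_box// ltW.
have -> : (\int[@lebesgue_measure_n R d]_(t in box d a b)
    (F (map (rescale a b) t) + M)%:E)%E =
  (\int[@lebesgue_measure_n R d]_(t in box d a b) F (map (rescale a b) t)
    + (b - a) ^+ d * M)%:E.
  have iF := mix_integrable_box ab Fm; have iM := mix_integrable_box ab Cm.
  have mB := @measurable_box R d a b.
  transitivity (\int[@lebesgue_measure_n R d]_(t in box d a b)
     (F (map (rescale a b) t))%:E + \int[@lebesgue_measure_n R d]_(t in box d a b) M%:E)%E.
    by rewrite -integralD_EFin.
  rewrite integral_cst// [X in (_ + _ * X)%E]mub -EFinM mulrC EFinD; congr (_ + _)%E.
  rewrite /Rintegral fineK//; exact: integrable_fin_num.
rewrite !lee_fin gmeanD gmean_cst// => /(_ F0).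
rewrite ler_distl; move: (Rintegral _ _ _) (gmean N d F) ((b - a) ^+ d) => I g e.
move: (_ / _) => r /andP[h1 h2]; apply/andP; split; lra.
Qed.

Definition cube_mean d F : R := \int[@lebesgue_measure_n R d]_(t in box d 0 1) F t.

Lemma cube_meanE d F :
  cube_mean d F = \int[@lebesgue_measure_n R d]_(t in box d 0 1) F (map (rescale 0 1) t).
Proof.
apply: eq_Rintegral => t _; congr (F _); rewrite -[LHS]map_id.
by apply: eq_map => x; rewrite /rescale !subr0 divr1.
Qed.

Lemma gmean_cvg_box d F M (a b : R) : a < b -> mix d F M ->
  (b - a) ^+ d * gmean n.+1 d F @[n --> \oo] -->
  \int[@lebesgue_measure_n R d]_(t in box d a b) F (map (rescale a b) t).
Proof.
move=> ab Fm; apply/cvgrPdist_le => e e0.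
have : (b - a) ^+ d * (d%:R * (M + M)) * n.+1%:R^-1 @[n --> \oo] --> (0 : R).
  rewrite -(mulr0 ((b - a) ^+ d * (d%:R * (M + M)))); apply: cvgMl_tmp.
  exact: cvg_harmonic.
move/cvgrPdist_le => /(_ _ e0)[m _ mP].
exists m => // n /= mn; apply: le_trans (box_integral_bound ab (ltn0Sn n) Fm) _.
have H := mP n mn; rewrite /= sub0r normrN in H.
by rewrite mulrA; exact: le_trans (ler_norm _) H.
Qed.

Lemma gmean_cvg d F M : mix d F M -> gmean n.+1 d F @[n --> \oo] --> cube_mean d F.
Proof.
move=> Fm; rewrite cube_meanE; have := gmean_cvg_box ltr01 Fm.
rewrite subr0 expr1n; apply: cvg_trans; apply: near_eq_cvg.
by apply: nearW => n /=; rewrite mul1r.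
Qed.

(** An affine change of variables in d dimensions, read off from the fact that both integrals are
    limits of the same grid means. *)
Lemma box_integralE d F M (a b : R) : a < b -> mix d F M ->
  \int[@lebesgue_measure_n R d]_(t in box d a b) F (map (rescale a b) t) =
  (b - a) ^+ d * cube_mean d F.
Proof.
move=> ab Fm; have := gmean_cvg_box ab Fm.
by move/cvg_unique; apply => //; apply: cvgMl_tmp; exact: gmean_cvg Fm.
Qed.

Lemma cube_meanB d F G M (N : R) : mix d F M -> mix d G N ->
  cube_mean d (fun t => F t - G t) = cube_mean d F - cube_mean d G.
Proof.
move=> Fm Gm; have := gmean_cvg (mixB Fm Gm).
have -> : (fun n => gmean n.+1 d (fun t => F t - G t)) =
    (fun n => gmean n.+1 d F - gmean n.+1 d G) by apply/funext => n; exact: gmeanB.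
move/cvg_unique; apply => //.
by apply: cvgB; [exact: gmean_cvg Fm|exact: gmean_cvg Gm].
Qed.

Lemma cube_mean_norm d F M : mix d F M -> `|cube_mean d F| <= M.
Proof.
move=> Fm; have H : `|gmean n.+1 d F| @[n --> \oo] --> `|cube_mean d F|.
  by apply: cvg_norm; exact: gmean_cvg Fm.
by apply: (ler_cvg_to H (cvg_cst M)); apply: nearW => n; exact: gmean_le.
Qed.

Lemma cube_mean_ge d F M c : mix d F M -> (forall t, ucube d t -> c <= F t) ->
  c <= cube_mean d F.
Proof.
move=> Fm cF; apply: (ler_cvg_to (cvg_cst c) (gmean_cvg Fm)).
by apply: nearW => n; exact: gmean_ge.
Qed.

End cube_mean.

(** * Averaging over the shift *)

Section shift_average.
Variable R : realType.

Lemma frac_unit (x : R) : unit_itvo (frac x).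
Proof.
have := Num.Theory.floor_itv x; rewrite /frac intrD => /andP[h1 h2].
by apply/andP; split; lra.
Qed.

Lemma frac_def (x : R) (k : int) : k%:~R <= x < (k + 1)%:~R -> frac x = x - k%:~R.
Proof. by move=> /Num.Theory.floor_def kE; rewrite /frac kE. Qed.

Lemma frac_shift_low (a x : R) : 0 <= x < 1 - frac a -> frac (a + x) = frac a + x.
Proof.
move=> /andP[x0 xa]; have /andP[a0 a1] := frac_unit a.
rewrite (@frac_def _ (Num.floor a)); first by rewrite /frac; ring.
move: a0 xa; rewrite intrD /frac => a0 xa; apply/andP; split; lra.
Qed.

Lemma frac_shift_high (a x : R) : 1 - frac a <= x < 1 -> frac (a + x) = frac a + x - 1.
Proof.
move=> /andP[x0 xa]; have /andP[a0 a1] := frac_unit a.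
rewrite (@frac_def _ (Num.floor a + 1)); first by rewrite /frac intrD; ring.
move: a0 a1 x0; rewrite !intrD /frac => a0 a1 x0; apply/andP; split; lra.
Qed.

Lemma measurable_frac (a : R) : measurable_fun [set: measurableTypeR R] (fun x => frac (a + x)).
Proof.
rewrite /frac; apply: measurable_funB; first exact: measurable_funD.
apply: nondecreasing_measurable => // x y xy.
by rewrite ler_int; apply: Num.Theory.le_floor; rewrite lerD2l.
Qed.

Lemma kappa_sym (x y : R) : kappa x y = kappa y x.
Proof. by rewrite /kappa maxC (addrC (x ^+ 2)). Qed.

Lemma kappa_ge (x y : R) : unit_itv x -> unit_itv y -> 0 <= 1 + kappa x y.
Proof.
move=> /andP[x0 x1] /andP[y0 y1]; rewrite /kappa.
have := sqr_ge0 (x - 1); have := sqr_ge0 (y - 1).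
rewrite !sqrrB !expr1n !mulr1; have := sqr_ge0 x; have := sqr_ge0 y.
by case: (leP x y) => _; lra.
Qed.

Definition shift_kernel (a a' x : R) : R := 1 + kappa (frac (a + x)) (frac (a' + x)).

Lemma shift_kernel_ge0 a a' x : 0 <= shift_kernel a a' x.
Proof. by apply: kappa_ge; exact/unit_itvoW/frac_unit. Qed.

Lemma measurable_shift_kernel a a' :
  measurable_fun [set: measurableTypeR R] (shift_kernel a a').
Proof.
have ma := measurable_frac a; have ma' := measurable_frac a'.
apply: measurable_funD => //; rewrite /kappa; apply: measurable_funB.
  apply: measurable_funD => //; apply: measurable_funM => //.
  by apply: measurable_funD; exact: measurable_funX.
exact: measurable_maxr.
Qed.

Lemma integral_quadratic (p q r c d : R) : c <= d ->
  (\int[@lebesgue_measure R]_(x in `[c, d[) (p * x ^+ 2 + q * x + r)%:E)%E =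
  ((p / 3 * d ^+ 3 + q / 2 * d ^+ 2 + r * d) -
   (p / 3 * c ^+ 3 + q / 2 * c ^+ 2 + r * c))%:E.
Proof.
rewrite le_eqVlt => /predU1P[->|cd].
  by rewrite set_itvco0 integral_set0 subrr.
pose F : R -> R := (p / 3) *: (id ^+ 3) + (q / 2) *: (id ^+ 2) + r *: id.
have FE (x : R) : F x = p / 3 * x ^+ 3 + q / 2 * x ^+ 2 + r * x by [].
have dF (x : R) : is_derive x 1 F (p * x ^+ 2 + q * x + r).
  have d1 : is_derive x 1 (@id R) 1 by exact: is_derive_id.
  have d2 := @is_deriveX R R id 2 x 1 1 d1; have d3 := @is_deriveX R R id 3 x 1 1 d1.
  have D := is_deriveD (is_deriveD (is_deriveZ (p / 3) d3) (is_deriveZ (q / 2) d2))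
    (is_deriveZ r d1).
  by apply: (is_derive_eq D); rewrite /GRing.scale /= !mulr1 expr1; field.
have cF : continuous F.
  by move=> x; apply: differentiable_continuous; apply/derivable1_diffP; exact: ex_derive.
have cf : continuous (fun x : R => p * x ^+ 2 + q * x + r).
  move=> x; apply: cvgD; last exact: cvg_cst.
  apply: cvgD; last by apply: cvgMl_tmp; exact: cvg_id.
  by apply: cvgMl_tmp; exact: exprn_continuous.
rewrite integral_itv_bndo_bndc; last first.
  apply/measurable_EFinP; apply: measurable_funTS.
  exact: continuous_measurable_fun.
rewrite (@continuous_FTC2 _ _ F)// -?FE ?EFinB//.
- exact: continuous_subspaceT.
- split; [by move=> x _; exact: ex_derive|by apply: cvg_at_right_filter; exact: cF|by apply: cvg_at_left_filter; exact: cF].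
- by move=> x _; rewrite derive1E; exact: derive_val.
Qed.

Lemma shift_kernel_piece (a a' u v c d : R) : c <= d ->
  (forall x, c <= x < d -> frac (a + x) = u + x) ->
  (forall x, c <= x < d -> frac (a' + x) = v + x) ->
  (\int[@lebesgue_measure R]_(x in `[c, d[) (shift_kernel a a' x)%:E)%E =
  (let r := 4 / 3 + (u ^+ 2 + v ^+ 2) / 2 - Num.max u v in
   (3^-1 * d ^+ 3 + (u + v - 1) / 2 * d ^+ 2 + r * d) -
   (3^-1 * c ^+ 3 + (u + v - 1) / 2 * c ^+ 2 + r * c))%:E.
Proof.
move=> cd fa fa'; rewrite -[3^-1]mul1r -integral_quadratic//.
apply: eq_integral => x; rewrite inE /= in_itv /= => xcd.
rewrite /shift_kernel fa// fa'// /kappa -addr_maxl; congr EFin.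
by move: (Num.max u v) => w; field.
Qed.

(** Of the two summands B_2(|x - y|) / 2 and (x - 1/2) (y - 1/2) of [kappa], each averages to half
    of B_2 of the distance. The integral is computed on three pieces, cut at 1 - be and 1 - al,
    where one of the fractional parts wraps around. *)
Lemma integral_shift_kernel_le (a a' : R) : frac a <= frac a' ->
  (\int[@lebesgue_measure R]_(x in `[0%R, 1%R]) (shift_kernel a a' x)%:E)%E =
  (1 + bernoulli2 `|frac a - frac a'|)%:E.
Proof.
move=> aa'; have /andP[a0 a1] := frac_unit a; have /andP[b0 b1] := frac_unit a'.
set al := frac a in aa' a0 a1 *; set be := frac a' in aa' b0 b1 *.
have mk : measurable_fun [set: measurableTypeR R] (fun x => (shift_kernel a a' x)%:E).
  by apply/measurable_EFinP; exact: measurable_shift_kernel.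
have k0 x : (0 <= (shift_kernel a a' x)%:E)%E by rewrite lee_fin shift_kernel_ge0.
rewrite -integral_itv_bndo_bndc; last exact: measurable_funS mk.
have h1 : 0 <= 1 - be by lra.
have h2 : 1 - be <= 1 - al by lra.
have h3 : 1 - al <= 1 by lra.
rewrite (ge0_integral_itvco_split h1 (le_trans h2 h3) mk k0).
rewrite (ge0_integral_itvco_split h2 h3 mk k0).
rewrite (@shift_kernel_piece a a' al be 0 (1 - be))//; first last.
- by move=> x /frac_shift_low.
- by move=> x /andP[x0 xb]; apply: frac_shift_low; rewrite x0 -/al (lt_le_trans xb h2).
rewrite (@shift_kernel_piece a a' al (be - 1) (1 - be) (1 - al))//; first last.
- move=> x /andP[x0 xb]; rewrite frac_shift_high; first by rewrite -/be; ring.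
  by rewrite -/be x0 (lt_le_trans xb h3).
- move=> x /andP[x0 xb]; apply: frac_shift_low; rewrite -/al xb andbT.
  exact: le_trans h1 x0.
rewrite (@shift_kernel_piece a a' (al - 1) (be - 1) (1 - al) 1)//; first last.
- move=> x /andP[x0 xb]; rewrite frac_shift_high; first by rewrite -/be; ring.
  by rewrite -/be xb (le_trans h2 x0).
- move=> x /andP[x0 xb]; rewrite frac_shift_high; first by rewrite -/al; ring.
  by rewrite -/al x0 xb.
rewrite -!EFinD /bernoulli2 /=; congr EFin.
rewrite (max_r aa') (max_l (_ : be - 1 <= al)); last by lra.
rewrite (max_r (_ : al - 1 <= be - 1)); last by lra.
rewrite ler0_norm ?subr_le0//; move: al be {a0 a1 b0 b1 aa' h1 h2 h3} => al be.
by field.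
Qed.

Lemma shift_kernel_sym a a' x : shift_kernel a a' x = shift_kernel a' a x.
Proof. by rewrite /shift_kernel kappa_sym. Qed.

Lemma integral_shift_kernel (a a' : R) :
  (\int[@lebesgue_measure R]_(x in `[0%R, 1%R]) (shift_kernel a a' x)%:E)%E =
  (1 + bernoulli2 `|frac a - frac a'|)%:E.
Proof.
case/orP: (le_total (frac a) (frac a')); first exact: integral_shift_kernel_le.
move=> /integral_shift_kernel_le; rewrite distrC => <-.
by apply: eq_integral => x _; rewrite shift_kernel_sym.
Qed.

End shift_average.

Section product_integral.
Variable R : realType.

Lemma measurable_prod_tnth d (psi : 'I_d -> R -> R) :
  (forall j, measurable_fun [set: measurableTypeR R] (psi j)) ->
  measurable_fun [set: d.-tuple R] (fun t => \prod_(j < d) psi j (tnth t j)).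
Proof.
move=> mpsi; apply: measurable_prod => j _.
exact: (measurableT_comp (mpsi j) (measurable_tnth j)).
Qed.

Lemma integral_prod_tnth d (psi : 'I_d -> R -> R) (v : 'I_d -> R) :
  (forall j, measurable_fun [set: measurableTypeR R] (psi j)) ->
  (forall j x, 0 <= psi j x) ->
  (forall j, (\int[@lebesgue_measure R]_(x in `[0%R, 1%R]) (psi j x)%:E)%E = (v j)%:E) ->
  (\int[@lebesgue_measure_n R d]_(t in box d 0 1) (\prod_(j < d) psi j (tnth t j))%:E)%E =
  (\prod_(j < d) v j)%:E.
Proof.
elim: d psi v => [|d IH] psi v mpsi psi0 psiv.
  rewrite box0 integral_dirac//=; last first.
    by apply/measurable_EFinP; exact: measurable_prod_tnth.
  by rewrite diracE in_setT mul1e !big_ord0.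
have m1 : measurable_fun [set: d.+1.-tuple R] (fun t => (\prod_(j < d.+1) psi j (tnth t j))%:E).
  by apply/measurable_EFinP; exact: measurable_prod_tnth.
have m2 : measurable_fun [set: d.-tuple R]
    (fun t => (\prod_(j < d) psi (lift ord0 j) (tnth t j))%:E).
  by apply/measurable_EFinP; apply: (@measurable_prod_tnth d (fun j => psi (lift ord0 j))).
have p0 n (phi : 'I_n -> R -> R) (t : n.-tuple R) :
    (forall j x, 0 <= phi j x) -> (0 <= (\prod_(j < n) phi j (tnth t j))%:E)%E.
  by move=> phi0; rewrite lee_fin; apply: prodr_ge0 => j _.
rewrite integral_mkcond lebesgue_measure_nS; last 2 first.
- apply/(measurable_restrictT _ _).1; first exact: measurable_box.
  exact: measurable_funTS.
- by move=> t; rewrite patchE; case: ifP => // _; exact: p0.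
transitivity (\int[@lebesgue_measure R]_x
  ((fun x => (psi ord0 x)%:E * (\prod_(j < d) v (lift ord0 j))%:E) \_ `[0%R, 1%R]) x)%E.
  apply: eq_integral => x _; rewrite [RHS]patchE.
  case: ifPn; rewrite ?notin_setE ?in_setE /= in_itv /= => x01; last first.
    rewrite (eq_integral (cst 0%E)) ?integral0// => t _.
    by rewrite patchE memNset// => /box_cons[/x01].
  have := IH (fun j => psi (lift ord0 j)) (fun j => v (lift ord0 j))
    (fun j => mpsi _) (fun j => psi0 _) (fun j => psiv _) => <-.
  rewrite -ge0_integralZl_EFin//; last 3 first.
  - exact: measurable_box.
  - by move=> t _; exact: (p0 d (fun j => psi (lift ord0 j))).
  - exact: measurable_funTS.
  rewrite [RHS]integral_mkcond; apply: eq_integral => t _.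
  rewrite !patchE; have [tab|tab] := pselect (box d 0 1 t).
    rewrite !mem_set//; last exact/box_cons.
    rewrite -EFinM big_ord_recl tnth0; congr (_ * _)%:E.
    by apply: eq_bigr => j _; rewrite tnthS.
  by rewrite !memNset// => /box_cons[].
rewrite -integral_mkcond ge0_integralZr//.
- by rewrite psiv -EFinM big_ord_recl.
- by apply/measurable_EFinP; apply: measurable_funTS; exact: mpsi.
- by move=> x _; rewrite lee_fin.
- rewrite lee_fin; apply: prodr_ge0 => j _; rewrite -lee_fin -psiv.
  by apply: integral_ge0 => x _; rewrite lee_fin.
Qed.

End product_integral.

(** * The squared worst-case error for a fixed shift, and its average *)

Section lattice_gap.
Variable R : realType.

Lemma bernoulli2_compl (x : R) : bernoulli2 (1 - x) = bernoulli2 x.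
Proof. by rewrite /bernoulli2; ring. Qed.

(** The distance of the two residues is {(i - i') z / n} or its complement to 1, and B_2 does not
    distinguish them; [n.-1 * i'] stands for - i' modulo n. *)
Lemma bernoulli2_dist n z i i' : (0 < n)%N ->
  1 + bernoulli2 `|frac (i%:R * z%:R / n%:R) - frac (i'%:R * z%:R / n%:R) : R| =
  b2kernel R n z (i + n.-1 * i').
Proof.
move=> n0; have N0 : 0 < n%:R :> R by rewrite ltr0n.
rewrite /b2kernel -!natrM !frac_nat//; congr (1 + _).
set r := (i * z %% n)%N; set r' := (i' * z %% n)%N.
have rn : (r < n)%N by rewrite ltn_mod.
have rn' : (r' < n)%N by rewrite ltn_mod.
have E : ((i + n.-1 * i') * z = r + n.-1 * r' %[mod n])%N.
  by rewrite mulnDl -mulnA -modnDml -/r -modnDmr -modnMmr -/r' modnDmr.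
rewrite E -mulrBl normrM (ger0_norm (x := n%:R^-1)) ?invr_ge0//; clearbody r r'.
have E2 : ((r + n.-1 * r') + r' = r + r' * n)%N.
  by rewrite -addnA -mulSnr prednK// mulnC.
have [r'r|rr'] := leqP r' r.
  rewrite ger0_norm ?subr_ge0 ?ler_nat// -natrB//; congr (bernoulli2 (_%:R / _)).
  have -> : (r + n.-1 * r' = (r - r') + r' * n)%N by lia.
  by rewrite addnC modnMDl modn_small//; apply: leq_ltn_trans rn; rewrite leq_subr.
rewrite ltr0_norm ?subr_lt0 ?ltr_nat// opprB -natrB 1?ltnW//.
rewrite -bernoulli2_compl; congr bernoulli2.
have E3 : (r' * n = r'.-1 * n + n)%N by rewrite -mulSnr prednK//; lia.
have -> : (r + n.-1 * r' = (n - (r' - r)) + r'.-1 * n)%N.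
  by clear E; move: (n.-1 * r')%N (r'.-1 * n)%N (r' * n)%N E2 E3 rn rn' rr' => A B C; lia.
rewrite addnC modnMDl modn_small; last by lia.
have le : (r' - r <= n)%N by lia.
by rewrite [in RHS](natrB _ le) mulrBl divff// gt_eqF.
Qed.

Lemma periodic_sum_shift n (g : nat -> R) c : (forall i, g (i + n)%N = g i) ->
  \sum_(1 <= i < n.+1) g (i + c)%N = \sum_(1 <= i < n.+1) g i.
Proof.
move=> gn; elim: c => [|c IH]; first by apply: eq_bigr => i _; rewrite addn0.
rewrite -IH {IH}; case: n gn => [|n] gn; first by rewrite !big_geq.
rewrite [RHS]big_ltn// [LHS]big_nat_recr//= addrC; congr (_ + _).
  by rewrite -[RHS]gn; congr g; lia.
by rewrite [RHS]big_add1 /=; apply: eq_bigr => i _; rewrite addnS addSn.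
Qed.

Definition lat_seq d n (z : 'I_d -> nat) (D : d.-tuple R) (i : nat) : seq R :=
  [seq frac (i%:R * (z j)%:R / n%:R + tnth D j) | j <- enum 'I_d].

Lemma lat_seq_cube d n (z : 'I_d -> nat) (D : d.-tuple R) i : ucubeo d (lat_seq n z D i).
Proof.
rewrite /ucubeo size_map size_enum_ord eqxx /=.
by apply/allP => _ /mapP[j _ ->]; exact: frac_unit.
Qed.

Lemma kerp_map (T : Type) (s : seq T) (kap : R -> R -> R) (f g : T -> R) :
  kerp kap (map f s) (map g s) = \prod_(j <- s) (1 + kap (f j) (g j)).
Proof. by elim: s => [|x s IH] /=; rewrite ?big_nil// big_cons IH. Qed.

Lemma kerp_lat_seq d n (z : 'I_d -> nat) (D : d.-tuple R) i i' :
  kerp (@kappa R) (lat_seq n z D i) (lat_seq n z D i') =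
  \prod_(j < d) shift_kernel (i%:R * (z j)%:R / n%:R) (i'%:R * (z j)%:R / n%:R) (tnth D j).
Proof. by rewrite kerp_map big_enum. Qed.

(** The squared worst-case error of the rule with shift [D] in the space with kernel prod (1 +
    kappa); as [kappa] integrates to 0 in each variable, the terms with integrals reduce to the
    -1. *)
Definition lat_gap d n (z : 'I_d -> nat) (D : d.-tuple R) : R :=
  \sum_(i < n) \sum_(i' < n) n%:R^-1 * n%:R^-1 *
    (kerp (@kappa R) (lat_seq n z D i.+1) (lat_seq n z D i'.+1) - 1).

Lemma lat_gap_bound d n (z : 'I_d -> nat) (D : d.-tuple R) F M : (0 < n)%N ->
  mix d F M ->
  (n%:R^-1 * \sum_(i < n) F (lat_seq n z D i.+1) - cube_mean d F) ^+ 2 <=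
  2 ^+ d * M ^+ 2 * lat_gap n z D.
Proof.
move=> n0 Fm; have := lattice_error_bound (fun=> n%:R^-1) Fm
  (fun i : 'I_n => lat_seq_cube n z D i.+1) (gmean_cvg Fm).
by rewrite sumr_const card_ord -[n%:R^-1 *+ n]mulr_natl divff ?pnatr_eq0 -?lt0n// mul1r -mulr_sumr.
Qed.

(** Single summands may be negative; the sign comes from the error bound for F = 0 with M = 1. *)
Lemma lat_gap_ge0 d n (z : 'I_d -> nat) (D : d.-tuple R) : (0 < n)%N -> 0 <= lat_gap n z D.
Proof.
move=> n0; have H : mix d (fun=> 0 : R) 1 by apply: mix_le (mix_cst d 0); rewrite normr0.
have := lat_gap_bound z D n0 H; have := sqr_ge0 (n%:R^-1 * \sum_(i < n) (0 : R) - cube_mean d (fun=> 0)).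
move=> /le_trans/[apply]; rewrite expr1n mulr1 pmulr_rge0// exprn_gt0//.
Qed.

Lemma measurable_lat_prod d n (z : 'I_d -> nat) i i' :
  measurable_fun [set: d.-tuple R] (fun D =>
   \prod_(j < d) shift_kernel (i%:R * (z j)%:R / n%:R) (i'%:R * (z j)%:R / n%:R) (tnth D j)).
Proof. exact: (measurable_prod_tnth (fun j => measurable_shift_kernel _ _)). Qed.

Lemma measurable_lat_gap d n (z : 'I_d -> nat) :
  measurable_fun [set: d.-tuple R] (lat_gap n z).
Proof.
rewrite (_ : lat_gap n z = fun D => \sum_(i < n) \sum_(i' < n) n%:R^-1 * n%:R^-1 *
  (kerp (@kappa R) (lat_seq n z D i.+1) (lat_seq n z D i'.+1) - 1))//.
apply: measurable_sum => i; apply: measurable_sum => i'.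
apply: measurable_funM => //; apply: measurable_funB => //.
rewrite (_ : (fun D => _) = (fun D : d.-tuple R => \prod_(j < d)
  shift_kernel (i.+1%:R * (z j)%:R / n%:R) (i'.+1%:R * (z j)%:R / n%:R) (tnth D j))).
  exact: measurable_lat_prod.
by apply/funext => D; exact: kerp_lat_seq.
Qed.

(** Adding 1 leaves a sum of nonnegative terms, to which integration of nonnegative functions
    applies term by term. *)
Lemma lat_gapE d n (z : 'I_d -> nat) (D : d.-tuple R) : (0 < n)%N ->
  lat_gap n z D + 1 = \sum_(p : 'I_n * 'I_n) n%:R^-1 * n%:R^-1 *
   \prod_(j < d) shift_kernel (p.1.+1%:R * (z j)%:R / n%:R) (p.2.+1%:R * (z j)%:R / n%:R) (tnth D j).
Proof.
move=> n0; rewrite -(pair_bigA _ (fun i i' : 'I_n => n%:R^-1 * n%:R^-1 *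
   \prod_(j < d) shift_kernel (i.+1%:R * (z j)%:R / n%:R) (i'.+1%:R * (z j)%:R / n%:R) (tnth D j))) /=.
have one : 1 = \sum_(i < n) \sum_(i' < n) n%:R^-1 * n%:R^-1 :> R.
  have N0 : n%:R != 0 :> R by rewrite pnatr_eq0 -lt0n.
  rewrite !sumr_const !card_ord -[(n%:R^-1 * n%:R^-1) *+ n]mulr_natl mulVKf//.
  by rewrite -[_ *+ n]mulr_natl divff.
rewrite [X in _ + X = _]one /lat_gap -big_split /=; apply: eq_bigr => i _; rewrite -big_split /=.
by apply: eq_bigr => i' _; rewrite kerp_lat_seq mulrBr mulr1 subrK.
Qed.

(** After averaging, a pair of points enters only through i - i' modulo n, so by periodicity the
    double sum is n times a single one: the CBC criterion with unit weights. *)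
Lemma integral_lat_gap d n (z : 'I_d -> nat) : (0 < n)%N ->
  (\int[@lebesgue_measure_n R d]_(t in box d 0 1) (lat_gap n z t)%:E)%E =
  (n%:R^-1 * \sum_(1 <= i < n.+1) (\prod_(j < d) b2kernel R n (z j) i - 1))%:E.
Proof.
move=> n0; have mB := @measurable_box R d 0 1.
have N0 : n%:R != 0 :> R by rewrite pnatr_eq0 -lt0n.
have mg : measurable_fun (box d 0 1 : set (d.-tuple R)) (fun t => (lat_gap n z t)%:E).
  by apply/measurable_EFinP; apply: measurable_funTS; exact: measurable_lat_gap.
pose g i : R := \prod_(j < d) b2kernel R n (z j) i.
have E1 : (\int[@lebesgue_measure_n R d]_(t in box d 0 1) (lat_gap n z t + 1)%:E)%E =
    (n%:R^-1 * \sum_(1 <= i < n.+1) g i)%:E.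
  transitivity (\int[@lebesgue_measure_n R d]_(t in box d 0 1)
    \sum_(p : 'I_n * 'I_n) (n%:R^-1 * n%:R^-1)%:E * (\prod_(j < d)
      shift_kernel (p.1.+1%:R * (z j)%:R / n%:R) (p.2.+1%:R * (z j)%:R / n%:R) (tnth t j))%:E)%E.
    apply: eq_integral => t _; rewrite lat_gapE// -sumEFin.
    by apply: eq_bigr => p _; rewrite EFinM.
  rewrite ge0_integral_sum//; last 2 first.
  - move=> p; apply/measurable_EFinP; apply: measurable_funTS.
    by apply: measurable_funM => //; exact: measurable_lat_prod.
  - move=> p t _; rewrite -EFinM lee_fin mulr_ge0 ?mulr_ge0 ?invr_ge0//.
    by apply: prodr_ge0 => j _; exact: shift_kernel_ge0.
  rewrite (eq_bigr (fun p : 'I_n * 'I_n =>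
    (n%:R^-1 * n%:R^-1 * g (p.1.+1 + n.-1 * p.2.+1)%N)%:E)) => [|p _].
    rewrite sumEFin; congr EFin.
    rewrite -(pair_bigA _ (fun i i' : 'I_n => n%:R^-1 * n%:R^-1 * g (i.+1 + n.-1 * i'.+1)%N)) /=.
    rewrite exchange_big /= (eq_bigr (fun=> n%:R^-1 * n%:R^-1 * \sum_(1 <= i < n.+1) g i)).
      rewrite sumr_const card_ord -[_ *+ n]mulr_natl.
      by rewrite -mulrA mulVKf.
    move=> i' _; rewrite -mulr_sumr; congr (_ * _).
    rewrite -[RHS](@periodic_sum_shift n g (n.-1 * i'.+1)).
      by rewrite big_add1 big_mkord.
    move=> i; apply: eq_bigr => j _.
    rewrite /b2kernel -!natrM !bernoulli2_frac//; congr (1 + _).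
    by rewrite -cosev_mod// mulnDl [(n * _)%N]mulnC addnC modnMDl cosev_mod.
  rewrite ge0_integralZl_EFin//; last 2 first.
  - by move=> t _; rewrite lee_fin; apply: prodr_ge0 => j _; exact: shift_kernel_ge0.
  - by apply/measurable_EFinP; apply: measurable_funTS; exact: measurable_lat_prod.
  rewrite [X in (_ * X)%E](@integral_prod_tnth R d
    (fun j => shift_kernel (p.1.+1%:R * (z j)%:R / n%:R) (p.2.+1%:R * (z j)%:R / n%:R))
    (fun j => b2kernel R n (z j) (p.1.+1 + n.-1 * p.2.+1)))//.
  - by move=> j; exact: measurable_shift_kernel.
  - by move=> j x; exact: shift_kernel_ge0.
  - by move=> j; rewrite integral_shift_kernel bernoulli2_dist.
have E2 : (\int[@lebesgue_measure_n R d]_(t in box d 0 1) (lat_gap n z t + 1)%:E =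
  \int[@lebesgue_measure_n R d]_(t in box d 0 1) (lat_gap n z t)%:E + 1%:E)%E.
  transitivity (\int[@lebesgue_measure_n R d]_(t in box d 0 1) ((lat_gap n z t)%:E + 1%:E))%E.
    by apply: eq_integral => t _; rewrite EFinD.
  rewrite ge0_integralD//; last by move=> t _; rewrite lee_fin lat_gap_ge0.
  rewrite integral_cst// mul1e; congr (_ + _)%E.
  by rewrite [LHS]lebesgue_measure_n_box// subr0 expr1n.
have E3 : n%:R^-1 * \sum_(1 <= i < n.+1) (g i - 1) = n%:R^-1 * \sum_(1 <= i < n.+1) g i - 1.
  rewrite sumrB mulrBr sumr_const_nat subSS subn0; congr (_ - _).
  by rewrite -[_ *+ n]mulr_natl mulr1 mulVf.
(* The 1 is subtracted again in the extended reals; an infinite integral would contradict the finite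
   total. *)
rewrite E3; move: E2; rewrite E1.
by case: (integral _ _ _) => [x [->]|//|//]; rewrite addrK.
Qed.

End lattice_gap.

(** * Expectations of functions of the random shifts *)

Section random_shifts.
Context d (Omega : measurableType d) (R : realType).
Variable P : probability Omega R.
Local Open Scope ereal_scope.

Lemma integral_uniform01 n (X : {RV P >-> n.-tuple R}) (f : n.-tuple R -> \bar R) :
  uniform01 X -> measurable_fun [set: n.-tuple R] f -> (forall t, 0 <= f t) ->
  \int[P]_w f (X w) = \int[@lebesgue_measure_n R n]_(t in box n 0%R 1%R) f t.
Proof.
move=> uX mf f0; have mB := @measurable_box R n 0%R 1%R.
have mBc : measurable (~` (box n 0%R 1%R : set (n.-tuple R))) by exact: measurableC.
rewrite -(ge0_integral_distribution X mf f0).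
rewrite -(setUv (box n 0%R 1%R)) ge0_integral_setU//; last 2 first.
- by rewrite setUv.
- by rewrite disj_set2E setICr.
rewrite [X in _ + X](eq_measure_integral mzero) => [|A mA AB]; last first.
  rewrite [LHS](uX _ mA) (_ : A `&` _ = set0) ?measure0//.
  by apply/seteqP; split=> // t [/AB].
rewrite integral_measure_zero adde0; apply: eq_measure_integral => A mA AB.
by rewrite [LHS](uX _ mA) (setIidl AB).
Qed.

(* The squared cubature error is compared with its bound without having to be
   proved measurable. *)
Lemma le_integral_nonmeasurable (D : set Omega) (f g : Omega -> \bar R) :
  (forall x, 0 <= f x) -> (forall x, f x <= g x) ->
  \int[P]_(x in D) f x <= \int[P]_(x in D) g x.
Proof.
move=> f0 fg; have g0 x : 0 <= g x by exact: le_trans (f0 x) (fg x).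
rewrite !ge0_integralE//; apply: ereal_sup_le => _ [h /= hf <-].
exists h => //= x; apply: le_trans (hf x) _.
by rewrite /patch; case: ifP.
Qed.

Lemma integral_independent m n (X : {RV P >-> m.-tuple R}) (Y : {RV P >-> n.-tuple R})
    (f : m.-tuple R -> R) (g : n.-tuple R -> R) :
  independent_rv X Y ->
  measurable_fun [set: m.-tuple R] f -> measurable_fun [set: n.-tuple R] g ->
  (forall t, (0 <= f t)%R) -> (forall t, (0 <= g t)%R) ->
  \int[P]_w (f (X w) * g (Y w))%:E =
  (\int[P]_w (f (X w))%:E) * (\int[P]_w (g (Y w))%:E).
Proof.
move=> iXY mf mg f0 g0.
pose XY w := (X w, Y w).
have mXY : measurable_fun [set: Omega] XY by exact: measurable_fun_pair.
pose h (z : m.-tuple R * n.-tuple R) := (f z.1 * g z.2)%:E.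
have mh : measurable_fun [set: m.-tuple R * n.-tuple R] h.
  apply/measurable_EFinP; apply: measurable_funM.
    exact: (measurableT_comp mf measurable_fst).
  exact: (measurableT_comp mg measurable_snd).
have h0 z : 0 <= h z by rewrite lee_fin mulr_ge0.
have mfE : measurable_fun [set: m.-tuple R] (fun t => (f t)%:E) by exact/measurable_EFinP.
have mgE : measurable_fun [set: n.-tuple R] (fun t => (g t)%:E) by exact/measurable_EFinP.
transitivity (\int[pushforward P XY]_z h z).
  by rewrite (ge0_integral_pushforward mXY).
transitivity (\int[distribution P X \x distribution P Y]_z h z).
  apply: eq_measure_integral => A mA _; apply/esym.
  pose PXY := measure_function_pushforward__canonical__measure_function_Measure P mXY.
  apply: (@product_measure_unique _ _ _ _ R (distribution P X) (distribution P Y) PXY) => //.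
transitivity (\int[distribution P X]_x fubini_F (distribution P Y) h x).
  by apply: fubini_tonelli1.
transitivity (\int[distribution P X]_x ((f x)%:E * \int[P]_w (g (Y w))%:E)).
  apply: eq_integral => x _; rewrite /fubini_F /h /=.
  under eq_integral do rewrite EFinM.
  rewrite ge0_integralZl_EFin//; last by move=> t _; rewrite lee_fin.
  by rewrite (ge0_integral_distribution Y mgE)// => t; rewrite lee_fin.
rewrite ge0_integralZr//.
- by rewrite (ge0_integral_distribution X mfE)// => t; rewrite lee_fin.
- by move=> t _; rewrite lee_fin.
- by apply: integral_ge0 => w _; rewrite lee_fin.
Qed.

End random_shifts.

(** * Smooth forward models *)

Section differences.
Variable R : realType.
Implicit Types (f g : seq R -> R) (w : seq (R + R * R)).

(* In each coordinate, evaluate at a point or take a first difference. *)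
Fixpoint dev w f : R :=
  match w with
  | [::] => f [::]
  | inl a :: w' => dev w' (fun t => f (a :: t))
  | inr (a, b) :: w' => dev w' (fun t => f (a :: t)) - dev w' (fun t => f (b :: t))
  end.

Definition dev_in (e : R + R * R) : bool :=
  match e with inl a => unit_itv a | inr (a, b) => unit_itv a && unit_itv b end.

Definition dev_step (e : R + R * R) : R :=
  match e with inl _ => 1 | inr (a, b) => `|a - b| end.

Lemma devB w f g : dev w (fun t => f t - g t) = dev w f - dev w g.
Proof. by elim: w f g => [|[a|[a b]] w IH] f g //=; rewrite !IH//; ring. Qed.

Lemma mix_dev d f M :
  (forall w, size w = d -> all dev_in w -> `|dev w f| <= M * \prod_(e <- w) dev_step e) ->
  mix d f M.
Proof.
elim: d f M => [|d IH] f M H /=; first by have := H [::]; rewrite big_nil mulr1; exact.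
split=> [a ua|a b ua ub]; apply: IH => w sw win.
  have := H (inl a :: w); rewrite big_cons /= mul1r ua win sw; exact.
have := H (inr (a, b) :: w); rewrite big_cons /= ua ub win sw devB mulrA; exact.
Qed.

Lemma dev_inl p f : dev (map inl p) f = f p.
Proof. by elim: p f => [|a p IH] f //=; rewrite IH. Qed.

Lemma dev_rcons w a b w' f : dev (w ++ inr (a, b) :: w') f =
  dev (w ++ inl a :: w') f - dev (w ++ inl b :: w') f.
Proof. by elim: w f => [|[c|[c c']] w IH] f //=; rewrite !IH; ring. Qed.

Lemma dev_is_derive w (p : seq R) f g (x : R) : all dev_in w ->
  (forall q, ucube (size w) q -> is_derive x 1 (fun y => f (q ++ y :: p)) (g (q ++ x :: p))) ->
  is_derive x 1 (fun y => dev (w ++ map inl (y :: p)) f) (dev (w ++ map inl (x :: p)) g).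
Proof.
elim: w f g => [|e w IH] f g /=.
  move=> _ H; have := H [::] isT; rewrite dev_inl.
  rewrite (_ : (fun y => dev _ _) = (fun y => f ([::] ++ y :: p)))//.
  by apply/funext => y; rewrite dev_inl.
case: e => [a|[a b]] /= /andP[ua win] H.
  apply: (IH (fun t => f (a :: t)) (fun t => g (a :: t)) win) => q uq.
  by apply: (H (a :: q)); rewrite ucubeS ua.
case/andP: ua => ua ub.
apply: is_deriveB.
  apply: (IH (fun t => f (a :: t)) (fun t => g (a :: t)) win) => q uq.
  by apply: (H (a :: q)); rewrite ucubeS ua.
apply: (IH (fun t => f (b :: t)) (fun t => g (b :: t)) win) => q uq.
by apply: (H (b :: q)); rewrite ucubeS ub.
Qed.

Lemma dev_continuous w (p : seq R) f (A : set R) : all dev_in w ->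
  (forall q, ucube (size w) q -> {within A, continuous (fun y => f (q ++ y :: p))}) ->
  {within A, continuous (fun y => dev (w ++ map inl (y :: p)) f)}.
Proof.
elim: w f => [|e w IH] f /=.
  move=> _ H; have := H [::] isT.
  rewrite (_ : (fun y => dev _ _) = (fun y => f ([::] ++ y :: p)))//.
  by apply/funext => y; rewrite dev_inl.
case: e => [a|[a b]] /= /andP[ua win] H.
  apply: (IH (fun t => f (a :: t)) win) => q uq.
  by apply: (H (a :: q)); rewrite ucubeS ua.
case/andP: ua => ua ub; move=> y; apply: continuousB.
  apply: (IH (fun t => f (a :: t)) win) => q uq.
  by apply: (H (a :: q)); rewrite ucubeS ua.
apply: (IH (fun t => f (b :: t)) win) => q uq.
by apply: (H (b :: q)); rewrite ucubeS ub.
Qed.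

Lemma lipschitz_of_derive (h h' : R -> R) (B : R) :
  {within `[0, 1], continuous h} ->
  (forall x : R, 0 < x < 1 -> is_derive x 1 h (h' x)) ->
  (forall x : R, 0 < x < 1 -> `|h' x| <= B) ->
  forall a b, unit_itv a -> unit_itv b -> `|h a - h b| <= B * `|a - b|.
Proof.
move=> ch dh hB.
have H a b : unit_itv a -> unit_itv b -> a < b -> `|h b - h a| <= B * `|b - a|.
  move=> /andP[a0 _] /andP[_ b1] ab.
  have sub x : a < x < b -> 0 < x < 1.
    by move=> /andP[ax xb]; rewrite (le_lt_trans a0 ax) (lt_le_trans xb b1).
  have dh' x : x \in `]a, b[ -> is_derive x 1 h (h' x).
    by rewrite in_itv /= => /sub; exact: dh.
  have [|c cab ->] := MVT ab dh'.
    apply: continuous_subspaceW ch => x /=; rewrite !in_itv /= => /andP[ax xb].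
    by rewrite (le_trans a0 ax) (le_trans xb b1).
  rewrite normrM ler_wpM2r//; apply/hB/sub.
  by move: cab; rewrite in_itv.
move=> a b ua ub; case: (ltgtP a b) => [ab|ab|->].
- by rewrite distrC (distrC a); exact: H.
- exact: H.
- by rewrite !subrr !normr0 mulr0.
Qed.

(* [phi v] stands for the partial derivative of [phi [::]] along [v]; peeling
   off the last coordinate first keeps [v] increasing. *)
Lemma dev_bound s (phi : seq 'I_s -> seq R -> R) (M : R) :
  (forall v (j : 'I_s) q p (x : R), size q = j -> ucube s (q ++ x :: p) ->
     0 < x < 1 -> is_derive x 1 (fun y => phi v (q ++ y :: p)) (phi (j :: v) (q ++ x :: p))) ->
  (forall v (j : 'I_s) q p, size q = j -> ucube s (q ++ 0 :: p) ->
     {within `[0, 1], continuous (fun y => phi v (q ++ y :: p))}) ->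
  (forall v t, sorted ltn (map val v) -> ucube s t -> `|phi v t| <= M) ->
  mix s (phi [::]) M.
Proof.
move=> dphi cphi Mphi.
(* Invariant: [w] acts on the coordinates below j, the later ones are frozen at [p], and [v] records
   the derivatives produced so far, all in coordinates from j on. *)
suff H j w (p : seq R) (v : seq 'I_s) : (j <= s)%N -> size w = j -> all dev_in w -> size p = (s - j)%N ->
    all (@unit_itv R) p -> sorted ltn (map val v) -> all (fun i : 'I_s => j <= i)%N v ->
    `|dev (w ++ map inl p) (phi v)| <= M * \prod_(e <- w) dev_step e.
  apply: mix_dev => w sw win; have := H s w [::] [::] (leqnn s) sw win.
  by rewrite subnn cats0; exact.
elim: j w p v => [|j IH] w p v js sw win sp up sv vj.
  rewrite (size0nil sw) big_nil mulr1 /= dev_inl; apply: Mphi => //.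
  by rewrite /ucube sp subn0 eqxx.
have vj' : all (fun i : 'I_s => j <= i)%N v.
  by apply: sub_all vj => i /ltnW.
case/lastP: w => [//|w e] in sw win *; rewrite size_rcons in sw.
move: sw => [sw]; rewrite all_rcons in win; case/andP: win => ein win.
have sp' : size p = (s - j).-1 by rewrite sp subnS.
have sj0 : (0 < s - j)%N by rewrite subn_gt0.
have spS x : size ((x : R) :: p) = (s - j)%N by rewrite /= sp' prednK.
rewrite cat_rcons -cats1 big_cat big_seq1 /=.
(* An evaluation moves its point to [p]; a difference becomes, by the mean value theorem, a
   derivative in coordinate j, put in front of [v]. *)
case: e => [a|[a b]] /= in ein *.
  by rewrite mulr1 -map_cons; apply: IH; rewrite ?spS//= 1?ltnW// ein.
case/andP: ein => ua ub; pose j0 := Ordinal js.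
have cubeE q x : ucube (size w) q -> unit_itv x -> ucube s (q ++ x :: p).
  move=> /andP[/eqP sq uq] ux; rewrite /ucube size_cat sq sw spS subnKC 1?ltnW//.
  by rewrite eqxx all_cat uq /= ux.
rewrite dev_rcons mulrA.
apply: (@lipschitz_of_derive (fun y => dev (w ++ map inl (y :: p)) (phi v))
  (fun y => dev (w ++ map inl (y :: p)) (phi (j0 :: v)))) => //.
- apply: dev_continuous => // q uq; apply: (cphi v j0).
    by case/andP: uq => /eqP ->.
  by apply: cubeE => //; exact: unit_itv0.
- move=> x x01; apply: dev_is_derive => // q uq; apply: (dphi v j0) => //.
    by case/andP: uq => /eqP ->.
  apply: cubeE => //; by case/andP: x01 => /ltW ? /ltW ?; apply/andP.
- move=> x /andP[x0 x1]; apply: IH => //.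
  + exact: ltnW.
  + by rewrite /= up andbT /unit_itv !ltW.
  + rewrite /= path_min_sorted//; apply/allP => _ /mapP[i iv ->].
    by move/allP : vj => /(_ _ iv).
  + by rewrite /= leqnn.
Qed.

End differences.

Section smooth_mix.
Variable R : realType.

Definition cube_pt s (t : seq R) : 'cV[R]_s := \col_j (nth 0 t j - 2^-1).

Lemma cube_ptP s t : ucube s t -> cube s (cube_pt s t).
Proof.
move=> /andP[/eqP st /allP ut] j; rewrite mxE.
have /ut/andP[t0 t1] : nth 0 t j \in t by rewrite mem_nth ?st.
by apply/andP; split; lra.
Qed.

Lemma cube_pt_shift s (j : 'I_s) q p (x h : R) : size q = j ->
  cube_pt s (q ++ (x + h) :: p) = cube_pt s (q ++ x :: p) + h *: delta_mx j ord0.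
Proof.
move=> sq; apply/matrixP => l c; rewrite !mxE !nth_cat sq.
rewrite (ord1 c) eqxx andbT -val_eqE /=.
case: (ltngtP l j) => lj.
- by rewrite mulr0 addr0.
- have [n ->] : exists n, (l - j = n.+1)%N.
    by exists (l - j).-1; rewrite prednK// subn_gt0.
  by rewrite /= mulr0 addr0.
- by rewrite lj subnn /= mulr1 addrAC.
Qed.

(** For x strictly between 0 and 1 all small increments stay in the cube, so the limit along
    [increments] is an ordinary two-sided derivative. *)
Lemma is_derive_partial s k (G : 'cV[R]_s -> 'cV[R]_k) (j : 'I_s) q p (x : R) i :
  size q = j -> ucube s (q ++ x :: p) -> 0 < x < 1 ->
  cvg (diff_quot j G (cube_pt s (q ++ x :: p)) h
    @[h --> increments (cube s) j (cube_pt s (q ++ x :: p))]) ->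
  is_derive x 1 (fun y => G (cube_pt s (q ++ y :: p)) i ord0)
    (partial_in (cube s) j G (cube_pt s (q ++ x :: p)) i ord0).
Proof.
move=> sq ux /andP[x0 x1]; set X := cube_pt s _ => cX.
pose psi h : R := h^-1 * (G (X + h *: delta_mx j ord0) i ord0 - G X i ord0).
have psiE h : psi h = diff_quot j G X h i ord0 by rewrite /psi /diff_quot !mxE.
set l := partial_in _ _ _ _ _ _.
have psi_inc : psi h @[h --> increments (cube s) j X] --> l.
  have -> : psi = (fun h => diff_quot j G X h i ord0) by apply/funext.
  exact: (cvg_comp _ _ cX (@coord_continuous R k 1 i ord0 _)).
have psi0 : psi h @[h --> 0^'] --> l.
  move=> U UU.
  have HU : \forall h \near 0^', cube s (X + h *: delta_mx j ord0) -> U (psi h).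
    exact: psi_inc UU.
  have : \forall h \near 0^', cube s (X + h *: delta_mx j ord0).
    have e0 : 0 < Num.min x (1 - x) by rewrite lt_min x0 subr_gt0.
    exists (Num.min x (1 - x)) => //= h; rewrite /ball_ /= sub0r normrN => + _.
    rewrite lt_min ltr_norml => /andP[/andP[h1 h2]]; rewrite ltr_norml => /andP[h3 h4].
    rewrite /X -cube_pt_shift//; apply: cube_ptP.
    move: ux; rewrite /ucube !size_cat /= !all_cat /= => /and3P[-> -> /andP[_ ->]].
    by rewrite /= andbT; apply/andP; split; lra.
  by move=> nearC; apply: filterS (filterI HU nearC) => h [HUh]; exact: HUh.
have C : h^-1 *: (G (cube_pt s (q ++ (h *: 1 + x) :: p)) i ord0 - G X i ord0)
    @[h --> 0^'] --> l.
  apply: cvg_trans psi0; apply: near_eq_cvg; apply: nearW => h.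
  by rewrite /psi /X -cube_pt_shift// (addrC x) /GRing.scale /= mulr1.
by apply: DeriveDef; [exact: cvgP C|exact: cvg_lim C].
Qed.

Lemma continuous_partial s k (G : 'cV[R]_s -> 'cV[R]_k) (j : 'I_s) q p i :
  size q = j -> ucube s (q ++ 0 :: p) -> {within cube s, continuous G} ->
  {within `[0, 1], continuous (fun y => G (cube_pt s (q ++ y :: p)) i ord0)}.
Proof.
move=> sq u0 /subspace_continuousP cG; apply/subspace_continuousP => x.
rewrite /= in_itv /= => x01.
have inC y : y \in `[0, 1]%R -> cube s (cube_pt s (q ++ y :: p)).
  rewrite in_itv /= => y01; apply: cube_ptP; move: u0.
  by rewrite /ucube !size_cat /= !all_cat /= => /and3P[-> -> /andP[_ ->]]; rewrite /unit_itv y01.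
have xC : x \in `[0, 1]%R by rewrite in_itv.
have := cG _ (inC _ xC); set X := cube_pt s _ => GX.
apply: (cvg_comp (fun y => G (cube_pt s (q ++ y :: p))) (fun M : 'cV[R]_k => M i ord0));
  last exact: (@coord_continuous R k 1 i ord0 _).
apply: (cvg_comp (fun y => cube_pt s (q ++ y :: p)) G); last exact: GX.
move=> U; rewrite /within /= => HU.
have cpt : cube_pt s (q ++ y :: p) @[y --> x] --> X.
  move=> V [P PX PV].
  have HP : \forall y \near x, forall l c, P l c (cube_pt s (q ++ y :: p) l c).
    apply: (@filter_forall _ _
      (fun l y => forall c, P l c (cube_pt s (q ++ y :: p) l c)) (nbhs x)) => l.
    apply: (@filter_forall _ _
      (fun c y => P l c (cube_pt s (q ++ y :: p) l c)) (nbhs x)) => c.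
    have : cube_pt s (q ++ y :: p) l c @[y --> x] --> X l c.
      have E y : cube_pt s (q ++ y :: p) l c =
          cube_pt s (q ++ 0 :: p) l c + y * delta_mx j ord0 l c.
        by rewrite -{1}[y]add0r (cube_pt_shift _ _ _ sq) !mxE.
      rewrite /X E (funext E).
      exact: (cvgD (cvg_cst _) (cvgMr_tmp cvg_id)).
    by apply; exact: PX.
  by apply: filterS HP => y; exact: PV.
have HV : \forall y \near x, cube s (cube_pt s (q ++ y :: p)) ->
    U (cube_pt s (q ++ y :: p)) by exact: cpt _ HU.
apply: filterS HV => y HUy y01; apply: HUy; exact: inC.
Qed.

Lemma flatten_nseq_filter (T : eqType) (a : pred T) (e : seq T) :
  flatten [seq nseq (a j) j | j <- e] = [seq j <- e | a j].
Proof. by elim: e => [|x e IH] //=; rewrite IH; case: (a x). Qed.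

Lemma sorted_ord_filter s (v : seq 'I_s) : sorted ltn (map val v) ->
  [seq j <- enum 'I_s | j \in v] = v.
Proof.
move=> sv; apply: (@inj_map _ _ (val : 'I_s -> nat)); first exact: val_inj.
apply: (irr_sorted_eq ltn_trans ltnn) => //.
  rewrite sorted_map; apply: sorted_filter; first by move=> a b c; exact: ltn_trans.
  by rewrite -sorted_map val_enum_ord; exact: iota_ltn_sorted.
move=> n; apply/mapP/mapP => -[x]; rewrite ?mem_filter ?mem_enum.
  by move=> /andP[xv _] ->; exists x.
by move=> xv ->; exists x => //; rewrite mem_filter xv mem_enum.
Qed.

Lemma enorm_ge_coord n (x : 'cV[R]_n) i : `|x i ord0| <= enorm x.
Proof.
rewrite -sqrtr_sqr /enorm ler_wsqrtr// (bigD1 i)//= lerDl.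
by apply: sumr_ge0 => j _; exact: sqr_ge0.
Qed.

(** An increasing list [v] enumerates its support, so it is a 0-1 multi-index in the very order of
    differentiation fixed by [mixed_partial]. There are finitely many, and the sum of their bounds
    serves for all. *)
Lemma smooth_mix s k (F : 'cV[R]_s -> 'cV[R]_k) (B : ('I_s -> nat) -> R) :
  smooth_in (cube s) F ->
  (forall nu x, cube s x -> enorm (mixed_partial (cube s) nu F x) <= B nu) ->
  exists2 M, 0 <= M & forall i, mix s (fun t => F (cube_pt s t) i ord0) M.
Proof.
move=> sF FB.
pose nuof (u : {set 'I_s}) : 'I_s -> nat := fun j => j \in u.
have cube0 : cube s (0 : 'cV[R]_s).
  by move=> j; rewrite mxE; apply/andP; split; lra.
have B0 nu : 0 <= B nu.
  by apply: le_trans (FB nu _ cube0); exact: sqrtr_ge0.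
exists (\sum_(u : {set 'I_s}) B (nuof u)) => [|i]; first exact: sumr_ge0.
apply: (@dev_bound R s (fun v t => partials_in (cube s) v F (cube_pt s t) i ord0)).
- move=> v j q p x sq ux x01; apply: is_derive_partial => //.
  by apply: (sF v).2; exact: cube_ptP.
- move=> v j q p sq u0; exact: (continuous_partial sq u0 (sF v).1).
move=> v t sv ut.
pose u := [set j in v]%SET.
have -> : partials_in (cube s) v F = mixed_partial (cube s) (nuof u) F.
  rewrite /mixed_partial; congr partials_in.
  rewrite (flatten_nseq_filter (fun j => j \in u)) -[LHS](sorted_ord_filter sv).
  by apply: eq_filter => j; rewrite finset.inE.
apply: (le_trans (enorm_ge_coord _ _)); apply: (le_trans (FB _ _ (cube_ptP ut))).
by rewrite (bigD1 u)//= lerDl; exact: sumr_ge0.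
Qed.

End smooth_mix.

(** * The likelihood as a function of y and theta jointly *)

Section likelihood_mix.
Variable R : realType.

Lemma posdef_unit k (Gamma : 'M[R]_k) : posdef Gamma -> Gamma \in unitmx.
Proof.
move=> [_ pG]; rewrite -row_free_unit -kermx_eq0; apply/negPn/negP.
move=> /rowV0Pn[v /sub_kermxP vG v0].
have := pG v^T; rewrite trmx_eq0 => /(_ v0).
by rewrite trmxK vG mul0mx mxE ltxx.
Qed.

Lemma posdef_inv_ge0 k (Gamma : 'M[R]_k) (x : 'cV[R]_k) : posdef Gamma ->
  0 <= (x^T *m invmx Gamma *m x) ord0 ord0.
Proof.
move=> Gpd; have Gu := posdef_unit Gpd; have [GT pG] := Gpd.
have -> : x^T *m invmx Gamma *m x =
    (invmx Gamma *m x)^T *m Gamma *m (invmx Gamma *m x).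
  by rewrite trmx_mul trmx_inv GT -!mulmxA (mulmxA Gamma) mulmxV// mul1mx.
have [->|/pG/ltW//] := eqVneq (invmx Gamma *m x) 0.
by rewrite mulmx0 mxE.
Qed.

Lemma posdef_const_gt0 k (Gamma : 'M[R]_k) : posdef Gamma ->
  0 < (\det ((2 * pi) *: Gamma)) `^ (- 2^-1).
Proof.
move=> /posdef_unit Gu; rewrite /powR detZ mulf_eq0 expf_eq0.
rewrite (gt_eqF (mulr_gt0 _ (pi_gt0 R)))// andbF /=.
by move: Gu; rewrite unitmxE unitfE => /negPf ->; exact: expR_gt0.
Qed.

Definition box_pt k (K : R) (t : seq R) : 'cV[R]_k := \col_i (2 * K * nth 0 t i - K).

(** The first k entries of the list carry y, the others theta. The exponent is a quadratic form in
    functions of the class; its sup bound [Mq] gives the lower bound C exp (- Mq / 2). *)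
Lemma likelihood_mix s k (K : R) (Gamma : 'M[R]_k) (G : 'cV[R]_s -> 'cV[R]_k) M :
  posdef Gamma -> (forall i, mix s (fun t => G (cube_pt s t) i ord0) M) ->
  exists c M', [/\ 0 < c, mix (k + s)
    (fun w => likelihood Gamma G (cube_pt s (drop k w)) (box_pt k K w)) M' &
    forall w, ucube (k + s) w ->
      c <= likelihood Gamma G (cube_pt s (drop k w)) (box_pt k K w)].
Proof.
move=> Gpd Gm; set A := invmx Gamma.
pose r (i : 'I_k) w := 2 * K * nth 0 w i - K - G (cube_pt s (drop k w)) i ord0.
pose q w := \sum_i \sum_j A i j * (r i w * r j w).
set C := (\det ((2 * pi) *: Gamma)) `^ (- 2^-1).
have C0 : 0 < C by exact: posdef_const_gt0.
have likE w : likelihood Gamma G (cube_pt s (drop k w)) (box_pt k K w) =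
    C * expR (- 2^-1 * q w).
  rewrite /likelihood -/C /wnorm sqr_sqrtr ?posdef_inv_ge0//.
  congr (_ * expR (_ * _)); rewrite mxE /q [RHS]exchange_big; apply: eq_bigr => j _.
  rewrite mxE mulr_suml; apply: eq_bigr => i _; rewrite !mxE -/A /r; ring.
have rm i : mix (k + s) (r i) (`|2 * K| * 1 + `|K| + M).
  apply: mixB; last exact: (mix_drop k (Gm i)).
  by apply: mixB; [apply: mixZ; exact: mix_nth|exact: mix_cst].
have [Mq qm] : exists Mq, mix (k + s) q Mq.
  eexists; apply: mix_sum => i; apply: mix_sum => j.
  by apply: mixZ; apply: mixM; exact: rm.
exists (C * expR (- 2^-1 * Mq)); eexists; split.
- by rewrite mulr_gt0// expR_gt0.
- apply: (@mix_ext R (k + s) (fun w => C * expR (- 2^-1 * q w))) => [w _|].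
    by rewrite likE.
  by apply: mixZ; apply: mix_expR; apply: mixZ; exact: qm.
- move=> w uw; rewrite likE ler_pM2l// ler_expR.
  have := mix_norm qm uw; rewrite ler_norml => /andP[_]; lra.
Qed.

End likelihood_mix.

(** * The sparse tensor product rule *)

Section sparse_error.
Variable R : realType.

Definition lat_mean d n (z : 'I_d -> nat) (D : d.-tuple R) (F : seq R -> R) : R :=
  n%:R^-1 * \sum_(i < n) F (lat_seq n z D i.+1).

Lemma nth_map_enum d (f : 'I_d -> R) (j : 'I_d) : nth 0 [seq f i | i <- enum 'I_d] j = f j.
Proof. by rewrite (nth_map j) ?size_enum_ord// nth_ord_enum. Qed.

Lemma lattice_cube_pt s n (z : 'I_s -> nat) (D : s.-tuple R) i :
  lattice_point n z (vec D) i - const_mx 2^-1 = cube_pt s (lat_seq n z D i).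
Proof. by apply/matrixP => j j'; rewrite !mxE nth_map_enum. Qed.

Lemma lattice_box_pt k (K : R) n (z : 'I_k -> nat) (D : k.-tuple R) i :
  (2 * K) *: lattice_point n z (vec D) i - const_mx K = box_pt k K (lat_seq n z D i).
Proof. by apply/matrixP => j j'; rewrite !mxE nth_map_enum. Qed.

Lemma cube_pt_rescale s (t : s.-tuple R) :
  cube_pt s (map (rescale (- 2^-1) 2^-1) t) = vec t.
Proof.
apply/matrixP => j j'; rewrite !mxE (nth_map 0) ?size_tuple// -tnth_nth /rescale.
by field.
Qed.

Lemma box_pt_rescale k (K : R) (t : k.-tuple R) : 0 < K ->
  box_pt k K (map (rescale (- K) K) t) = vec t.
Proof.
move=> K0; apply/matrixP => j j'; rewrite !mxE (nth_map 0) ?size_tuple// -tnth_nth /rescale.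
by field; rewrite opprK -mulr2n mulrn_eq0 /= gt_eqF.
Qed.

Lemma Q1E k K (z : nat -> 'I_k -> nat) (D : k.-tuple R) l F :
  Q1 K z (vec D) l F = (2 * K) ^+ k * lat_mean (2 ^ l) (z l) D (fun y => F (box_pt k K y)).
Proof.
rewrite /Q1 /lat_mean -mulrA natrX; congr (_ * (_ * _)).
by rewrite big_add1 big_mkord; apply: eq_bigr => i _; rewrite lattice_box_pt.
Qed.

Lemma Q2E s (z : nat -> 'I_s -> nat) (D : s.-tuple R) l F :
  Q2 0 z (vec D) l F = lat_mean (2 ^ l) (z l) D (fun t => F (cube_pt s t)).
Proof.
rewrite /Q2 /lat_mean addn0 natrX; congr (_ * _).
by rewrite big_add1 big_mkord; apply: eq_bigr => i _; rewrite lattice_cube_pt.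
Qed.

Definition increment (Z : nat -> seq R -> R) l (y : seq R) : R :=
  if l is l'.+1 then Z l y - Z l' y else Z 0%N y.

Lemma sparse_QE s k K (z1 : nat -> 'I_k -> nat) (z2 : nat -> 'I_s -> nat)
    (D1 : k.-tuple R) (D2 : s.-tuple R) L (f : 'cV[R]_s -> 'cV[R]_k -> R) :
  sparse_Q K 0 z1 z2 (vec D1) (vec D2) L f = (2 * K) ^+ k *
    \sum_(l < L.+1) lat_mean (2 ^ (L - l)) (z1 (L - l)%N) D1
      (increment (fun l y => xlogx (lat_mean (2 ^ l) (z2 l) D2
         (fun t => f (cube_pt s t) (box_pt k K y)))) l).
Proof.
rewrite /sparse_Q (exchange_big_dep predT) //= mulr_sumr; apply: eq_bigr => l _.
set F := fun y : ('cV[R]_k) => Diff2 _ _ _ _ _.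
transitivity (Q1 K z1 (vec D1) (L - l) F); last first.
  rewrite Q1E; congr (_ * _); congr (_ * _); apply: eq_bigr => i _.
  set y := lat_seq _ _ _ _; move: y => y.
  by rewrite /F; case: (l : nat) => [|l'] /=; rewrite !Q2E.
have lL : (l <= L)%N by rewrite -ltnS.
transitivity (\sum_(l1 < (L - l).+1) Diff1 K z1 (vec D1) l1 F).
  rewrite (big_ord_widen L.+1 (fun l1 => Diff1 K z1 (vec D1) l1 F)) ?ltnS ?leq_subr//.
  by apply: eq_bigl => l1; rewrite ltnS leq_subRL// addnC.
elim: (L - l)%N => [|n IH]; first by rewrite big_ord1.
by rewrite big_ord_recr/= IH addrC subrK.
Qed.

Lemma double_integralE s k K (f : 'cV[R]_s -> 'cV[R]_k -> R) F M N : 0 < K ->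
  (forall y t, ucube k y -> F (y ++ t) = f (cube_pt s t) (box_pt k K y)) ->
  mix (k + s) F M ->
  mix k (fun y => xlogx (cube_mean s (fun t => F (y ++ t)))) N ->
  double_integral K f =
    (2 * K) ^+ k * cube_mean k (fun y => xlogx (cube_mean s (fun t => F (y ++ t)))).
Proof.
move=> K0 Ff Fm Zm.
have KK : - K < K by lra.
have HH : - 2^-1 < 2^-1 :> R by lra.
have -> : 2 * K = K - - K by ring.
rewrite -(box_integralE KK Zm); apply: eq_Rintegral => y yb; congr xlogx.
have uy : ucube k (map (rescale (- K) K) y).
  by apply: rescale_box => //; move: yb; rewrite inE.
have -> : cube_mean s (fun t => F (map (rescale (- K) K) y ++ t)) =
    (2^-1 - - 2^-1) ^+ s * cube_mean s (fun t => F (map (rescale (- K) K) y ++ t)).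
  by rewrite (_ : 2^-1 - - 2^-1 = 1) ?expr1n ?mul1r//; field.
rewrite -(box_integralE HH (mix_section Fm uy)); apply: eq_Rintegral => t tb.
by rewrite Ff// cube_pt_rescale box_pt_rescale.
Qed.

(** The value 1 at level 0 reflects that the first increment is Z_0 itself, bounded but not
    small. *)
Definition prev (a : nat -> R) l : R := if l is l'.+1 then a l' else 1.

Lemma prev_ge0 a l : (forall l, 0 <= a l) -> 0 <= prev a l.
Proof. by case: l => [|l] //=. Qed.

Lemma cube_mean_increments k (Z : nat -> seq R -> R) M L : (forall l, mix k (Z l) (M l)) ->
  \sum_(l < L.+1) cube_mean k (increment Z l) = cube_mean k (Z L).
Proof.
move=> Zm; elim: L => [|L IH]; first by rewrite big_ord1.
rewrite big_ord_recr /= IH [X in _ + X](_ : _ = cube_mean k (Z L.+1) - cube_mean k (Z L)).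
  by rewrite addrC subrK.
exact: cube_meanB (Zm _) (Zm _).
Qed.

(** An increment is a difference of two inner errors, so its squared mixed bound is at most 2 C^2
    (a_l + a_(l - 1)); [lat_gap_bound] then adds the factor of the outer shift. Index 0 of [v] holds
    the purely inner error. *)
Lemma sparse_error_bound k (Zi : seq R -> R) (Z : nat -> seq R -> R) (C Mi : R) (a : nat -> R)
    (z1 : nat -> 'I_k -> nat) (D1 : k.-tuple R) L :
  0 <= C -> (forall l, 0 <= a l) -> mix k Zi Mi -> mix k (Z 0%N) C ->
  (forall l, mix k (fun y => Zi y - Z l y) (C * Num.sqrt (a l))) ->
  (cube_mean k Zi - \sum_(l < L.+1) lat_mean (2 ^ (L - l)) (z1 (L - l)%N) D1 (increment Z l)) ^+ 2
  <= (2 ^+ k * 2 * C ^+ 2) * L.+2%:R *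
     (a L + \sum_(l < L.+1) (a l + prev a l) * lat_gap (2 ^ (L - l)) (z1 (L - l)%N) D1).
Proof.
move=> C0 a0 Zim Z0m Zd.
have Zm l : mix k (Z l) (Mi + C * Num.sqrt (a l)).
  by apply: mix_ext (mixB Zim (Zd l)) => y _; ring.
have incm l : exists2 M, mix k (increment Z l) M & M ^+ 2 <= 2 * C ^+ 2 * (a l + prev a l).
  case: l => [|l].
    by exists C => //=; have := mulr_ge0 (sqr_ge0 C) (a0 0%N); have := sqr_ge0 C; nra.
  exists (C * Num.sqrt (a l) + C * Num.sqrt (a l.+1)).
    by apply: mix_ext (mixB (Zd l) (Zd l.+1)) => y _ /=; ring.
  rewrite /= -mulrDr exprMn.
  rewrite [X in _ <= X](_ : _ = C ^+ 2 * (2 * (a l.+1 + a l))); last by ring.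
  rewrite ler_wpM2l ?sqr_ge0//.
  have := sqr_sqrtr (a0 l); have := sqr_sqrtr (a0 l.+1).
  have := sqr_ge0 (Num.sqrt (a l) - Num.sqrt (a l.+1)).
  by move: (Num.sqrt _) (Num.sqrt _) => x y; nra.
set q := fun l : 'I_L.+1 => lat_mean (2 ^ (L - l)) (z1 (L - l)%N) D1 (increment Z l).
pose v (i : 'I_L.+2) := if unlift ord0 i is Some l then
  cube_mean k (increment Z l) - q l else cube_mean k (fun y => Zi y - Z L y).
have -> : cube_mean k Zi - \sum_l q l = \sum_i v i.
  rewrite [RHS]big_ord_recl {1}/v unlift_none.
  rewrite [in RHS](eq_bigr (fun l : 'I_L.+1 => cube_mean k (increment Z l) - q l)); last first.
    by move=> l _; rewrite /v liftK.
  by rewrite sumrB (cube_mean_increments _ Zm) (cube_meanB Zim (Zm L)); ring.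
apply: (le_trans (sqr_sum_le _)).
rewrite [X in _ <= X](_ : _ = L.+2%:R * ((2 ^+ k * 2 * C ^+ 2) *
     (a L + \sum_(l < L.+1) (a l + prev a l) * lat_gap (2 ^ (L - l)) (z1 (L - l)%N) D1))); last by ring.
rewrite ler_wpM2l// [in leLHS]big_ord_recl {1}/v unlift_none mulrDr mulr_sumr; apply: lerD.
  apply: (@le_trans _ _ ((C * Num.sqrt (a L)) ^+ 2)).
    by rewrite -ler_sqrt ?sqr_ge0// !sqrtr_sqr; apply: le_trans (cube_mean_norm (Zd L)) (ler_norm _).
  rewrite exprMn sqr_sqrtr// ler_wpM2r// ler_peMl ?sqr_ge0//.
  by have : 1 <= 2 ^+ k :> R; [rewrite exprn_ege1// ler1n|lra].
apply: ler_sum => l _; rewrite /v liftK -sqrrN opprB.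
have [M Mm MC] := incm l.
have g0 : (0 < 2 ^ (L - l))%N by rewrite expn_gt0.
apply: (le_trans (lat_gap_bound (z1 (L - l)%N) D1 g0 Mm)).
rewrite mulrA ler_wpM2r ?lat_gap_ge0// -!mulrA ler_wpM2l ?exprn_ge0//.
by apply: le_trans MC _; rewrite expr2 !mulrA.
Qed.

End sparse_error.

Section inner_error.
Variable R : realType.

Lemma lat_meanB d n (z : 'I_d -> nat) (D : d.-tuple R) (F G : seq R -> R) :
  lat_mean n z D (fun t => F t - G t) = lat_mean n z D F - lat_mean n z D G.
Proof. by rewrite /lat_mean -mulrBr sumrB. Qed.

Lemma lat_mean_cst d n (z : 'I_d -> nat) (D : d.-tuple R) (c : R) : (0 < n)%N ->
  lat_mean n z D (fun=> c) = c.
Proof.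
move=> n0; rewrite /lat_mean sumr_const card_ord -[c *+ n]mulr_natl mulKf//.
by rewrite pnatr_eq0 -lt0n.
Qed.

Lemma lat_mean_le d n (z : 'I_d -> nat) (D : d.-tuple R) (F G : seq R -> R) :
  (forall t, ucube d t -> F t <= G t) -> lat_mean n z D F <= lat_mean n z D G.
Proof.
move=> FG; rewrite /lat_mean ler_wpM2l ?invr_ge0//; apply: ler_sum => i _.
by apply: FG; exact/ucubeoW/lat_seq_cube.
Qed.

Lemma eq_lat_mean d n (z : 'I_d -> nat) (D : d.-tuple R) (F G : seq R -> R) :
  (forall t, ucube d t -> F t = G t) -> lat_mean n z D F = lat_mean n z D G.
Proof. by move=> FG; apply/le_anti; rewrite !lat_mean_le// => t /FG ->. Qed.

Lemma lat_mean_norm d n (z : 'I_d -> nat) (D : d.-tuple R) F M : (0 < n)%N ->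
  mix d F M -> `|lat_mean n z D F| <= M.
Proof.
move=> n0 Fm; rewrite ler_norml -{1}(lat_mean_cst z D (- M) n0) -(lat_mean_cst z D M n0).
apply/andP; split; apply: lat_mean_le => t /(mix_norm Fm);
  rewrite ?lat_mean_cst// ler_norml => /andP[]//.
Qed.

Lemma lat_mean_dist d n (z : 'I_d -> nat) (D : d.-tuple R) F M : (0 < n)%N ->
  mix d F M ->
  `|cube_mean d F - lat_mean n z D F| <= Num.sqrt (2 ^+ d * lat_gap n z D) * M.
Proof.
move=> n0 Fm; have M0 := mix_ge0 Fm.
rewrite -sqrtr_sqr -[M in leRHS](ger0_norm M0) -[X in _ * X]sqrtr_sqr -sqrtrM.
  rewrite ler_wsqrtr// -sqrrN opprB.
  by apply: le_trans (lat_gap_bound z D n0 Fm) _; rewrite mulrAC.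
by rewrite mulr_ge0 ?exprn_ge0 ?lat_gap_ge0.
Qed.

(** Through [mix_app], applied to cube mean minus lattice mean, the scalar estimate [lat_mean_dist]
    becomes a mixed bound in y, which [mix_xlogx_diff] carries through x log x with a constant free
    of the rule and the shift. *)
Lemma inner_error k s F (M c : R) : 0 < c -> mix (k + s) F M ->
  (forall w, ucube (k + s) w -> c <= F w) ->
  exists2 C, 0 < C & mix k (fun y => xlogx (cube_mean s (fun t => F (y ++ t)))) C /\
   forall n (z : 'I_s -> nat) (D : s.-tuple R), (0 < n)%N ->
     mix k (fun y => xlogx (lat_mean n z D (fun t => F (y ++ t)))) C /\
     mix k (fun y => xlogx (cube_mean s (fun t => F (y ++ t)))
                   - xlogx (lat_mean n z D (fun t => F (y ++ t))))
       (C * Num.sqrt (lat_gap n z D)).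
Proof.
move=> c0 Fm cF.
have [N N0 NP] := mix_xlogx k M c0; have [N' N'0 N'P] := mix_xlogx_diff k M c0.
have M0 := mix_ge0 Fm.
have cm : mix k (fun y => cube_mean s (fun t => F (y ++ t))) M.
  rewrite -[M]mul1r; apply: (@mix_app _ k s (cube_mean s) 1) Fm => [|H A Hm]; first exact: cube_meanB.
  by rewrite mul1r; exact: cube_mean_norm Hm.
have sec y : ucube k y -> mix s (fun t => F (y ++ t)) M by exact: mix_section.
have cF' y t : ucube k y -> ucube s t -> c <= F (y ++ t).
  move=> /andP[/eqP sy ay] /andP[/eqP st at_]; apply: cF.
  by rewrite /ucube size_cat sy st eqxx all_cat ay.
have cc y : ucube k y -> c <= cube_mean s (fun t => F (y ++ t)).
  by move=> uy; apply: (cube_mean_ge (sec y uy)) => t; exact: cF'.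
exists (N + N' * (Num.sqrt (2 ^+ s) * M) + 1).
  by rewrite ltr_wpDl// addr_ge0 ?mulr_ge0 ?sqrtr_ge0.
have le1 : N <= N + N' * (Num.sqrt (2 ^+ s) * M) + 1.
  by rewrite -addrA lerDl addr_ge0 ?mulr_ge0 ?sqrtr_ge0.
split; first exact: mix_le le1 (NP _ cm cc).
move=> n z D n0.
have lm : mix k (fun y => lat_mean n z D (fun t => F (y ++ t))) M.
  rewrite -[M]mul1r; apply: (@mix_app _ k s (lat_mean n z D) 1) Fm => [H H' A A' _ _|H A Hm]; first exact: lat_meanB.
  by rewrite mul1r; exact: lat_mean_norm Hm.
have lc y : ucube k y -> c <= lat_mean n z D (fun t => F (y ++ t)).
  move=> uy; rewrite -(lat_mean_cst z D c n0); apply: lat_mean_le => t; exact: cF'.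
split; first exact: mix_le le1 (NP _ lm lc).
apply: (@mix_le _ _ _ (N' * (Num.sqrt (2 ^+ s * lat_gap n z D) * M))).
  rewrite sqrtrM ?exprn_ge0// mulrAC [_ * (_ * Num.sqrt _)]mulrA ler_wpM2r ?sqrtr_ge0//.
  by rewrite -addrA addrCA lerDl addr_ge0.
apply: N'P => //.
apply: (@mix_app _ k s (fun H => cube_mean s H - lat_mean n z D H) _) Fm => [H H' A A' Hm H'm|H A Hm].
  by rewrite (cube_meanB Hm H'm) lat_meanB; ring.
exact: lat_mean_dist Hm.
Qed.

End inner_error.

(** * Rates of convergence *)

Section rates.
Variable R : realType.

(** A single term of the series of exp (x (m + 1)) already dominates. With x = delta ln 2 this
    trades powers of m for 2^(delta m). *)
Lemma pow_le_exp p (x : R) : 0 < x ->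
  exists2 C, 0 < C & forall m, m.+1%:R ^+ p.+1 <= C * expR x ^+ m :> R.
Proof.
move=> x0; exists (p.+1`!%:R / x ^+ p.+1 * expR x).
  by rewrite !mulr_gt0 ?invr_gt0 ?exprn_gt0 ?expR_gt0// ltr0n fact_gt0.
move=> m; have x1 : 0 <= x * m.+1%:R by rewrite mulr_ge0// ltW.
have := expR_ge1Dxn p x1; rewrite expRM_natr exprMn => H; rewrite -[_ * _ * expR x ^+ m]mulrA -exprS.
rewrite [leRHS]mulrAC ler_pdivlMr ?exprn_gt0// mulrC.
rewrite [leRHS]mulrC -ler_pdivrMr ?ltr0n ?fact_gt0//.
by apply: le_trans H; rewrite lerDr.
Qed.

Lemma powR_expr (a x : R) n : 0 <= a -> (a ^+ n) `^ x = (a `^ x) ^+ n.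
Proof.
by move=> a0; rewrite -(powR_mulrn n a0) -powRrM mulrC powRrM powR_mulrn// powR_ge0.
Qed.

Lemma cbc_gap_rate d (delta : R) : 0 < delta ->
  exists2 C, 0 < C & forall m, cbc_gap R d m <= C * (2 `^ (- 1 + delta)) ^+ m.
Proof.
move=> d0; have l2 : 0 < delta * ln 2 :> R by rewrite mulr_gt0// ln_gt0// ltr1n.
have [C C0 CP] := pow_le_exp d.+1 l2.
(* The 8 comes from 1 + 2 (m + 1) m <= 2 (m + 1)^2 and the 4 in [cbc_gap]. *)
exists (8 * 4 ^+ d * C) => [|m]; first by rewrite !mulr_gt0 ?exprn_gt0.
have -> : 2 `^ (- 1 + delta) = 2^-1 * expR (delta * ln 2) :> R.
  rewrite powRD; last by rewrite pnatr_eq0 implybT.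
  by rewrite powR_inv1// /powR pnatr_eq0.
rewrite [_ ^+ m]exprMn exprVn /cbc_gap natrX ler_pdivrMr ?exprn_gt0//.
have p2 : 2 ^+ m != 0 :> R by rewrite expf_neq0.
rewrite [leRHS](_ : _ = 8 * 4 ^+ d * (C * expR (delta * ln 2) ^+ m)); last by field.
apply: (@le_trans _ _ (8 * 4 ^+ d * m.+1%:R ^+ d.+2)).
  rewrite exprMn 2!exprS natrM -(natr1 m); have := ler0n R m.
  set x : R := m%:R; set y := 4 ^+ d; set z := (x + 1) ^+ d => x0.
  have yz : 0 <= y * z by rewrite mulr_ge0 ?exprn_ge0// addr_ge0.
  have -> : 8 * y * ((x + 1) * ((x + 1) * z)) =
    4 * (y * z) * (1 + 2 * ((x + 1) * x)) + (y * z) * (4 + 8 * x) by ring.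
  by rewrite lerDl mulr_ge0//; lra.
by rewrite ler_wpM2l ?mulr_ge0 ?exprn_ge0.
Qed.

(** Every summand is of size r^L, as the inner and outer exponents add up to L. The term Ka / r pays
    for the index shift in [prev], and the 1 for its value at level 0. *)
Lemma rate_sum (Ka Kb r : R) L : 0 <= Ka -> 0 <= Kb -> 0 < r ->
  Ka * r ^+ L + \sum_(l < L.+1) (Ka * r ^+ l + prev (fun l => Ka * r ^+ l) l) * (Kb * r ^+ (L - l))
  <= L.+1%:R * ((Ka + (Ka + Ka / r + 1) * Kb) * r ^+ L).
Proof.
move=> Ka0 Kb0 r0.
have r0' := ltW r0.
have H (l : 'I_L.+1) : (Ka * r ^+ l + prev (fun l => Ka * r ^+ l) l) * (Kb * r ^+ (L - l)) <=
    (Ka + Ka / r + 1) * Kb * r ^+ L.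
  have lL : (l <= L)%N by rewrite -ltnS.
  have -> : r ^+ L = r ^+ l * r ^+ (L - l) by rewrite -exprD subnKC.
  rewrite [leRHS](_ : _ = ((Ka + Ka / r + 1) * r ^+ l) * (Kb * r ^+ (L - l))); last by ring.
  rewrite ler_wpM2r ?mulr_ge0 ?exprn_ge0//.
  have Kr : 0 <= Ka / r by rewrite divr_ge0// ltW.
  case: (l : nat) => [|l'] /=; first by rewrite ?expr0 ?mulr1; lra.
  have e : Ka * r ^+ l' = Ka / r * r ^+ l'.+1 by rewrite exprS mulrA mulfVK// gt_eqF.
  by rewrite e -mulrDl ler_wpM2r ?exprn_ge0// lerDl.
apply: le_trans (lerD (lexx _) (ler_sum _ (fun l _ => H l))) _.
rewrite sumr_const card_ord -[_ *+ L.+1]mulr_natl [in leRHS]mulrDl [in leRHS]mulrDr lerD2r.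
by rewrite ler_peMl ?mulr_ge0 ?exprn_ge0// ler1n.
Qed.

End rates.

Section expectation.
Context d (Omega : measurableType d) (R : realType).
Variable P : probability Omega R.

Lemma integral_lat_gap_cbc n (X : {RV P >-> n.-tuple R}) m (z : 'I_n -> nat) :
  uniform01 X -> cbc_output (fun=> 1 : R) (2 ^ m) z ->
  (\int[P]_w (lat_gap (2 ^ m) z (X w))%:E <= (n%:R * cbc_gap R n m ^+ 2)%:E)%E.
Proof.
move=> uX zP; have m0 : (0 < 2 ^ m)%N by rewrite expn_gt0.
rewrite (integral_uniform01 uX (f := fun t => (lat_gap (2 ^ m) z t)%:E)); last 2 first.
- by apply/measurable_EFinP; exact: measurable_lat_gap.
- by move=> t; rewrite lee_fin lat_gap_ge0.
rewrite integral_lat_gap// lee_fin; apply: le_trans (cbc_partial_bound zP (leqnn n)).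
rewrite ler_wpM2l ?invr_ge0//; apply: ler_sum => i _; rewrite lerD2r le_eqVlt.
by apply/orP; left; apply/eqP; apply: eq_bigl => j; rewrite ltn_ord.
Qed.

Lemma integral_sum_bound k s (X : {RV P >-> k.-tuple R}) (Y : {RV P >-> s.-tuple R}) n
    (f : s.-tuple R -> R) (g : nat -> s.-tuple R -> R) (h : nat -> k.-tuple R -> R)
    (c phi : R) (gam eta : nat -> R) : independent_rv X Y -> 0 <= c ->
  measurable_fun setT f -> (forall l, measurable_fun setT (g l)) ->
  (forall l, measurable_fun setT (h l)) ->
  (forall t, 0 <= f t) -> (forall l t, 0 <= g l t) -> (forall l t, 0 <= h l t) ->
  (\int[P]_w (f (Y w))%:E <= phi%:E)%E ->
  (forall l, \int[P]_w (g l (Y w))%:E <= (gam l)%:E)%E ->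
  (forall l, \int[P]_w (h l (X w))%:E <= (eta l)%:E)%E ->
  (\int[P]_w (c * (f (Y w) + \sum_(l < n) g l (Y w) * h l (X w)))%:E <=
    (c * (phi + \sum_(l < n) gam l * eta l))%:E)%E.
Proof.
move=> iXY c0 mf mg mh f0 g0 h0 fI gI hI.
have mfY : measurable_fun setT (fun w => f (Y w)).
  exact: (measurableT_comp mf (measurable_funPT Y)).
have mgh l : measurable_fun setT (fun w => g l (Y w) * h l (X w)).
  apply: measurable_funM.
    exact: (measurableT_comp (mg l) (measurable_funPT Y)).
  exact: (measurableT_comp (mh l) (measurable_funPT X)).
have gh0 l w : 0 <= g l (Y w) * h l (X w) by rewrite mulr_ge0.
have msum : measurable_fun setT (fun w => \sum_(l < n) g l (Y w) * h l (X w)).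
  by apply: measurable_sum => l; exact: mgh.
have sum0 w : 0 <= \sum_(l < n) g l (Y w) * h l (X w) by apply: sumr_ge0.
under eq_integral do rewrite EFinM.
rewrite ge0_integralZl_EFin//; last 2 first.
- by move=> w _; rewrite lee_fin addr_ge0.
- by apply/measurable_EFinP; apply: measurable_funD.
rewrite EFinM lee_wpmul2l ?lee_fin//.
under eq_integral do rewrite EFinD.
rewrite ge0_integralD//; last 4 first.
- by move=> w _; rewrite lee_fin.
- exact/measurable_EFinP.
- by move=> w _; rewrite lee_fin.
- exact/measurable_EFinP.
rewrite EFinD leeD//.
under eq_integral do rewrite -sumEFin.
rewrite ge0_integral_sum//; last 2 first.
- by move=> l; apply/measurable_EFinP; exact: mgh.
- by move=> l w _; rewrite lee_fin.
rewrite -sumEFin; apply: lee_sum => l _.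
under eq_integral do rewrite mulrC.
rewrite (integral_independent iXY)// EFinM muleC.
by apply: lee_pmul => //; apply: integral_ge0 => w _; rewrite lee_fin.
Qed.

End expectation.

Theorem theorem8p3 (R : realType)
  (k q : nat) (k_gt0 : (0 < k)%N)
  (K : R) (K_gt0 : 0 < K)
  (Xi : set 'cV[R]_q) (Xi_compact : compact Xi)
  (Gamma : 'M[R]_k) (Gamma_posdef : posdef Gamma)
  (mu_min : R) (mu_min_gt0 : 0 < mu_min) (mu_min_le1 : mu_min <= 1)
  (mu_min_lb : forall a, eigenvalue Gamma a -> mu_min <= a)
  (C beta p : R) (C_ge1 : 1 <= C) (beta_ge1 : 1 <= beta)
  (p_gt0 : 0 < p) (p_lt1 : p < 1)
  (b : nat -> R) (b_ge0 : forall j, 0 <= b j)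
  (b_summable : cvgn (series (fun j => b j `^ p)))
  (G : forall s, 'cV[R]_s -> 'cV[R]_q -> 'cV[R]_k)
  (G_smooth : forall s xi, (0 < s)%N -> Xi xi ->
    smooth_in (cube s) (fun theta => G s theta xi))
  (G_bound : forall s (nu : 'I_s -> nat) theta xi,
    (0 < s)%N -> cube s theta -> Xi xi ->
    enorm (mixed_partial (cube s) nu (fun t => G s t xi) theta)
      <= C * (((\sum_(j < s) nu j)`!)%:R `^ beta) * \prod_(j < s) b j ^+ nu j)
  (p_le : p <= Num.min (2 / 3) beta^-1) (p_neq : p != beta^-1)
  (s : nat) (s_gt0 : (0 < s)%N)
  (xi : 'cV[R]_q) (Xi_xi : Xi xi)
  (delta : R) (delta_gt0 : 0 < delta)
  (d : measure_display) (Omega : measurableType d) (P : probability Omega R)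
  (Delta1 : {RV P >-> k.-tuple R}) (Delta2 : {RV P >-> s.-tuple R})
  (Delta1_unif : uniform01 Delta1) (Delta2_unif : uniform01 Delta2)
  (Delta_indep : independent_rv Delta1 Delta2) :
  let f := likelihood Gamma (fun theta => G s theta xi) in
  exists (gamma1 : {set 'I_k} -> R) (gamma2 : {set 'I_s} -> R),
    (forall u, 0 < gamma1 u) /\ (forall u, 0 < gamma2 u) /\
    exists (l0 : nat) (C' : R), 0 < C' /\
    forall (z1 : nat -> 'I_k -> nat) (z2 : nat -> 'I_s -> nat),
      (forall m, cbc_output gamma1 (2 ^ m) (z1 m)) ->
      (forall m, cbc_output gamma2 (2 ^ m) (z2 m)) ->
    forall L : nat,
      (sqrte ('E_P[fun w =>
         (`|double_integral K f -
           sparse_Q K l0 z1 z2 (vec (Delta1 w)) (vec (Delta2 w)) L f| ^+ 2)%R])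
       <= (C' * (2 ^+ L) `^ (- 1 + delta) * (L.+1)%:R)%:E)%E.
Proof.
move=> f; exists (fun=> 1), (fun=> 1); do 2!split=> //; exists 0%N.
pose B (nu : 'I_s -> nat) : R :=
  C * (((\sum_(j < s) nu j)`!)%:R `^ beta) * \prod_(j < s) b j ^+ nu j.
have [MG MG0 Gm] := @smooth_mix R s k (fun t => G s t xi) B (G_smooth s xi s_gt0 Xi_xi)
  (fun nu x xc => G_bound s nu x xi s_gt0 xc Xi_xi).
have [c [M [c0 Fm cF]]] :=
  likelihood_mix (G := fun t => G s t xi) K Gamma_posdef Gm.
set F := fun w : seq R => _ in Fm cF.
have Ff y t : ucube k y -> F (y ++ t) = f (cube_pt s t) (box_pt k K y).
  move=> /andP[/eqP sy _]; have dy : drop k (y ++ t) = t by rewrite drop_size_cat.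
  have by_ : box_pt k K (y ++ t) = box_pt k K y.
    by apply/matrixP => i j; rewrite !mxE nth_cat sy ltn_ord.
  by rewrite /F dy by_.
have {}cF w : ucube (k + s) w -> c <= F w := cF w.
clearbody f F.
have [C1 C10 [Zim Zm]] := inner_error c0 Fm cF.
set Zi := fun y : seq R => _ in Zim.
have [Ck Ck0 Ckr] := cbc_gap_rate k delta_gt0.
have [Cs Cs0 Csr] := cbc_gap_rate s delta_gt0.
set rho := 2 `^ (- 1 + delta) in Ckr Csr.
have rho0 : 0 < rho by exact: powR_gt0.
pose r := rho ^+ 2; have r0 : 0 < r by exact: exprn_gt0.
(* Constants of the averaged inner and outer [lat_gap]: one squared [cbc_gap] for each of the s or k
   components. *)
pose Ka := s%:R * Cs ^+ 2; pose Kb := k%:R * Ck ^+ 2.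
have Ka0 : 0 <= Ka by rewrite mulr_ge0 ?sqr_ge0.
have Kb0 : 0 <= Kb by rewrite mulr_ge0 ?sqr_ge0.
pose K' := Ka + (Ka + Ka / r + 1) * Kb.
have K'0 : 0 <= K'.
  have q0 : 0 <= Ka / r by rewrite divr_ge0// ltW.
  by rewrite addr_ge0// mulr_ge0//; lra.
(* The volume of the outer box, squared, times the constant of [sparse_error_bound]. *)
pose cc := ((2 * K) ^+ k) ^+ 2 * (2 ^+ k * 2 * C1 ^+ 2).
have cc0 : 0 <= cc by rewrite !mulr_ge0 ?exprn_ge0 ?mulr_ge0 ?(ltW K_gt0) ?(ltW C10).
exists (Num.sqrt (cc * 2 * K') + 1); split; first by rewrite ltr_wpDl ?sqrtr_ge0.
move=> z1 z2 z1P z2P L.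
pose a l (t : s.-tuple R) := lat_gap (2 ^ l) (z2 l) t.
pose g l (t : s.-tuple R) := a l t + prev (a ^~ t) l.
pose h l (t : k.-tuple R) := lat_gap (2 ^ (L - l)) (z1 (L - l)%N) t.
have a0 l t : 0 <= a l t by rewrite lat_gap_ge0// expn_gt0.
have g0 l t : 0 <= g l t by rewrite addr_ge0// prev_ge0.
have h0 l t : 0 <= h l t by rewrite lat_gap_ge0// expn_gt0.
have ma l : measurable_fun setT (a l) by exact: measurable_lat_gap.
have mg l : measurable_fun setT (g l).
  by apply: measurable_funD => //; case: l => [|l]; [exact: measurable_cst|exact: ma].
have mh l : measurable_fun setT (h l) by exact: measurable_lat_gap.
have sq n (Cn : R) m : 0 <= Cn -> cbc_gap R n m <= Cn * rho ^+ m ->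
    n%:R * cbc_gap R n m ^+ 2 <= n%:R * Cn ^+ 2 * r ^+ m.
  move=> Cn0 H; rewrite -mulrA ler_wpM2l// -exprM mulnC exprM -exprMn.
  have gap0 : 0 <= cbc_gap R n m.
    by rewrite divr_ge0// mulr_ge0 ?addr_ge0 ?mulr_ge0 ?exprn_ge0 ?mulr_ge0.
  by rewrite lerXn2r// nnegrE// (le_trans gap0).
have aI l : (\int[P]_w (a l (Delta2 w))%:E <= (Ka * r ^+ l)%:E)%E.
  apply: le_trans (integral_lat_gap_cbc Delta2_unif (z2P l)) _.
  by rewrite lee_fin; apply: sq => //; exact: ltW.
have hI l : (\int[P]_w (h l (Delta1 w))%:E <= (Kb * r ^+ (L - l))%:E)%E.
  apply: le_trans (integral_lat_gap_cbc Delta1_unif (z1P (L - l)%N)) _.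
  by rewrite lee_fin; apply: sq => //; exact: ltW.
have gI l : (\int[P]_w (g l (Delta2 w))%:E <=
    (Ka * r ^+ l + prev (fun l => Ka * r ^+ l) l)%:E)%E.
  have maY l' : measurable_fun setT (fun w => (a l' (Delta2 w))%:E).
    by apply/measurable_EFinP; exact: (measurableT_comp (ma l') (measurable_funPT Delta2)).
  rewrite /g; case: l => [|l] /=; under eq_integral do rewrite EFinD.
    rewrite ge0_integralD//; last by move=> w _; rewrite lee_fin.
    rewrite EFinD leeD// integral_cst// mul1e; exact: probability_le1.
  rewrite ge0_integralD//; try by move=> w _; rewrite lee_fin.
  by rewrite EFinD leeD.
have err w : (double_integral K f -
    sparse_Q K 0 z1 z2 (vec (Delta1 w)) (vec (Delta2 w)) L f) ^+ 2 <=
    cc * L.+2%:R * (a L (Delta2 w) + \sum_(l < L.+1) g l (Delta2 w) * h l (Delta1 w)).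
  rewrite (double_integralE K_gt0 Ff Fm Zim) sparse_QE -mulrBr exprMn.
  rewrite [leRHS](_ : _ = ((2 * K) ^+ k) ^+ 2 * ((2 ^+ k * 2 * C1 ^+ 2) * L.+2%:R *
    (a L (Delta2 w) + \sum_(l < L.+1) g l (Delta2 w) * h l (Delta1 w)))); last by rewrite /cc; ring.
  rewrite ler_wpM2l ?sqr_ge0//.
  have n0 l : (0 < 2 ^ l)%N by rewrite expn_gt0.
  pose Z l (y : seq R) := xlogx (lat_mean (2 ^ l) (z2 l) (Delta2 w) (fun t => F (y ++ t))).
  rewrite [X in (_ - X) ^+ 2](_ : _ = \sum_(l < L.+1)
      lat_mean (2 ^ (L - l)) (z1 (L - l)%N) (Delta1 w) (increment Z l)).
    exact: (@sparse_error_bound R k Zi Z C1 C1 (a ^~ (Delta2 w)) z1 (Delta1 w) L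
      (ltW C10) (a0 ^~ _) Zim (Zm _ (z2 0%N) (Delta2 w) (n0 0%N)).1
      (fun l => (Zm _ (z2 l) (Delta2 w) (n0 l)).2)).
  apply: eq_bigr => l _; apply: eq_lat_mean => y uy.
  have E l' : Z l' y = xlogx (lat_mean (2 ^ l') (z2 l') (Delta2 w)
      (fun t => f (cube_pt s t) (box_pt k K y))).
    by rewrite /Z (eq_lat_mean _ _ _ (fun t _ => Ff y t uy)).
  by rewrite /increment; case: (l : nat) => [|l']; rewrite !E.
have : ('E_P[fun w => (`|double_integral K f -
    sparse_Q K 0 z1 z2 (vec (Delta1 w)) (vec (Delta2 w)) L f| ^+ 2)%R] <=
    (cc * 2 * K' * (L.+1%:R * rho ^+ L) ^+ 2)%:E)%E.
  rewrite unlock.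
  apply: (@le_trans _ _ (\int[P]_w (cc * L.+2%:R *
      (a L (Delta2 w) + \sum_(l < L.+1) g l (Delta2 w) * h l (Delta1 w)))%:E)%E).
    apply: le_integral_nonmeasurable => w; first by rewrite lee_fin exprn_ge0.
    by rewrite lee_fin real_normK ?num_real//; exact: err.
  apply: le_trans (integral_sum_bound L.+1 Delta_indep (mulr_ge0 cc0 (ler0n _ L.+2))
      (ma L) mg mh (a0 L) g0 h0 (aI L) gI hI) _.
  rewrite lee_fin; apply: le_trans (ler_wpM2l _ (rate_sum L Ka0 Kb0 r0)) _.
    by rewrite mulr_ge0.
  rewrite -/K' (_ : r ^+ L = (rho ^+ L) ^+ 2); last by rewrite /r -!exprM mulnC.
  rewrite [leRHS](_ : _ = cc * (2 * L.+1%:R) * (L.+1%:R * (K' * (rho ^+ L) ^+ 2))); last by ring.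
  (* One factor L + 2 stems from Cauchy-Schwarz, a factor L + 1 from [rate_sum]; with this estimate
     the mean square carries (L + 1)^2, whose root is the factor claimed. *)
  have LL : L.+2%:R <= 2 * L.+1%:R :> R by rewrite -natrM ler_nat mul2n -addnn addSn ltnS leq_addl.
  apply: ler_wpM2r; last exact: ler_wpM2l.
  by rewrite mulr_ge0// mulr_ge0// sqr_ge0.
have W0 : 0 <= cc * 2 * K' by rewrite mulr_ge0// mulr_ge0.
have x0 : 0 <= rho ^+ L by rewrite exprn_ge0// ltW.
rewrite powR_expr// -/rho; clearbody rho.
move: (cc * 2 * K') (rho ^+ L) W0 x0 ('E_P[_])%E => W x W0 x0 E EB.
apply: (@le_trans _ _ (sqrte (W * (L.+1%:R * x) ^+ 2)%:E)).
  by rewrite lee_sqrt// lee_fin mulr_ge0// sqr_ge0.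
rewrite /= lee_fin sqrtrM// sqrtr_sqr ger0_norm ?mulr_ge0//.
by rewrite -mulrA [x * _]mulrC ler_wpM2r ?mulr_ge0// lerDl.
Qed.
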